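(* Let $f\in\mathbf F(w,y,\kappa,\lambda,u,\omega,\omega')$, $n\in\mathbb N$, $B>0$, and a Schwartz function $h$ on $\mathbb R$ be given, and assume that $$\kappa\ge1+\iota'(4),\quad n-w>\kappa+\iota'+\iota'(12),\quad u+\lfloor\lambda\rfloor>\kappa+\iota',\quad\tilde\lambda=\min(\kappa-\rho_p(y),\lambda)>0.$$ Let $\varepsilon_\lambda=\lfloor\lambda\rfloor-\lceil\tilde\lambda\rceil$. Then there exist a power series $$\mathring f\in\mathbf F\big(w+\mathrm{ord}_py,\ y^{-1},\ \kappa,\ \tilde\lambda,\ u+\varepsilon_\lambda-\mathrm{ord}_py,\ \omega'^{-1},\ -\omega^{-1}\big)$$ depending on $f$ only (not on $n$, $B$, $h$) and an $\epsilon\in\mathbb C$ with $|\epsilon|=1$, such that $$\sum_{m\in\mathbb Z}e\left(\frac{f(m)}{p^n}\right)h\left(\frac mB\right)=\frac{\epsilon B}{p^{(n-w-\iota'-\kappa)/2}}\sum_{t\in\mathbb Z}e\left(\frac{\mathring f(t)}{p^n}\right)\hat h_{f,B}\left(\frac{t}{p^{n-w-\iota'-\kappa}/B}\right),$$ where $\hat h_{f,B}$ is the reflected translate of the Fourier transform $\hat h$ given by $$\hat h_{f,B}(t)=\hat h\left(-t-\frac{f'(0)}{p^n/B}\right);$$ here, in the real number $f'(0)/(p^n/B)$, $f'(0)\in p^w\mathbb Z_p$ is to be replaced by any $a\in p^w\mathbb Z$ with $a-f'(0)\in p^n\mathbb Z_p$ (a fixed choice of such $a$).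
   Context: $p$ is a prime, $\mathbb N=\{1,2,\dots\}$, $\rho_p=1/(p-1)$. $e(x)=e^{2\pi i x}$, also extended from $\mathbb Z[1/p]$ to the unique $\mathbb Z_p$-periodic function on $\mathbb Q_p$. $\hat h(s)=\int_{\mathbb R}h(x)e(-sx)\,dx$. For a positive rational $y$: $\iota(y)=\max(0,-\mathrm{ord}_py)$, $\iota'(y)=\max(0,\mathrm{ord}_py)$; $\iota,\iota'$ without argument mean $\iota(y),\iota'(y)$. $\rho_p(y)=\rho_p$ if $\mathrm{ord}_py\ne0$ and $\rho_p(y)=0$ otherwise. $\mathbf I_0(\mathbb Z_p)$ is the set of power series $\sum_{k\ge0}a_kt^k$ with $a_k\in\mathbb Z_p$, $|a_k|_p\to0$; $\mathbf I_0[\lambda](\mathbb Z_p)=\{a\in\mathbf I_0(\mathbb Z_p):\mathrm{ord}_pa_k\ge\lceil k\lambda\rceil\ \forall k\ge0\}$ for real $\lambda\ge0$. $(1+x)^y=\sum_k\binom ykx^k$. Let $w\in\mathbb Z$, $u,\kappa\in\mathbb N$ with $\kappa\ge1+\iota'(2)$, $\lambda\in\rho_p\mathbb N$, $y\in\mathbb Q^+$, $\omega,\omega'\in\mathbb Z_p^\times$. A power series $f\in\mathbb Q_p^\times\mathbf I_0(\mathbb Z_p)$ belongs to $\mathbf F(w,y,\kappa,\lambda,u,\omega,\omega')$ if $f'(t)=p^w\omega'(1+p^{\iota(y)+\kappa}\omega t)^{-y}+p^w\gamma_0+p^{u+w}g(t)$ for some $\gamma_0\in\mathbb Z_p$ and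 $g\in\mathbf I_0[\lambda](\mathbb Z_p)$. *)

(* Defs.v *)
From HB Require Import structures.
From mathcomp Require Import all_boot all_order all_algebra.
From mathcomp Require Import complex.
From mathcomp Require Import all_classical all_reals all_analysis.

Set Implicit Arguments.
Unset Strict Implicit.
Unset Printing Implicit Defensive.

Import Order.TTheory GRing.Theory Num.Theory.
Import numFieldNormedType.Exports.

Local Open Scope ring_scope.

(* Z_p is the inverse limit of the rings Z/p^n: [pint_res x n] is the residue
   of x modulo p^n, represented in {0, ..., p^n - 1}. The primality proof is
   carried by the type so that the ring structure can be inferred from it. *)
Record pint (p : nat) (hp : prime p) := PInt {
  pint_res :> nat -> int;
  pint_resP : `[< forall n, pint_res n = (pint_res n.+1 %% p%:Z ^+ n)%Z >] }.

Section PInt.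
Variables (p : nat) (hp : prime p).
Local Notation Zp := (pint hp).
Local Notation P n := (p%:Z ^+ n).
Implicit Types x y z : Zp.

HB.instance Definition _ := [isSub for @pint_res p hp].
HB.instance Definition _ := gen_eqMixin Zp.
HB.instance Definition _ := gen_choiceMixin Zp.

Lemma pint_ext x y : (forall n, x n = y n) -> x = y.
Proof. by move=> xy; apply/val_inj/funext. Qed.

Lemma pint_resE x n : x n = (x n.+1 %% P n)%Z.
Proof. by case: x => f /= /asboolP. Qed.

Lemma pint_res_mod x n : (x n %% P n)%Z = x n.
Proof. by rewrite pint_resE modz_mod. Qed.

Lemma modz_expS (a : int) n : modz (modz a (P n.+1)) (P n) = modz a (P n).
Proof.
rewrite {2}(divz_eq a (P n.+1)) exprS mulrA.
by rewrite -[in RHS]modzDml modzMl add0r.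
Qed.

(* The p-adic integer whose residue modulo p^n is that of [f n], for a
   sequence f coherent modulo the powers of p. *)
Definition pint_mk_res (f : nat -> int) n := (f n %% P n)%Z.

Lemma pint_mk_subproof (f : nat -> int) :
  (forall n, (f n.+1 %% P n)%Z = (f n %% P n)%Z) ->
  `[< forall n, pint_mk_res f n = (pint_mk_res f n.+1 %% P n)%Z >].
Proof. by move=> fE; apply/asboolP => n; rewrite /pint_mk_res modz_expS fE. Qed.

Definition pint_mk f fE : Zp := PInt hp (@pint_mk_subproof f fE).

Lemma pint_constE (a : int) n : (a %% P n)%Z = (a %% P n)%Z. Proof. by []. Qed.
Definition pint_const (a : int) : Zp := pint_mk (pint_constE a).

Lemma pint_addE x y n :
  ((x n.+1 + y n.+1) %% P n)%Z = ((x n + y n) %% P n)%Z.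
Proof. by rewrite -modzDm -!pint_resE. Qed.
Definition pint_add x y : Zp := pint_mk (pint_addE x y).

Lemma pint_oppE x n : ((- x n.+1) %% P n)%Z = ((- x n) %% P n)%Z.
Proof. by rewrite -modzNm -pint_resE. Qed.
Definition pint_opp x : Zp := pint_mk (pint_oppE x).

Lemma pint_mulE x y n :
  ((x n.+1 * y n.+1) %% P n)%Z = ((x n * y n) %% P n)%Z.
Proof. by rewrite -modzMm -!pint_resE. Qed.
Definition pint_mul x y : Zp := pint_mk (pint_mulE x y).

Fact pint_addA : associative pint_add.
Proof.
move=> x y z; apply: pint_ext => n /=.
by rewrite /pint_mk_res /= /pint_mk_res modzDmr modzDml addrA.
Qed.

Fact pint_addC : commutative pint_add.
Proof. by move=> x y; apply: pint_ext => n /=; rewrite /pint_mk_res addrC. Qed.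

Fact pint_add0 : left_id (pint_const 0) pint_add.
Proof.
move=> x; apply: pint_ext => n /=.
by rewrite /pint_mk_res /= /pint_mk_res modzDml add0r pint_res_mod.
Qed.

Fact pint_addN : left_inverse (pint_const 0) pint_opp pint_add.
Proof.
move=> x; apply: pint_ext => n /=.
by rewrite /pint_mk_res /= /pint_mk_res modzDml addNr.
Qed.

HB.instance Definition _ :=
  GRing.isZmodule.Build Zp pint_addA pint_addC pint_add0 pint_addN.

Fact pint_mulA : associative pint_mul.
Proof.
move=> x y z; apply: pint_ext => n /=.
by rewrite /pint_mk_res /= /pint_mk_res modzMmr modzMml mulrA.
Qed.

Fact pint_mulC : commutative pint_mul.
Proof. by move=> x y; apply: pint_ext => n /=; rewrite /pint_mk_res mulrC. Qed.

Fact pint_mul1 : left_id (pint_const 1) pint_mul.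
Proof.
move=> x; apply: pint_ext => n /=.
by rewrite /pint_mk_res /= /pint_mk_res modzMml mul1r pint_res_mod.
Qed.

Fact pint_mulD : left_distributive pint_mul pint_add.
Proof.
move=> x y z; apply: pint_ext => n /=.
by rewrite /pint_mk_res /= /pint_mk_res modzMml modzDm mulrDl.
Qed.

Fact pint_1neq0 : pint_const 1 != 0.
Proof.
apply/eqP => /(congr1 (fun x : Zp => x 1%N)) /=.
rewrite /pint_mk_res /= expr1 mod0z modz_small //.
by rewrite ltz_nat prime_gt1.
Qed.

HB.instance Definition _ := GRing.Zmodule_isComNzRing.Build Zp
  pint_mulA pint_mulC pint_mul1 pint_mulD pint_1neq0.

Lemma pint0E n : (0 : Zp) n = 0.
Proof. by rewrite /= /pint_mk_res mod0z. Qed.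

Lemma pintME x y n : (x * y) n = ((x n * y n) %% P n)%Z.
Proof. by []. Qed.

Lemma pint_res_le x m n : (m <= n)%N -> x m = (x n %% P m)%Z.
Proof.
move=> /subnK <-; elim: (n - m)%N => [|k IH]; first by rewrite pint_res_mod.
rewrite IH addSn [x (k + m)%N]pint_resE exprD.
rewrite [in RHS](divz_eq (x (k + m).+1) (P k * P m)) mulrA.
by rewrite -[in RHS]modzDml modzMl add0r.
Qed.

Lemma pint_neq0 x : x != 0 -> exists n, x n.+1 != 0.
Proof.
move=> x0; apply: contrapT => /forallNP h; move/eqP: x0; apply.
apply: pint_ext => n; rewrite pint0E.
case: n => [|n]; first by rewrite pint_resE expr0 modz1.
by apply/eqP; rewrite -[_ == _]negbK; apply/negP/h.
Qed.

Definition pint_unit : pred Zp := fun x => `[< exists y : Zp, y * x = 1 >].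
Definition pint_inv x : Zp :=
  if pselect (exists y : Zp, y * x = 1) is left h then projT1 (cid h) else x.

Fact pint_mulVx : {in pint_unit, left_inverse 1 pint_inv *%R}.
Proof.
move=> x /asboolP ux; rewrite /pint_inv; case: pselect => // h.
exact: (projT2 (cid h)).
Qed.

Fact pint_unitPl x y : y * x = 1 -> pint_unit x.
Proof. by move=> yx; apply/asboolP; exists y. Qed.

Fact pint_inv_out : {in [predC pint_unit], pint_inv =1 id}.
Proof.
move=> x /negP nx; rewrite /pint_inv; case: pselect => // h.
by case: nx; apply/asboolP.
Qed.

HB.instance Definition _ := GRing.ComNzRing_hasMulInverse.Build Zp
  pint_mulVx pint_unitPl pint_inv_out.

Fact pint_idomain x y : x * y = 0 -> (x == 0) || (y == 0).
Proof.
move=> xy0; apply/norP => -[/pint_neq0[m xm] /pint_neq0[n yn]].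
pose N := (m.+1 + n.+1)%N.
have xm' : (P m.+1 %| x N)%Z = false.
  apply/negbTE; apply: contraNN xm => /dvdz_mod0P.
  by rewrite -pint_res_le ?leq_addr // => ->.
have yn' : (P n.+1 %| y N)%Z = false.
  apply/negbTE; apply: contraNN yn => /dvdz_mod0P.
  by rewrite -pint_res_le ?leq_addl // => ->.
have : (P N %| x N * y N)%Z by apply/dvdz_mod0P; rewrite -pintME xy0 pint0E.
move: xm' yn'; rewrite /N !dvdzE !abszX abszM !absz_nat.
set a := `|x _|%N; set b := `|y _|%N => am bn abN.
have a0 : (0 < a)%N by rewrite lt0n; apply: contraFneq am => ->.
have b0 : (0 < b)%N by rewrite lt0n; apply: contraFneq bn => ->.
move: am bn abN.
rewrite !pfactor_dvdn // ?muln_gt0 ?a0 // lognM //.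
move=> /negbT; rewrite -ltnNge => h1 /negbT; rewrite -ltnNge => h2.
apply/negP; rewrite -ltnNge addSn addnS.
by rewrite ltnS leqW // leq_add.
Qed.

HB.instance Definition _ := GRing.ComUnitRing_isIntegral.Build Zp pint_idomain.

End PInt.

Notation padic hp := {fraction (pint hp)}.

Section Padic.
Variables (p : nat) (hp : prime p).
Local Notation Zp := (pint hp).
Local Notation Qp := (padic hp).
Local Notation tofrac := (@FracField.tofrac Zp).

(* The p-adic valuation, with value +oo at 0: the order of a nonzero [x] in Z_p
   is the largest n such that x = 0 mod p^n, and [repr x] is a fraction of
   elements of Z_p representing [x] in Q_p. *)
Definition pint_ord (x : Zp) : \bar int :=
  if pselect (exists n, x n.+1 != 0) is left ex_n then (ex_minn ex_n)%:Z%:E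
  else +oo%E.

Definition padic_ord (x : Qp) : \bar int :=
  (pint_ord (repr x).1 - pint_ord (repr x).2)%E.

(* |x|_p = p^(- ord x), as a rational number. *)
Definition padic_abs (x : Qp) : rat :=
  if padic_ord x is EFin v then p%:R ^ (- v) else 0.

Definition padic_cvg (s : nat -> Qp) (l : Qp) :=
  forall eps : rat, 0 < eps ->
    exists n0 : nat, forall n, (n0 <= n)%N -> padic_abs (s n - l) < eps.

(* A power series is represented by the sequence of its coefficients. *)
Definition psder (f : nat -> Qp) : nat -> Qp := fun k => k.+1%:R * f k.+1.

(* The sum of the series at [x]; unspecified if the series diverges. *)
Definition pseval (f : nat -> Qp) (x : Qp) : Qp :=
  xget 0 [set l | padic_cvg (fun n => \sum_(k < n) f k * x ^+ k) l]%classic.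

(* The power series (1 + c t)^y in t. *)
Definition psbinom (y : rat) (c : Qp) : nat -> Qp := fun k =>
  ratr ((\prod_(i < k) (y - i%:R)) / k`!%:R) * c ^+ k.

(* Membership in I_0(Z_p). *)
Definition psI0 (a : nat -> Zp) := padic_cvg (fun k => tofrac (a k)) 0.

(* Membership in I_0[lambda](Z_p). *)
Definition psI0_slope (R : realType) (lambda : R) (a : nat -> Zp) :=
  psI0 a /\
  forall k, ((Num.ceil (k%:R * lambda))%:E <= pint_ord (a k))%E.

Definition ordq (y : rat) : int :=
  (logn p `|numq y|)%:Z - (logn p `|denq y|)%:Z.

Definition iotap (y : rat) : int := Num.max 0 (- ordq y).
Definition iotap' (y : rat) : int := Num.max 0 (ordq y).

Definition rho (R : realType) : R := (p%:R - 1)^-1.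
Definition rho_at (R : realType) (y : rat) : R :=
  if ordq y != 0 then rho R else 0.

(* Membership in F(w, y, kappa, lambda, u, omega, omega'), including the
   standing constraints on these parameters. The positive integer [u] has type
   [int] because it is also given by differences. *)
Record phaseF (R : realType) (w : int) (y : rat) (kappa : nat) (lambda : R)
    (u : int) (omega omega' : Zp) (f : nat -> Qp) : Prop := PhaseF {
  phaseF_u : 0 < u;
  phaseF_kappa : 1 + iotap' 2 <= kappa%:Z;
  phaseF_lambda : exists2 l : nat, (0 < l)%N & lambda = rho R * l%:R;
  phaseF_y : 0 < y;
  phaseF_omega : omega \is a GRing.unit;
  phaseF_omega' : omega' \is a GRing.unit;
  phaseF_I0 : exists (c : Qp) (a : nat -> Zp),
    [/\ c != 0, psI0 a & forall k, f k = c * tofrac (a k)];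
  phaseF_der : exists (gamma0 : Zp) (g : nat -> Zp),
    psI0_slope lambda g /\
    forall k, psder f k =
      p%:R ^ w * tofrac omega' *
        psbinom (- y) (p%:R ^ (iotap y + kappa%:Z) * tofrac omega) k
      + (if k == 0%N then p%:R ^ w * tofrac gamma0 else 0)
      + p%:R ^ (u + w) * tofrac (g k) }.

End Padic.

Section Analysis.
Variable R : realType.

Definition expi (x : R) : R[i] := Complex (cos (2 * pi * x)) (sin (2 * pi * x)).

(* The extension of x |-> expi x from Z[1/p] to a Z_p-periodic function on
   Q_p: [x] is replaced by an element of Z[1/p] congruent to it modulo Z_p. *)
Definition expi_padic (p : nat) (hp : prime p) (x : padic hp) : R[i] :=
  expi (ratr (xget 0 [set r : rat |
    (exists (a : int) (k : nat), r = a%:~R / p%:R ^+ k) /\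
    exists z : pint hp, x - ratr r = FracField.tofrac z]%classic)).

Definition schwartz_real (g : R -> R) := forall k : nat,
  (forall x, derivable (derive1n k g) x 1) /\
  forall j : nat, exists M : R, forall x, `|x ^+ j * derive1n k g x| <= M.

Definition schwartz (h : R -> R[i]) :=
  schwartz_real (fun x => complex.Re (h x)) /\
  schwartz_real (fun x => complex.Im (h x)).

Definition Cintegral (f : R -> R[i]) : R[i] :=
  Complex (\int[@lebesgue_measure R]_x complex.Re (f x))
          (\int[@lebesgue_measure R]_x complex.Im (f x)).

Definition fourier (h : R -> R[i]) (s : R) : R[i] :=
  Cintegral (fun x => h x * expi (- (s * x))).

Definition zsummable (F : int -> R[i]) :=
  summable [set: int]%classic (fun m => (complex.Re `|F m|)%:E).

Definition zsum_real (F : int -> R) : R :=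
  limn (fun n : nat => \sum_(k < n.*2.+1) F (k%:Z - n%:Z)).

(* Symmetric partial sums are taken, so this is the unordered sum over Z only
   when [zsummable F] holds. *)
Definition zsum (F : int -> R[i]) : R[i] :=
  Complex (zsum_real (fun m => complex.Re (F m)))
          (zsum_real (fun m => complex.Im (F m))).

End Analysis.

(* Main.v *)
(* Write f(x) = f(0) + f'(0) x + c psi(x) with c = p^(w + kappa + iota') and
   N = n - w - kappa - iota'. Poisson summation on each residue class modulo
   p^N turns the sum into a sum over t of the discrete Fourier transform of
   x |-> e(psi(x) / p^N). Up to a unit, psi' is tangent to the identity, so
   psi'(x) = t has a unique solution x(t) in Z_p, given by the inverse power
   series, and p-adic stationary phase shows that the complete sum at t is
   e((psi(x(t)) - t x(t)) / p^N) times the complete sum at 0; the absolute value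
   of the latter then follows from Parseval's identity. The critical value
   psi(x(t)) - t x(t) has derivative - x(t), hence the dual phase is
   f(0) - c times the primitive of x(t). When psi' is an exact binomial series,
   so is x(t), by a first-order linear differential equation; in general x(t) is a
   p-adically small perturbation of that series. *)

Require Import Defs.
From HB Require Import structures.
From mathcomp Require Import all_boot all_order all_algebra.
From mathcomp Require Import complex ring lra zify.
From mathcomp Require Import all_classical all_reals all_analysis measurable_realfun.

Set Implicit Arguments.
Unset Strict Implicit.
Unset Printing Implicit Defensive.

Import Order.TTheory GRing.Theory Num.Theory.
Import numFieldNormedType.Exports.

Local Open Scope ring_scope.

(** * Integrals of bounded functions and Bessel's inequality *)

(** Three choices shape the proof. Sums over Z are limits of symmetric partial sums, so Poisson
    summation is proved by integrating against Dirichlet kernels, one period at a time, with errors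
    summable over the periods; no periodization is formed. Power series are replaced by polynomials:
    a formal identity holds modulo ['X^n], and the coefficients beyond are small because their
    valuations grow linearly, which beats the logarithmic loss from the denominators of a primitive.
    Stationary phase needs N = s + r with r <= s: Taylor terms of order at least two must vanish
    modulo p^N at steps p^s, and at steps p^r they must not depend on the base point. The
    denominators k of the primitive are the obstacle. For odd p only k = p is dangerous, and p
    divides its inner binomial coefficients; for p = 2 the quadratic coefficient itself loses a
    factor 2, which forces s > N/2 and explains the role of 4 and 12 in the hypotheses. The exponent
    of the dual class comes from k lambda >= floor(lambda) + (k-1) mu with mu = min(kappa -
    rho_p(y), lambda): the inverse series inherits this estimate, and returning to slope k mu costs
    ceil(mu). *)

Section Integrals.
Variable R : realType.
Local Notation mu := (@lebesgue_measure R).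
Local Open Scope classical_set_scope.

Lemma is_derive_sin_scale (c x : R) :
  is_derive x 1 (fun x => sin (c * x)) (c * cos (c * x)).
Proof. apply: is_derive_eq. rewrite /GRing.scale /=; ring. Qed.

Lemma is_derive_cos_scale (c x : R) :
  is_derive x 1 (fun x => cos (c * x)) (- (c * sin (c * x))).
Proof. apply: is_derive_eq. rewrite /GRing.scale /=; ring. Qed.

Lemma continuous_sin_scale (c : R) : continuous (fun x => sin (c * x)).
Proof.
move=> x; apply: differentiable_continuous; apply/derivable1_diffP.
by have [] := is_derive_sin_scale c x.
Qed.

Lemma continuous_cos_scale (c : R) : continuous (fun x => cos (c * x)).
Proof.
move=> x; apply: differentiable_continuous; apply/derivable1_diffP.
by have [] := is_derive_cos_scale c x.
Qed.

Lemma is_derive_continuous (f df : R -> R) :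
  (forall x : R, is_derive x 1 f (df x)) -> continuous f.
Proof.
move=> dF x; apply: differentiable_continuous; apply/derivable1_diffP.
by have [] := dF x.
Qed.

Lemma Rintegral_FTC (F f : R -> R) a b : a <= b -> continuous f ->
  (forall x : R, is_derive x 1 F (f x)) ->
  \int[mu]_(x in `[a, b]) f x = F b - F a.
Proof.
rewrite le_eqVlt => /predU1P[<-|ab] cf dF.
  by rewrite set_itv1 Rintegral_set1 subrr.
have cF := is_derive_continuous dF.
rewrite /Rintegral (@continuous_FTC2 _ _ F) //.
- exact: continuous_subspaceT.
- split.
  + by move=> x _; have [] := dF x.
  + by apply: cvg_at_right_filter; exact: cF.
  + by apply: cvg_at_left_filter; exact: cF.
- by move=> x _; rewrite derive1E; have [_ ->] := dF x.
Qed.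

Lemma continuous_itv_integrable (f : R -> R) a b : continuous f ->
  mu.-integrable `[a, b] (EFin \o f).
Proof.
move=> cf; apply: continuous_compact_integrable; first exact: segment_compact.
exact: continuous_subspaceT.
Qed.

Lemma Rintegral_itv_cat (f : R -> R) a b c : continuous f -> a <= b -> b <= c ->
  \int[mu]_(x in `[a, c]) f x =
  \int[mu]_(x in `[a, b]) f x + \int[mu]_(x in `[b, c]) f x.
Proof.
move=> cf ab bc.
rewrite -(@Rintegral_itv_obnd_cbnd _ b (BRight c)).
  rewrite -(@Rintegral_itvB _ f (BLeft a) (BRight c) b) ?bnd_simp //.
    by rewrite addrC subrK.
  exact: continuous_itv_integrable.
apply: integrableS (continuous_itv_integrable b c cf) => //.
by apply: subset_itvr; rewrite bnd_simp.
Qed.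

Lemma integrable_oneDsqrV (C : R) :
  mu.-integrable setT (fun x : R => (C * (1 + x ^+ 2)^-1)%:E).
Proof.
have h : mu.-integrable setT (fun x : R => ((oneDsqr x)^-1)%:E).
  apply/integrableP; split.
    apply/measurable_EFinP; apply: continuous_measurable_fun.
    exact: continuous_oneDsqrV.
  rewrite (_ : (fun _ => _) = (fun x : R => ((oneDsqr x)^-1)%:E)); last first.
    by apply/funext => x; rewrite abse_EFin ger0_norm // invr_ge0.
  rewrite ge0_symfun_integralT.
  - rewrite -set_itvcy integral0y_oneDsqr -EFinM ltry //.
  - by move=> x; rewrite invr_ge0.
  - exact: continuous_oneDsqrV.
  - by move=> x /=; rewrite /oneDsqr sqrrN.
have := integrableZl measurableT C h.
by apply: eq_integrable => // x _; rewrite EFinM.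
Qed.

(** The form in which Schwartz decay enters the summation arguments: it gives integrability over the
    line and summability along arithmetic progressions, and the explicit [C] allows uniform
    bounds. *)
Definition sqdecay (C : R) (g : R -> R) := forall x, `|g x| <= C * (1 + x ^+ 2)^-1.

Lemma integrable_sqdecay C g : continuous g -> sqdecay C g ->
  mu.-integrable setT (EFin \o g).
Proof.
move=> cg dg; apply: (le_integrable _ _ _ (integrable_oneDsqrV C)) => //.
  by apply/measurable_EFinP; exact: continuous_measurable_fun.
by move=> x _ /=; rewrite lee_fin (le_trans (dg x)) // ler_norm.
Qed.

(** The endpoints are multiples of [L] so that the integral splits into whole periods in
    [real_poisson]; the limit is dominated convergence for the truncations of [g]. *)
Lemma Rintegral_sym_cvg (g : R -> R) (L : R) : 0 < L ->
  mu.-integrable setT (EFin \o g) ->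
  \int[mu]_(x in `[- (n%:R * L), n%:R * L]) g x @[n --> \oo] --> \int[mu]_x g x.
Proof.
move=> L0 ig.
have mg : measurable_fun setT g by apply/measurable_EFinP; exact: measurable_int ig.
pose gn n := (EFin \o (g \_ `[- (n%:R * L), n%:R * L]%classic)).
have [] := @dominated_convergence _ _ _ mu setT measurableT gn (EFin \o g) (abse \o (EFin \o g)).
- move=> n; apply/measurable_EFinP; apply/(measurable_restrictT _ _).1 => //.
  exact: measurable_funTS.
- exact/measurable_EFinP.
- apply: aeW => x _; apply: cvg_near_cst.
  near=> n; rewrite /gn /= patchE mem_set //= in_itv /= -ler_norml.
  rewrite -ler_pdivrMr //.
  near: n; exact: nbhs_infty_ger.
- exact: integrable_abse.
- apply: aeW => x n _; rewrite /gn /= patchE; case: ifP => // _.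
  by rewrite normr0 lee_fin.
move=> _ _; rewrite /gn => h.
rewrite /Rintegral.
under eq_fun do rewrite integral_mkcond restrict_EFin.
apply: fine_cvg; rewrite fineK; last exact: integrable_fin_num.
exact: h.
Unshelve. all: by end_near. Qed.

Lemma le_Rintegral_itv (f : R -> R) (C : R) a b : a <= b -> 
  mu.-integrable `[a, b] (EFin \o f) ->
  (forall x, a <= x <= b -> `|f x| <= C) ->
  `|\int[mu]_(x in `[a, b]) f x| <= C * (b - a).
Proof.
move=> ab iF fC.
apply: (le_trans (le_normr_Rintegral _ _)) => //.
have cE : C * (b - a) = \int[mu]_(x in `[a, b]) C.
  by rewrite Rintegral_cst //= lebesgue_measure_itv /=; case: ifPn; rewrite ?lte_fin // -leNgt => ba /=; rewrite (le_anti (introT andP (conj ab ba))) subrr.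
rewrite cE; apply: le_Rintegral => //.
- exact: integrable_norm.
- by apply: continuous_itv_integrable => x; exact: cvg_cst.
Qed.

Lemma measurable_funV (D : set R) (f : R -> R) :
  measurable_fun D f -> measurable_fun D (fun x => (f x)^-1).
Proof.
move=> mf.
(* [powR] is measurable but is the inverse only on nonnegative reals, hence the square; at a zero of
   [f] both sides are 0 by the convention for the inverse of 0. *)
have -> : (fun x => (f x)^-1) = (fun x => f x * (f x ^+ 2) `^ (-1)).
  apply/funext => x; rewrite powR_inv1 ?sqr_ge0 //.
  have [->|fx0] := eqVneq (f x) 0; first by rewrite invr0 mul0r.
  by rewrite expr2 invfM mulrA divff // mul1r.
apply: measurable_realfun.measurable_funM => //.
have mff : measurable_fun D (fun x => f x ^+ 2).
  by under eq_fun do rewrite expr2; exact: measurable_realfun.measurable_funM.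
exact: (measurableT_comp (measurable_powR (-1)) mff).
Qed.

(** Bessel's inequality is applied to a quotient by a sine, which takes the value 0 at the zeros of
    the sine and need not be continuous there; this class contains it and is closed under
    products. *)
Definition bounded_measurable (D : set R) (f : R -> R) :=
  measurable_fun D f /\ exists M : R, forall x, D x -> `|f x| <= M.

Section BoundedMeasurable.
Variable D : set R.
Hypotheses (mD : measurable D) (muD : (mu D < +oo)%E).

Lemma bounded_measurableD f g : bounded_measurable D f ->
  bounded_measurable D g -> bounded_measurable D (fun x => f x + g x).
Proof.
move=> [mf [M fM]] [mg [N gN]]; split; first exact: measurable_funD.
by exists (M + N) => x Dx; rewrite (le_trans (ler_normD _ _)) // lerD ?fM ?gN.
Qed.

Lemma bounded_measurableM f g : bounded_measurable D f ->
  bounded_measurable D g -> bounded_measurable D (fun x => f x * g x).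
Proof.
move=> [mf [M fM]] [mg [N gN]]; split.
  exact: measurable_realfun.measurable_funM.
by exists (M * N) => x Dx; rewrite normrM ler_pM ?fM ?gN.
Qed.

Lemma bounded_measurable_cst c : bounded_measurable D (fun=> c).
Proof. by split; [exact: measurable_cst | exists `|c|]. Qed.

Lemma bounded_measurableB f g : bounded_measurable D f ->
  bounded_measurable D g -> bounded_measurable D (fun x => f x - g x).
Proof.
move=> bf bg.
have := bounded_measurableD bf (bounded_measurableM (bounded_measurable_cst (-1)) bg).
by congr bounded_measurable; apply/funext => x; rewrite mulN1r.
Qed.

Lemma bounded_measurable_integrable f : bounded_measurable D f ->
  mu.-integrable D (EFin \o f).
Proof.
move=> [mf [M fM]]; apply: measurable_bounded_integrable => //.
exists M; split; first exact: num_real.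
by move=> N MN x Dx /=; rewrite (le_trans (fM x Dx)) // ltW.
Qed.

Local Notation I := bounded_measurable_integrable.
Local Notation M := bounded_measurableM.

(* Bessel's inequality makes the series of squares of the coefficients
   converge. *)
Lemma orthogonal_coef_cvg0 (G : R -> R) (s : nat -> R -> R) (c : R) :
  0 < c -> bounded_measurable D G -> (forall j, bounded_measurable D (s j)) ->
  (forall i j, \int[mu]_(x in D) (s i x * s j x) = if i == j then c else 0) ->
  \int[mu]_(x in D) (G x * s j x) @[j --> \oo] --> 0.
Proof.
move=> c0 bG bs os.
pose g j := \int[mu]_(x in D) (G x * s j x).
(* [P] is [G] minus its orthogonal projection on the first [n] functions; its squared norm is
   nonnegative, which bounds the partial sums of squared coefficients. *)
have H n : exists P : R -> R, [/\ bounded_measurable D P,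
    \int[mu]_(x in D) (P x * P x) =
      \int[mu]_(x in D) (G x * G x) - \sum_(j < n) (g j ^+ 2 / c) &
    forall k, (n <= k)%N -> \int[mu]_(x in D) (P x * s k x) = g k].
  elim: n => [|n [P [bP PP Ps]]].
    by exists G; split => //; rewrite big_ord0 subr0.
  have bcs : bounded_measurable D (fun x => g n / c * s n x).
    exact: M (bounded_measurable_cst _) (bs n).
  exists (fun x => P x - g n / c * s n x); split.
  - exact: bounded_measurableB.
  - have -> : \int[mu]_(x in D) ((P x - g n / c * s n x) * (P x - g n / c * s n x))
        = \int[mu]_(x in D) (P x * P x - (2 * (g n / c) * (P x * s n x) -
          (g n / c) ^+ 2 * (s n x * s n x))).
      by apply: eq_Rintegral => x _; ring.
    rewrite RintegralB //; try apply: I.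
    + rewrite PP RintegralB //; try apply: I.
      * rewrite !RintegralZl //; try apply: I; try exact: M.
        rewrite Ps // os eqxx big_ord_recr /=.
        by field; rewrite gt_eqF.
      * exact: M (bounded_measurable_cst _) (M _ _).
      * exact: M (bounded_measurable_cst _) (M _ _).
    + exact: M.
    + by apply: bounded_measurableB; exact: M (bounded_measurable_cst _) (M _ _).
  - move=> k nk.
    have -> : \int[mu]_(x in D) ((P x - g n / c * s n x) * s k x)
        = \int[mu]_(x in D) (P x * s k x - g n / c * (s n x * s k x)).
      by apply: eq_Rintegral => x _; ring.
    rewrite RintegralB //; try apply: I; try exact: M.
      rewrite RintegralZl //; last by apply: I; exact: M.
      by rewrite Ps ?(ltnW nk) // os ltn_eqF // mulr0 subr0.
    exact: M (bounded_measurable_cst _) (M _ _).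
have cvs : cvgn (series (fun j => g j ^+ 2 / c)).
  apply: nondecreasing_is_cvgn.
    by apply: nondecreasing_series => j _; rewrite divr_ge0 ?sqr_ge0 // ltW.
  exists (\int[mu]_(x in D) (G x * G x)) => _ [n _ <-].
  have [P [bP PP _]] := H n.
  rewrite -subr_ge0 /series /= big_mkord -PP.
  by apply: Rintegral_ge0 => x _; rewrite -expr2 sqr_ge0.
have /cvgrPdist_lt g0 := cvg_series_cvg_0 cvs.
apply/cvgrPdist_lt => e e0.
have ec : 0 < e ^+ 2 / c by rewrite divr_gt0 ?exprn_gt0.
have := g0 _ ec; apply: filterS => j.
rewrite !sub0r !normrN ger0_norm; last by rewrite divr_ge0 ?sqr_ge0 // ltW.
rewrite ltr_pM2r ?invr_gt0 // => h.
by rewrite -(ltr_pXn2r (n := 2)) ?nnegrE ?(ltW e0) // real_normK ?num_real.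
Qed.

End BoundedMeasurable.
End Integrals.

(** * Elementary trigonometric estimates and the Dirichlet kernel *)

Section Trigonometry.
Variable R : realType.
Implicit Types (x y : R) (k : int).

Lemma sin_piz k : sin (pi * k%:~R) = 0 :> R.
Proof.
have H (n : nat) : sin (pi * n%:R) = 0 :> R.
  elim: n => [|n IH]; first by rewrite mulr0 sin0.
  by rewrite -addn1 natrD mulrDr mulr1 sinD IH sinpi mul0r mulr0 addr0.
by case: k => n; rewrite ?NegzE ?mulrNz ?mulrN ?sinN ?H ?oppr0 // -[n.+1%:~R]/(n.+1%:R) H oppr0.
Qed.

Lemma normr_cos_piz k : `|cos (pi * k%:~R)| = 1 :> R.
Proof. exact/sin0cos1/sin_piz. Qed.

Lemma sin_2piz k : sin (2 * pi * k%:~R) = 0 :> R.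
Proof.
have := sin_piz (2 * k); rewrite intrM /= => <-.
by rewrite mulrCA mulrA.
Qed.

Lemma cos_2piz k : cos (2 * pi * k%:~R) = 1 :> R.
Proof.
rewrite -mulrA mulr_natl cos_mulr2n cos2sin2 sin_piz expr0n subr0.
by rewrite mulr2n -addrA subrr addr0.
Qed.

Lemma normr_sin_pizD x k : `|sin (x + pi * k%:~R)| = `|sin x|.
Proof. by rewrite sinD sin_piz mulr0 addr0 normrM normr_cos_piz mulr1. Qed.

(** A crude Jordan inequality. Up to pi/4 the derivative cos is at least 1/2; beyond, sin is at
    least 1/2 while x/4 < 1/2 because pi/2 < 2. *)
Lemma sin_ge_quarter x : 0 <= x <= pi / 2 -> x / 4 <= sin x.
Proof.
move=> /andP[x0 xp].
have p0 : 0 < pi :> R := pi_gt0 R.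
have p4 : pi < 4 :> R.
  by rewrite -(@ltr_pM2r _ 2^-1) // -[4 / 2]/(4 * 2^-1); rewrite (lt_le_trans (pihalf_lt2 R)) //; lra.
have c4 : 1 / 2 <= cos (pi / 4) :> R.
  have c0 : 0 < cos (pi / 4) :> R by apply: cos_gt0_pihalf; lra.
  have : cos (pi / 4 *+ 2) = 0 :> R by rewrite -[RHS](@cos_pihalf R); congr cos; field.
  rewrite cos_mulr2n => c2; nra.
have s4 : 1 / 2 <= sin (pi / 4) :> R.
  by rewrite -cosBpihalf -cosN (_ : - _ = pi / 4) //; field.
have [xs|xs] := leP x (pi / 4).
  have [c /itvP cx] := @MVT_segment R sin cos 0 x x0 (fun z _ => is_derive_sin z)
    (continuous_subspaceT (@continuous_sin R)).
  rewrite sin0 !subr0 => ->.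
  have : cos (pi / 4) <= cos c.
    rewrite leNgt; apply/negP; rewrite ltr_cos ?in_itv /=.
    + by rewrite ltNge (le_trans _ xs) // cx.
    + lra.
    + by rewrite cx /=; have : c <= x; [rewrite cx | lra].
  by move=> ?; nra.
have : sin (pi / 4) <= sin x.
  rewrite leNgt; apply/negP; rewrite ltr_sin ?in_itv /=; lra.
lra.
Qed.

Lemma sum_zsym (V : zmodType) (F : int -> V) (n : nat) :
  \sum_(k < n.+1.*2.+1) F (k%:Z - n.+1%:Z) =
  \sum_(k < n.*2.+1) F (k%:Z - n%:Z) + F n.+1%:Z + F (- n.+1%:Z).
Proof.
rewrite doubleS big_ord_recl big_ord_recr /= [LHS]addrC.
congr (_ + _); first congr (_ + _).
- by apply: eq_bigr => i _; congr F; rewrite /bump /=; lia.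
- by congr F; rewrite /bump /=; lia.
- by rewrite sub0r.
Qed.

(** The closed form of the Dirichlet kernel, multiplied out so that it also holds at the zeros of
    sin. *)
Lemma sin_dirichlet x (n : nat) :
  sin x * \sum_(k < n.*2.+1) cos ((k%:Z - n%:Z)%:~R * 2 * x) =
  sin (n.*2.+1%:R * x).
Proof.
elim: n => [|n IH].
  by rewrite big_ord_recl big_ord0 subrr mul0r mul0r cos0 addr0 mulr1 mul1r.
rewrite (sum_zsym (fun k => cos (k%:~R * 2 * x))) 2!mulrDr IH.
set m := n.*2.+1.
have -> : n.+1.*2.+1%:R * x = m.+1%:R * x + x.
  by rewrite /m doubleS -[in LHS]addn1 natrD mulrDl mul1r.
have -> : m%:R * x = m.+1%:R * x - x.
  by rewrite -[m.+1]addn1 natrD mulrDl mul1r addrK.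
have -> : n.+1%:Z%:~R * 2 * x = m.+1%:R * x.
  by congr (_ * x); rewrite -natrM /m muln2 doubleS.
have -> : (- n.+1%:Z)%:~R * 2 * x = - (m.+1%:R * x).
  by rewrite mulrNz !mulNr; congr (- (_ * x)); rewrite -natrM /m muln2 doubleS.
rewrite cosN sinB sinD; ring.
Qed.

End Trigonometry.

Lemma continuous_ord_sum (R : realType) (F : nat -> R -> R) n :
  (forall k, continuous (F k)) -> continuous (fun x => \sum_(k < n) F k x).
Proof.
move=> cF x; elim: n => [|n IH].
  by under eq_fun do rewrite big_ord0; exact: cvg_cst.
rewrite (_ : (fun _ => _) = (fun x => \sum_(k < n) F k x + F n x)).
  by apply: (@cvgD _ R^o); [exact: IH | exact: cF].
by apply/funext => y; rewrite big_ord_recr.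
Qed.

(** * Dirichlet's theorem and Poisson summation *)

Section DirichletKernel.
Variables (R : realType) (L : R) (m : int).
Hypothesis L0 : 0 < L.
Local Notation mu := (@lebesgue_measure R).
Local Open Scope classical_set_scope.
Local Notation a := (m%:~R * L).
Local Notation b := ((m + 1)%:~R * L).
Local Notation w := (pi / L).

Lemma period_itv_lt : a < b. Proof. by rewrite ltr_pM2r // ltr_int; lia. Qed.
Lemma period_itv_len : b - a = L. Proof. by rewrite intrD; ring. Qed.

Local Lemma w_neq0 : w != 0.
Proof. by rewrite mulf_neq0 ?invr_neq0 // gt_eqF // pi_gt0. Qed.

Local Lemma phase_bdry (k n : int) : k%:~R * 2 * w * (n%:~R * L) = 2 * pi * (k * n)%:~R.
Proof. by rewrite intrM; field; rewrite gt_eqF. Qed.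

Lemma period_integral_cos (k : int) :
  \int[mu]_(x in `[a, b]) cos (k%:~R * 2 * w * x) = if k == 0 then L else 0.
Proof.
have ab := ltW period_itv_lt.
set c := k%:~R * 2 * w.
have cont : continuous (fun x => cos (c * x)) by exact: continuous_cos_scale.
have [k0|k0] := eqVneq k 0.
  have dF (x : R) : is_derive x 1 id (cos (c * x)).
    by rewrite /c k0 !mul0r cos0; exact: is_derive_id.
  by rewrite (Rintegral_FTC ab cont dF) period_itv_len.
have c0 : c != 0 by rewrite mulf_neq0 ?w_neq0 // mulf_neq0 ?intr_eq0 ?pnatr_eq0.
have dF (x : R) : is_derive x 1 (fun x => c^-1 * sin (c * x)) (cos (c * x)).
  have ? := is_derive_sin_scale c x.
  by apply: is_derive_eq; rewrite /GRing.scale /=; field.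
by rewrite (Rintegral_FTC ab cont dF) !phase_bdry !sin_2piz mulr0 subrr.
Qed.

Lemma period_integral_linear_cos (k : int) :
  \int[mu]_(x in `[a, b]) ((x - a) * cos (k%:~R * 2 * w * x)) =
  if k == 0 then L ^+ 2 / 2 else 0.
Proof.
have ab := ltW period_itv_lt.
set c := k%:~R * 2 * w.
have cont : continuous (fun x => (x - a) * cos (c * x)).
  move=> x; apply: cvgM; last exact: continuous_cos_scale.
  by apply: cvgB; [exact: cvg_id | exact: cvg_cst].
have [k0|k0] := eqVneq k 0.
  have dF (x : R) : is_derive x 1 (fun x => (x - a) ^+ 2 / 2) ((x - a) * cos (c * x)).
    rewrite /c k0 !mul0r cos0 mulr1.
    by apply: is_derive_eq; rewrite /GRing.scale /=; field.
  by rewrite (Rintegral_FTC ab cont dF) period_itv_len; ring.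
have c0 : c != 0 by rewrite mulf_neq0 ?w_neq0 // mulf_neq0 ?intr_eq0 ?pnatr_eq0.
have dF (x : R) : is_derive x 1
    (fun x => (x - a) * (c^-1 * sin (c * x)) + c^-1 ^+ 2 * cos (c * x))
    ((x - a) * cos (c * x)).
  have ? := is_derive_sin_scale c x; have ? := is_derive_cos_scale c x.
  by apply: is_derive_eq; rewrite /GRing.scale /=; field.
by rewrite (Rintegral_FTC ab cont dF) !phase_bdry !sin_2piz !cos_2piz !mulr0 subrr.
Qed.

(** Odd multiples of pi/L do not have period [L], but a product of two such sines is half a
    difference of cosines of period [L] with indices i - j and i + j + 1, and the second index is
    never 0. *)
Lemma period_integral_sin_orth (i j : nat) :
  \int[mu]_(x in `[a, b]) (sin (i.*2.+1%:R * w * x) * sin (j.*2.+1%:R * w * x)) =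
  if i == j then L / 2 else 0.
Proof.
pose p : int := i%:Z - j%:Z; pose q : int := i%:Z + j%:Z + 1.
have dn (n : nat) : n.*2.+1%:R = 2 * n%:R + 1 :> R.
  by rewrite -addn1 natrD -muln2 natrM mulrC.
have E (x : R) : sin (i.*2.+1%:R * w * x) * sin (j.*2.+1%:R * w * x) =
    2^-1 * (cos (p%:~R * 2 * w * x) - cos (q%:~R * 2 * w * x)).
  have -> : p%:~R * 2 * w * x = i.*2.+1%:R * w * x - j.*2.+1%:R * w * x.
    by rewrite !dn /p intrB; ring.
  have -> : q%:~R * 2 * w * x = i.*2.+1%:R * w * x + j.*2.+1%:R * w * x.
    by rewrite !dn /q !intrD; ring.
  by rewrite cosB cosD; field.
under eq_Rintegral do rewrite E.
have ic (k : int) : mu.-integrable `[a, b] (EFin \o (fun x => cos (k%:~R * 2 * w * x))).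
  exact/continuous_itv_integrable/continuous_cos_scale.
rewrite RintegralZl //; last exact: (integrableB _ (ic p) (ic q)).
rewrite RintegralB // !period_integral_cos.
rewrite (_ : (q == 0) = false); last by apply/negP => /eqP; rewrite /q; lia.
rewrite (_ : (p == 0) = (i == j)); last by rewrite /p subr_eq0.
by case: ifP => _; field.
Qed.

Section Estimate.
Variables (g dg : R -> R) (M : R).
Hypothesis dgP : forall x : R, is_derive x 1 g (dg x).
Hypothesis dgM : forall x, a <= x <= b -> `|dg x| <= M.

(** [lin] interpolates [g] at both ends of the period. The difference [g - lin] vanishes wherever
    the sine does, so the quotient [G] is bounded; multiplying the kernel by the sine leaves
    sin((2K+1)wx), and the integral of [G] against it tends to 0 by Bessel's inequality. *)
Local Notation D K := (fun x => \sum_(k < K.*2.+1) cos ((k%:Z - K%:Z)%:~R * 2 * w * x)).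
Local Notation lin := (fun x => g a + (g b - g a) / L * (x - a)).
Local Notation G := (fun x => (g x - lin x) / sin (w * x)).

Local Lemma lipschitz_itv x y : a <= x -> x <= y -> y <= b ->
  `|g y - g x| <= M * (y - x).
Proof.
move=> ax xy yb.
have cg := is_derive_continuous dgP.
have [c /itvP cxy ->] := MVT_segment xy (fun z _ => dgP z) (continuous_subspaceT cg).
rewrite normrM (ger0_norm (x := y - x)) ?subr_ge0 // ler_wpM2r ?subr_ge0 //.
by apply: dgM; rewrite (le_trans ax) ?cxy //= (le_trans _ yb) ?cxy.
Qed.

Local Lemma M_ge0 : 0 <= M.
Proof.
by apply: le_trans (normr_ge0 _) (dgM (x := a) _); rewrite lexx (ltW period_itv_lt).
Qed.

Local Lemma num_le_left x : a <= x -> x <= b -> `|g x - lin x| <= 2 * M * (x - a).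
Proof.
move=> ax xb.
have -> : g x - lin x = (g x - g a) - (g b - g a) / L * (x - a) by ring.
apply: (le_trans (ler_normB _ _)).
have -> : 2 * M * (x - a) = M * (x - a) + M * (x - a) by ring.
rewrite lerD ?lipschitz_itv //.
have ab := ltW period_itv_lt.
rewrite !normrM (ger0_norm (x := x - a)) ?subr_ge0 // ler_wpM2r ?subr_ge0 //.
rewrite normfV (gtr0_norm L0) ler_pdivrMr //.
by have := lipschitz_itv (lexx a) ab (lexx b); rewrite period_itv_len.
Qed.

Local Lemma num_le_right x : a <= x -> x <= b -> `|g x - lin x| <= 2 * M * (b - x).
Proof.
move=> ax xb.
have -> : g x - lin x = (g b - g a) / L * (b - x) - (g b - g x).
  have -> : b - x = L - (x - a) by rewrite -period_itv_len; ring.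
  by field; rewrite gt_eqF.
apply: (le_trans (ler_normB _ _)).
have -> : 2 * M * (b - x) = M * (b - x) + M * (b - x) by ring.
rewrite lerD ?lipschitz_itv //.
have ab := ltW period_itv_lt.
rewrite !normrM (ger0_norm (x := b - x)) ?subr_ge0 // ler_wpM2r ?subr_ge0 //.
rewrite normfV (gtr0_norm L0) ler_pdivrMr //.
by have := lipschitz_itv (lexx a) ab (lexx b); rewrite period_itv_len.
Qed.

(** On each half of the period, numerator and sine are both compared with the distance to the nearer
    endpoint. The constant combines the factor 1/4 of [sin_ge_quarter] with wL = pi >= 2. *)
Local Lemma num_le_sin x : a <= x -> x <= b ->
  `|g x - lin x| <= 4 * M * L * `|sin (w * x)|.
Proof.
move=> ax xb.
have p0 : 0 < pi :> R := pi_gt0 R; have p2 : 2 <= pi :> R := pi_ge2 R.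
have M0 := M_ge0; have w0 : 0 < w by rewrite divr_gt0.
have sE : `|sin (w * x)| = `|sin (w * (x - a))|.
  rewrite -(normr_sin_pizD (w * (x - a)) m); congr `|sin _|.
  by field; rewrite gt_eqF.
have wab : w * (b - a) = pi by rewrite period_itv_len divfK ?gt_eqF.
have wL : 2 <= w * L by rewrite divfK ?gt_eqF.
rewrite sE; set v := w * (x - a) in sE *.
have v0 : 0 <= v by rewrite mulr_ge0 ?subr_ge0 // ltW.
have key (d : R) : 0 <= d -> w * d / 4 <= `|sin v| -> 2 * M * d <= 4 * M * L * `|sin v|.
  move=> d0 h.
  have : 4 * M * L * (w * d / 4) <= 4 * M * L * `|sin v|.
    by rewrite ler_wpM2l ?mulr_ge0 // ltW.
  apply: le_trans.
  have -> : 4 * M * L * (w * d / 4) = (M * d) * (w * L) by field; rewrite gt_eqF.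
  by rewrite -mulrA mulrC ler_wpM2l ?mulr_ge0.
have [vp|vp] := leP v (pi / 2).
  apply: le_trans (num_le_left ax xb) (key _ _ _); rewrite ?subr_ge0 //.
  by rewrite (le_trans _ (ler_norm _)) // sin_ge_quarter // v0.
apply: le_trans (num_le_right ax xb) (key _ _ _); rewrite ?subr_ge0 //.
have vE : w * (b - x) = pi - v by rewrite -[in RHS]wab /v; ring.
have vb : 0 <= pi - v by rewrite -vE mulr_ge0 ?subr_ge0 // ltW.
have -> : `|sin v| = `|sin (pi - v)|.
  by rewrite sinB sinpi cospi mul0r sub0r mulN1r opprK.
rewrite vE (le_trans _ (ler_norm _)) // sin_ge_quarter //; lra.
Qed.

(** At a zero of the sine the quotient is 0 by convention, and [num_le_sin] forces the numerator to
    vanish as well. *)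
Local Lemma GsinE x : a <= x -> x <= b -> G x * sin (w * x) = g x - lin x.
Proof.
move=> ax xb; have [s0|s0] := eqVneq (sin (w * x)) 0; last by rewrite divfK.
have := num_le_sin ax xb; rewrite s0 normr0 mulr0 normr_le0 => /eqP.
by rewrite mulr0.
Qed.

Local Lemma G_le x : a <= x -> x <= b -> `|G x| <= 4 * M * L.
Proof.
move=> ax xb; have ? : 0 <= 4 * M * L.
  by rewrite !mulr_ge0 ?M_ge0 // ltW.
have [s0|s0] := eqVneq (sin (w * x)) 0; first by rewrite s0 invr0 mulr0 normr0.
by rewrite normrM normfV ler_pdivrMr ?normr_gt0 // num_le_sin.
Qed.

Local Lemma continuous_lin : continuous lin.
Proof.
move=> x; apply: cvgD; first exact: cvg_cst.
apply: cvgM; first exact: cvg_cst.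
by apply: cvgB; [exact: cvg_id | exact: cvg_cst].
Qed.

Local Lemma itv_finite : (mu `[a, b] < +oo)%E.
Proof. by rewrite lebesgue_measure_itv /=; case: ifP => // _; rewrite -EFinD ltry. Qed.

Local Lemma bounded_measurable_G : bounded_measurable `[a, b] G.
Proof.
split.
  apply: measurable_realfun.measurable_funM; last apply: measurable_funV;
    apply: measurable_funTS; apply: continuous_measurable_fun => x.
  - by apply: cvgB; [exact: (is_derive_continuous dgP) | exact: continuous_lin].
  - exact: continuous_sin_scale.
exists (4 * M * L) => x /=; rewrite in_itv /= => /andP[]; exact: G_le.
Qed.

Local Lemma bounded_measurable_sin j :
  bounded_measurable `[a, b] (fun x => sin (j.*2.+1%:R * w * x)).
Proof.
split; last by exists 1 => x _; exact: sin_max.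
apply: measurable_funTS; apply: continuous_measurable_fun.
exact: continuous_sin_scale.
Qed.

Local Lemma G_cvg0 : \int[mu]_(x in `[a, b]) (G x * sin (j.*2.+1%:R * w * x))
  @[j --> \oo] --> 0.
Proof.
apply: (@orthogonal_coef_cvg0 _ _ _ _ G (fun j x => sin (j.*2.+1%:R * w * x)) (L / 2)) => //.
- exact: itv_finite.
- by rewrite divr_gt0.
- exact: bounded_measurable_G.
- exact: bounded_measurable_sin.
- exact: period_integral_sin_orth.
Qed.

Local Lemma G_bound j :
  `|\int[mu]_(x in `[a, b]) (G x * sin (j.*2.+1%:R * w * x))| <= 4 * M * L * L.
Proof.
have := @le_Rintegral_itv R (fun x => G x * sin (j.*2.+1%:R * w * x)) (4 * M * L)
  _ _ (ltW period_itv_lt).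
rewrite period_itv_len; apply.
  apply: bounded_measurable_integrable => //; first exact: itv_finite.
  exact: bounded_measurableM bounded_measurable_G (bounded_measurable_sin j).
move=> x /andP[ax xb]; rewrite normrM -[leRHS]mulr1 ler_pM ?G_le //.
exact: sin_max.
Qed.

Local Lemma Rintegral_ord_sum (F : nat -> R -> R) n :
  (forall k, continuous (F k)) ->
  \int[mu]_(x in `[a, b]) (\sum_(k < n) F k x) =
  \sum_(k < n) \int[mu]_(x in `[a, b]) F k x.
Proof.
move=> cF; elim: n => [|n IH].
  by under eq_Rintegral do rewrite big_ord0; rewrite Rintegral_cst // mul0r big_ord0.
under eq_Rintegral do rewrite big_ord_recr.
rewrite RintegralD //=; last first.
- exact: continuous_itv_integrable.
- apply: (@continuous_itv_integrable R (fun x => \sum_(k < n) F k x)) => x.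
  exact: continuous_ord_sum.
by rewrite IH big_ord_recr.
Qed.

(** Over a full period a linear function is orthogonal to every nonconstant cosine of the kernel, so
    only the central index k = K, of frequency 0, contributes; it gives the trapezoidal value. *)
Local Lemma lin_dirichlet K :
  \int[mu]_(x in `[a, b]) (lin x * D K x) = L * (g a + g b) / 2.
Proof.
under eq_Rintegral do rewrite mulr_sumr.
pose c (k : nat) x := cos ((k%:Z - K%:Z)%:~R * 2 * w * x).
have cc k : continuous (c k) by exact: continuous_cos_scale.
have cl k : continuous (fun x => (x - a) * c k x).
  by move=> x; apply: cvgM; [apply: cvgB; [exact: cvg_id|exact: cvg_cst] | exact: cc].
rewrite (@Rintegral_ord_sum (fun k x => lin x * c k x)); last first.
  by move=> k x; apply: cvgM; [exact: continuous_lin | exact: cc].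
have E (k : nat) : \int[mu]_(x in `[a, b]) (lin x * c k x) =
    if k == K then L * (g a + g b) / 2 else 0.
  have -> : \int[mu]_(x in `[a, b]) (lin x * c k x) =
     \int[mu]_(x in `[a, b]) (g a * c k x + (g b - g a) / L * ((x - a) * c k x)).
    by under eq_Rintegral do rewrite mulrDl -[_ / L * _ * _]mulrA.
  rewrite RintegralD //=; last first.
  - apply: (@continuous_itv_integrable R (fun x => (g b - g a) / L * ((x - a) * c k x))) => x.
    by apply: cvgM; [exact: cvg_cst | exact: cl].
  - apply: (@continuous_itv_integrable R (fun x => g a * c k x)) => x.
    by apply: cvgM; [exact: cvg_cst | exact: cc].
  rewrite !RintegralZl //=; try exact: continuous_itv_integrable.
  rewrite /c period_integral_cos period_integral_linear_cos subr_eq0 eqz_nat.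
  by case: ifP => _; field; rewrite gt_eqF.
have Kl : (K < K.*2.+1)%N by rewrite ltnS -addnn leq_addr.
rewrite (bigD1 (Ordinal Kl)) //= E eqxx big1 ?addr0 // => i iK.
by rewrite E ifF //; apply: contraNF iK => /eqP iK; apply/eqP/val_inj.
Qed.

Local Lemma continuous_dirichlet K : continuous (D K).
Proof.
apply: (@continuous_ord_sum _ (fun k x => cos ((k%:Z - K%:Z)%:~R * 2 * w * x))) => k.
exact: continuous_cos_scale.
Qed.

Local Lemma period_dirichletE K :
  \int[mu]_(x in `[a, b]) (g x * D K x) - L * (g a + g b) / 2 =
  \int[mu]_(x in `[a, b]) (G x * sin (K.*2.+1%:R * w * x)).
Proof.
have cg := is_derive_continuous dgP.
rewrite -(lin_dirichlet K) -RintegralB //=; first last.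
- apply: (@continuous_itv_integrable R (fun x => lin x * D K x)) => x.
  by apply: cvgM; [exact: continuous_lin | exact: continuous_dirichlet].
- apply: (@continuous_itv_integrable R (fun x => g x * D K x)) => x.
  by apply: cvgM; [exact: cg | exact: continuous_dirichlet].
apply: eq_Rintegral => x; rewrite inE /= in_itv /= => /andP[ax xb].
have sD : sin (w * x) * D K x = sin (K.*2.+1%:R * w * x).
  rewrite -[_ * w * x]mulrA -(sin_dirichlet (w * x)); congr (_ * _).
  by apply: eq_bigr => k _; rewrite !mulrA.
by rewrite -mulrBl -sD mulrA (GsinE ax xb).
Qed.

Lemma period_dirichlet_cvg :
  \int[mu]_(x in `[a, b]) (g x * D K x) - L * (g a + g b) / 2
  @[K --> \oo] --> 0.
Proof. under eq_fun do rewrite period_dirichletE; exact: G_cvg0. Qed.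

(** Uniform in [K], and linear in the bound [M] of the derivative on this one period, so that the
    errors of all periods have a summable majorant. *)
Lemma period_dirichlet_bound K :
  `|\int[mu]_(x in `[a, b]) (g x * D K x) - L * (g a + g b) / 2| <= 4 * M * L * L.
Proof. by rewrite period_dirichletE; exact: G_bound. Qed.

End Estimate.
End DirichletKernel.

Section Poisson.
Variable R : realType.
Local Notation mu := (@lebesgue_measure R).
Local Open Scope classical_set_scope.

Lemma is_cvg_series_sqdecay (C L : R) : 0 <= C -> 0 < L ->
  cvgn (series (fun j => C * (1 + (j%:R * L) ^+ 2)^-1)).
Proof.
move=> C0 L0.
have pos (j : nat) : 0 < 1 + (j%:R * L) ^+ 2 by rewrite ltr_pwDl ?sqr_ge0.
suff H : cvgn (series (fun j : nat => (1 + (j%:R * L) ^+ 2)^-1)).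
  by have := @is_cvg_seriesZ _ _ C H; congr (cvgn (series _)); apply/funext.
apply: nondecreasing_is_cvgn.
  by apply: nondecreasing_series => j _; rewrite invr_ge0 ltW.
exists (1 + 2 * L ^- 2) => _ [n _ <-]; rewrite /series /= big_mkord.
have L2 : 0 < L ^- 2 by rewrite invr_gt0 exprn_gt0.
case: n => [|n]; first by rewrite big_ord0; nra.
(* A telescoping majorant: 1/(n+1)^2 <= 2 (1/(n+1) - 1/(n+2)). *)
suff : \sum_(j < n.+1) (1 + (j%:R * L) ^+ 2)^-1 <=
    1 + 2 * L ^- 2 * (1 - n.+1%:R^-1).
  by move=> /le_trans; apply; rewrite lerD2l ler_piMr ?mulr_ge0 ?ltW // gerBl.
elim: n => [|n IH].
  by rewrite big_ord_recl big_ord0 mul0r expr0n addr0 addr0 invr1 subrr mulr0 addr0.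
rewrite big_ord_recr /=; apply: (le_trans (lerD IH (lexx _))).
rewrite -addrA lerD2l -lerBrDl -mulrBr.
have n1 : 0 < n.+1%:R :> R by []. have n2 : n.+2%:R = n.+1%:R + 1 :> R by rewrite -natr1.
have -> : 1 - n.+2%:R^-1 - (1 - n.+1%:R^-1) = (n.+1%:R * n.+2%:R)^-1 :> R.
  by rewrite n2; field; rewrite !gt_eqF //; lra.
apply: (@le_trans _ _ ((n.+1%:R * L) ^+ 2)^-1).
  by rewrite lef_pV2 ?posrE ?lerDr // exprn_gt0 // mulr_gt0.
have -> : 2 * L ^- 2 * (n.+1%:R * n.+2%:R)^-1 =
   ((n.+1%:R * L) ^+ 2)^-1 * (2 * n.+1%:R * n.+2%:R^-1).
  by rewrite n2; field; rewrite !gt_eqF //; lra.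
have n1' : 1 <= n.+1%:R :> R by rewrite ler1n.
by rewrite ler_peMr ?invr_ge0 ?sqr_ge0 // n2 ler_pdivlMr; lra.
Qed.

Lemma normr_squeeze0 (u v : nat -> R) : (forall n, `|u n| <= v n) ->
  v @ \oo --> 0 -> u @ \oo --> 0.
Proof.
move=> uv /cvgrPdist_lt v0; apply/cvgrPdist_lt => e e0.
have := v0 _ e0; apply: filterS => n; rewrite !sub0r !normrN.
by apply: le_lt_trans; rewrite (le_trans (uv n)) // ler_norm.
Qed.

(** Dominated convergence for series: beyond some [T] the tails are small uniformly in [K], and the
    remaining terms are finitely many. *)
Lemma tannery0 (e : nat -> nat -> R) (v : nat -> R) :
  (forall j K, `|e j K| <= v j) -> cvgn (series v) ->
  (forall j, e j K @[K --> \oo] --> 0) ->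
  limn (series (e ^~ K)) @[K --> \oo] --> 0.
Proof.
move=> ev cv e0.
have v0 j : 0 <= v j := le_trans (normr_ge0 _) (ev j 0%N).
have ce K : cvgn (series (e ^~ K)).
  apply: normed_cvg; apply: (@series_le_cvg _ (fun j => `|e j K|) v) => // j.
have tail T K : `|limn (series (e ^~ K))| <=
    `|series (e ^~ K) T| + (limn (series v) - series v T).
  have h : (fun n => `|series (e ^~ K) n|) @ \oo --> `|limn (series (e ^~ K))|.
    exact: cvg_norm (ce K).
  rewrite -(cvg_lim (@Rhausdorff R) h); apply: limr_le; first exact: cvgP h.
  near=> n.
  have Tn : (T <= n)%N by near: n; exact: nbhs_infty_ge.
  rewrite -[series _ n](subrK (series (e ^~ K) T)) addrC.
  apply: (le_trans (ler_normD _ _)); rewrite lerD2l !sub_series_geq //.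
  apply: (le_trans (ler_norm_sum _ _ _)).
  apply: (@le_trans _ _ (\sum_(T <= k < n) v k)); first exact: ler_sum.
  rewrite -sub_series_geq // lerD2r.
  apply: nondecreasing_cvgn_le => //.
  by apply: nondecreasing_series => j _.
apply/cvgrPdist_lt => eps eps0.
have e2 : 0 < eps / 2 by rewrite divr_gt0.
have /cvgrPdist_lt/(_ _ e2) [T _ hT] := cv.
have fin : series (e ^~ K) T @[K --> \oo] --> 0.
  elim: T {hT} => [|T IH].
    by under eq_fun do rewrite /series /= big_geq //; exact: cvg_cst.
  under eq_fun do rewrite seriesSr.
  by rewrite -[0]addr0; apply: cvgD; [exact: IH | exact: e0].
move/cvgrPdist_lt : fin => /(_ _ e2); apply: filterS => K.
rewrite !sub0r !normrN => hK.
apply: (le_lt_trans (tail T K)).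
have := hT T (leqnn T); rewrite /= => /(le_lt_trans (ler_norm _)); lra.
Unshelve. all: by end_near. Qed.

Lemma zpart_cvg_decay (F : int -> R) (C L : R) : 0 < L ->
  (forall m, `|F m| <= C * (1 + (m%:~R * L) ^+ 2)^-1) ->
  cvgn (fun n => \sum_(k < n.*2.+1) F (k%:Z - n%:Z)).
Proof.
move=> L0 FC.
have C0 : 0 <= C.
  have := FC 0; rewrite mul0r expr0n addr0 invr1 mulr1; exact: le_trans.
pose u (j : nat) := F j.+1%:Z + F (- j.+1%:Z).
have -> : (fun n => \sum_(k < n.*2.+1) F (k%:Z - n%:Z)) = (fun n => F 0 + series u n).
  apply/funext; elim=> [|n IH].
    by rewrite big_ord_recl big_ord0 /series /= big_geq.
  by rewrite sum_zsym IH seriesSr /u !addrA.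
apply: is_cvgD; first exact: is_cvg_cst.
apply: normed_cvg; apply: (@series_le_cvg _ _ (fun j => (2 * C) * (1 + (j%:R * L) ^+ 2)^-1)) => //.
- by move=> j /=.
- by move=> j; rewrite mulr_ge0 ?mulr_ge0 // invr_ge0 addr_ge0 ?sqr_ge0.
- move=> j; rewrite /u /= (le_trans (ler_normD _ _)) // mulr_natl mulrnAl mulr2n.
  have h : (1 + (j.+1%:R * L) ^+ 2)^-1 <= (1 + (j%:R * L) ^+ 2)^-1.
    rewrite lef_pV2 ?posrE ?ltr_pwDl ?sqr_ge0 // lerD2l ler_pXn2r ?nnegrE ?mulr_ge0 ?(ltW L0) //.
    by rewrite ler_pM2r // ler_nat.
  rewrite lerD // (le_trans (FC _)) // ler_wpM2l //.
  by rewrite mulrNz mulNr sqrrN.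
- by apply: is_cvg_series_sqdecay => //; rewrite mulr_ge0.
Qed.

Lemma normr_sum_cos_le (t : nat -> R) n : `|\sum_(k < n) cos (t k)| <= n%:R.
Proof.
elim: n => [|n IH]; first by rewrite big_ord0 normr0.
by rewrite big_ord_recr -natr1 (le_trans (ler_normD _ _)) // lerD ?cos_max.
Qed.

Lemma Rintegral_cos_sum (g : R -> R) (C c : R) K :
  continuous g -> sqdecay C g ->
  \int[mu]_x (g x * \sum_(k < K.*2.+1) cos ((k%:Z - K%:Z)%:~R * 2 * c * x)) =
  \sum_(k < K.*2.+1) \int[mu]_x (g x * cos ((k%:Z - K%:Z)%:~R * 2 * c * x)).
Proof.
move=> cg dg.
have H (t : R) : mu.-integrable setT (EFin \o (fun x => g x * cos (t * x))).
  apply: (@integrable_sqdecay _ C).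
    by move=> x; apply: cvgM; [exact: cg | exact: continuous_cos_scale].
  move=> x; rewrite normrM -[leRHS]mulr1 ler_pM //; exact: cos_max.
elim: (K.*2.+1) => [|n IH].
  under eq_Rintegral do rewrite big_ord0 mulr0.
  by rewrite big_ord0 /Rintegral; under eq_integral do rewrite /=; rewrite integral0.
under eq_Rintegral do rewrite big_ord_recr mulrDr.
rewrite RintegralD //=; last first.
  apply: (@integrable_sqdecay _ (C * n%:R) (fun x => g x * \sum_(k < n) cos ((k%:Z - K%:Z)%:~R * 2 * c * x))).
    move=> x; apply: cvgM; first exact: cg.
    apply: (@continuous_ord_sum _ (fun k x => cos ((k%:Z - K%:Z)%:~R * 2 * c * x))) => k.
    exact: continuous_cos_scale.
  move=> x; rewrite normrM mulrAC ler_pM //.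
  exact: (normr_sum_cos_le (fun k => (k%:Z - K%:Z)%:~R * 2 * c * x)).
by rewrite IH big_ord_recr.
Qed.

(** On each period the kernel yields [L] times the mean of the two end values, up to an error;
    adjacent periods share end values, which therefore add up to the full sum. Cosines suffice since
    sine terms cancel between opposite frequencies. *)
Theorem real_poisson (g dg : R -> R) (C L : R) : 0 < L ->
  (forall x : R, is_derive x 1 g (dg x)) -> sqdecay C g -> sqdecay C dg ->
  \sum_(k < K.*2.+1) \int[mu]_x (g x * cos ((k%:Z - K%:Z)%:~R * 2 * (pi / L) * x))
  @[K --> \oo] --> L * zsum_real (fun m => g (m%:~R * L)).
Proof.
move=> L0 dgP gC dgC; have cg := is_derive_continuous dgP.
have C0 : 0 <= C.
  have := gC 0; rewrite expr0n addr0 invr1 mulr1; exact: le_trans.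
pose D K x := \sum_(k < K.*2.+1) cos ((k%:Z - K%:Z)%:~R * 2 * (pi / L) * x).
have cD K : continuous (D K).
  apply: (@continuous_ord_sum _ (fun k x => cos ((k%:Z - K%:Z)%:~R * 2 * (pi / L) * x))) => k.
  exact: continuous_cos_scale.
have cgD K : continuous (fun x => g x * D K x).
  by move=> x; apply: cvgM; [exact: cg | exact: cD].
have igD K : mu.-integrable setT (EFin \o (fun x => g x * D K x)).
  apply: (@integrable_sqdecay _ (C * (K.*2.+1)%:R)) => // x.
  rewrite normrM mulrAC ler_pM //.
  exact: (normr_sum_cos_le (fun k => (k%:Z - K%:Z)%:~R * 2 * (pi / L) * x)).
pose S := zsum_real (fun m => g (m%:~R * L)).
pose P n := \sum_(k < n.*2.+1) g ((k%:Z - n%:Z)%:~R * L).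
have cP : P @ \oo --> S.
  by apply: (@zpart_cvg_decay (fun m => g (m%:~R * L)) C L) => // m; exact: gC.
pose r (m : int) K := \int[mu]_(x in `[m%:~R * L, (m + 1)%:~R * L]) (g x * D K x)
  - L * (g (m%:~R * L) + g ((m + 1)%:~R * L)) / 2.
(* The periods starting at jL and at -(j+1)L are treated together: on both, |x| >= jL, so the
   derivative is at most C/(1+(jL)^2) there. *)
pose e (j K : nat) := r j%:Z K + r (- j.+1%:Z) K.
pose v (j : nat) := 8 * C * L ^+ 2 * (1 + (j%:R * L) ^+ 2)^-1.
have mono (j : nat) x : j%:R * L <= `|x| -> C * (1 + x ^+ 2)^-1 <= C * (1 + (j%:R * L) ^+ 2)^-1.
  move=> jx; rewrite ler_wpM2l // lef_pV2 ?posrE ?ltr_pwDl ?sqr_ge0 // lerD2l.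
  by rewrite -[x ^+ 2]real_normK ?num_real // ler_pXn2r ?nnegrE ?mulr_ge0 ?(ltW L0).
have ev j K : `|e j K| <= v j.
  have -> : v j = 4 * (C * (1 + (j%:R * L) ^+ 2)^-1) * L * L +
                  4 * (C * (1 + (j%:R * L) ^+ 2)^-1) * L * L by rewrite /v; ring.
  rewrite (le_trans (ler_normD _ _)) // lerD //.
    apply: (period_dirichlet_bound L0 dgP) => x /andP[x1 x2].
    rewrite (le_trans (dgC x)) // mono // (le_trans _ (ler_norm _)) //.
  apply: (period_dirichlet_bound L0 dgP) => x /andP[x1 x2].
  rewrite (le_trans (dgC x)) // mono // -normrN (le_trans _ (ler_norm _)) //.
  rewrite lerNr (le_trans x2) //.
  by rewrite (_ : - j.+1%:Z + 1 = - j%:Z); [rewrite mulrNz mulNr | lia].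
have cv : cvgn (series v) by apply: is_cvg_series_sqdecay => //; rewrite mulr_ge0 ?sqr_ge0 // mulr_ge0.
have e0 j : e j K @[K --> \oo] --> 0.
  have dgB x : `|dg x| <= C.
    by rewrite (le_trans (dgC x)) // ler_piMr // invf_le1 ?ltr_pwDl ?sqr_ge0 // lerDl sqr_ge0.
  have rc m : r m K @[K --> \oo] --> 0.
    exact: (@period_dirichlet_cvg R L m L0 g dg C dgP (fun x _ => dgB x)).
  by rewrite -[0]addr0; apply: cvgD; exact: rc.
(* The trapezoidal rule on 2T periods: all sample values count fully except the two outermost ones,
   which count half. *)
have J T K : \int[mu]_(x in `[- (T%:R * L), T%:R * L]) (g x * D K x) =
    L * (P T - (g (T%:R * L) + g (- (T%:R * L))) / 2) + series (e ^~ K) T.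
  elim: T => [|T IH].
    rewrite mul0r oppr0 set_itv1 Rintegral_set1 /P big_ord_recl big_ord0.
    by rewrite /series /= big_geq // subrr mul0r; field.
  have le1 : - (T.+1%:R * L) <= - (T%:R * L) by rewrite lerN2 ler_pM2r // ler_nat.
  have le2 : - (T%:R * L) <= T%:R * L.
    by rewrite -subr_ge0 opprK addr_ge0 // mulr_ge0 // ltW.
  have le3 : T%:R * L <= T.+1%:R * L by rewrite ler_pM2r // ler_nat.
  rewrite (Rintegral_itv_cat (cgD K) le1) ?(le_trans le2 le3) //.
  rewrite (Rintegral_itv_cat (cgD K) le2 le3) IH seriesSr /e /r.
  have -> : - T.+1%:Z + 1 = - T%:Z by lia.
  have -> : T%:Z + 1 = T.+1%:Z by lia.
  rewrite !mulrNz !mulNr -![_%:Z%:~R]/(_%:R).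
  rewrite /P (sum_zsym (fun m => g (m%:~R * L))) !mulrNz !mulNr -![_%:Z%:~R]/(_%:R).
  by field.
have gT0 : (fun T : nat => (g (T%:R * L) + g (- (T%:R * L))) / 2) @ \oo --> 0.
  have s0 := cvg_series_cvg_0 (is_cvg_series_sqdecay C0 L0).
  apply: normr_squeeze0 s0 => T; rewrite normrM (ger0_norm (x := 2^-1)) //.
  rewrite ler_pdivrMr // mulr_natr mulr2n (le_trans (ler_normD _ _)) //.
  by rewrite lerD // (le_trans (gC _)) // sqrrN.
have EK K : \int[mu]_x (g x * D K x) = L * S + limn (series (e ^~ K)).
  have ce : cvgn (series (e ^~ K)).
    apply: normed_cvg; apply: (@series_le_cvg _ (fun j => `|e j K|) v) => // j.
    by rewrite (le_trans _ (ev j K)).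
  have h1 := Rintegral_sym_cvg L0 (igD K).
  have h2 : \int[mu]_(x in `[- (T%:R * L), T%:R * L]) (g x * D K x) @[T --> \oo]
      --> L * S + limn (series (e ^~ K)).
    under eq_fun do rewrite J.
    apply: cvgD => //; rewrite -[S]subr0; apply: cvgM; first exact: cvg_cst.
    exact: cvgB.
  exact: cvg_unique h1 h2.
rewrite -[L * _]addr0.
under eq_fun do rewrite -(Rintegral_cos_sum _ _ cg gC) EK.
by apply: cvgD; [exact: cvg_cst | exact: (tannery0 ev cv e0)].
Qed.

End Poisson.

(** * Summation over the integers and componentwise complex limits *)

Section Summation.
Variable R : realType.
Local Open Scope classical_set_scope.

Lemma esum_int (a : int -> \bar R) : (forall m, 0 <= a m)%E ->
  (\esum_(i in [set: int]) a i =
   \esum_(n in [set: nat]) a (Posz n) + \esum_(n in [set: nat]) a (Negz n))%E.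
Proof.
move=> a0; rewrite (esumID [set m : int | 0 <= m]) //; congr (_ + _)%E.
- rewrite setTI; apply: reindex_esum; split => //.
  + by move=> m n _ _ [].
  + by case=> // n _; exists n.
- rewrite setTI; apply: reindex_esum; split => //.
  + by move=> m n _ _ [].
  + by case=> n //= _; exists n.
Qed.

Lemma esum_nat_lty (u : nat -> R) : (forall n, 0 <= u n) -> cvgn (series u) ->
  (\esum_(n in [set: nat]) (u n)%:E < +oo)%E.
Proof.
move=> u0 cu; rewrite -nneseries_esumT; last by move=> n; rewrite lee_fin.
rewrite (_ : (fun n => _) = EFin \o series u).
  by rewrite EFin_lim // ltry.
by apply/funext => n; rewrite /= sumEFin.
Qed.

Lemma esum_int_lty (F : int -> R) (C L : R) : 0 < L ->
  (forall m, 0 <= F m <= C * (1 + (m%:~R * L) ^+ 2)^-1) ->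
  (\esum_(i in [set: int]) (F i)%:E < +oo)%E.
Proof.
move=> L0 FC.
have C0 : 0 <= C.
  have /andP[h1 h2] := FC 0; have := le_trans h1 h2.
  by rewrite mul0r expr0n addr0 invr1 mulr1.
have cv := is_cvg_series_sqdecay C0 L0.
have F0 m : 0 <= F m by case/andP: (FC m).
rewrite esum_int; last by move=> m; rewrite lee_fin.
apply: lte_add_pinfty; apply: esum_nat_lty => //;
    apply: (@series_le_cvg _ _ (fun j => C * (1 + (j%:R * L) ^+ 2)^-1)) => //.
- by move=> j; rewrite mulr_ge0 // invr_ge0 addr_ge0 ?sqr_ge0.
- by move=> j; case/andP: (FC j).
- by move=> j; rewrite mulr_ge0 // invr_ge0 addr_ge0 ?sqr_ge0.
- move=> j; have /andP[_ /le_trans -> //] := FC (Negz j).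
  rewrite ler_wpM2l // lef_pV2 ?posrE ?ltr_pwDl ?sqr_ge0 // lerD2l.
  rewrite NegzE mulrNz mulNr sqrrN ler_pXn2r ?nnegrE ?mulr_ge0 ?(ltW L0) //.
  by rewrite ler_pM2r // ler_nat.
Qed.

(** The inequality 1 + x^2 <= 2(1+t^2)(1+(x+t)^2) is shown by writing the difference as 1 plus a
    nonnegative combination of squares. *)
Lemma sqdecay_shift (C t : R) (f : R -> R) : 0 <= C -> sqdecay C f ->
  sqdecay (C * (2 * (1 + t ^+ 2))) (fun x => f (x + t)).
Proof.
move=> C0 fC x; rewrite (le_trans (fC _)) // -mulrA ler_wpM2l //.
have p1 : 0 < 1 + x ^+ 2 by rewrite ltr_pwDl ?sqr_ge0.
have p2 : 0 < 1 + (x + t) ^+ 2 by rewrite ltr_pwDl ?sqr_ge0.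
rewrite ler_pdivlMr // mulrC ler_pdivrMr //.
rewrite -subr_ge0.
have -> : 2 * (1 + t ^+ 2) * (1 + (x + t) ^+ 2) - (1 + x ^+ 2) =
  1 + (x + 2 * t) ^+ 2 + 2 * (t * (x + t)) ^+ 2 by ring.
have := sqr_ge0 (x + 2 * t); have := sqr_ge0 (t * (x + t)); lra.
Qed.

End Summation.

Section ComplexLimits.
Variable R : realType.
Local Open Scope classical_set_scope.
Implicit Types (u v : nat -> R[i]) (F : int -> R[i]).

(** Convergence is taken by components to match [zsum], which is defined by components. *)
Definition ccvg u (l : R[i]) :=
  (complex.Re (u n) @[n --> \oo] --> complex.Re l) /\
  (complex.Im (u n) @[n --> \oo] --> complex.Im l).

Lemma ccvg_cst l : ccvg (fun=> l) l.
Proof. by split; exact: cvg_cst. Qed.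

Lemma ccvgD u v l l' : ccvg u l -> ccvg v l' -> ccvg (fun n => u n + v n) (l + l').
Proof.
move=> [u1 u2] [v1 v2]; split; rewrite !raddfD /=;
  under eq_fun do rewrite raddfD /=; exact: cvgD.
Qed.

Lemma ccvgM_l c u l : ccvg u l -> ccvg (fun n => c * u n) (c * l).
Proof.
case: c l => [c1 c2] [l1 l2] [/= u1 u2]; split => /=.
- rewrite (_ : (fun n => _) = (fun n => c1 * complex.Re (u n) - c2 * complex.Im (u n))).
    by apply: cvgB; apply: cvgM => //; exact: cvg_cst.
  by apply/funext => n; case: (u n).
- rewrite (_ : (fun n => _) = (fun n => c1 * complex.Im (u n) + c2 * complex.Re (u n))).
    by apply: cvgD; apply: cvgM => //; exact: cvg_cst.
  by apply/funext => n; case: (u n).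
Qed.

Lemma ccvg_sum q (u : nat -> nat -> R[i]) (l : nat -> R[i]) :
  (forall j, (j < q)%N -> ccvg (u j) (l j)) ->
  ccvg (fun n => \sum_(j < q) u j n) (\sum_(j < q) l j).
Proof.
elim: q => [|q IH] h.
  by rewrite big_ord0; under eq_fun do rewrite big_ord0; exact: ccvg_cst.
rewrite big_ord_recr; under eq_fun do rewrite big_ord_recr /=.
by apply: ccvgD; [apply: IH => j jq; apply: h; exact: ltnW | exact: h].
Qed.

Lemma ccvg_unique u l l' : ccvg u l -> ccvg u l' -> l = l'.
Proof.
case: l l' => [l1 l2] [l1' l2'] [/= h1 h2] [/= h1' h2'].
by congr Complex; [exact: cvg_unique h1 h1' | exact: cvg_unique h2 h2'].
Qed.

Lemma ccvg_subseq u l (s : nat -> nat) : ccvg u l -> s @ \oo --> \oo ->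
  ccvg (u \o s) l.
Proof. by move=> [u1 u2] sy; split; [apply: cvg_comp sy u1 | apply: cvg_comp sy u2]. Qed.

Definition zpart F (n : nat) := \sum_(k < n.*2.+1) F (k%:Z - n%:Z).

Lemma Re_sum n (G : 'I_n -> R[i]) :
  complex.Re (\sum_(k < n) G k) = \sum_(k < n) complex.Re (G k).
Proof. exact: raddf_sum. Qed.

Lemma Im_sum n (G : 'I_n -> R[i]) :
  complex.Im (\sum_(k < n) G k) = \sum_(k < n) complex.Im (G k).
Proof. exact: raddf_sum. Qed.

Lemma zsumE F l : ccvg (zpart F) l -> zsum F = l.
Proof.
case: l => [l1 l2] [/= h1 h2]; congr Complex; apply: (cvg_lim (@Rhausdorff R)).
  by under eq_fun do rewrite -Re_sum.
by under eq_fun do rewrite -Im_sum.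
Qed.

Lemma Re_norm_le (z : R[i]) : complex.Re `|z| <= `|complex.Re z| + `|complex.Im z|.
Proof.
rewrite normc_def /= -[leRHS]ger0_norm ?addr_ge0 // -sqrtr_sqr ler_wsqrtr //.
by rewrite sqrrD !real_normK ?num_real // addrAC lerDl mulrn_wge0 //.
Qed.

End ComplexLimits.

Section Exponential.
Variable R : realType.
Implicit Types (x y : R) (k : int).

Lemma expiD x y : expi (x + y) = expi x * expi y.
Proof.
apply/eqP; rewrite eq_complex /= mulrDr cosD sinD eqxx /=.
by rewrite addrC [sin (_ * x) * _]mulrC.
Qed.

Lemma expi_int k : expi k%:~R = 1 :> R[i].
Proof. by rewrite /expi sin_2piz cos_2piz. Qed.

Lemma expi0 : expi 0 = 1 :> R[i].
Proof. exact: (expi_int 0). Qed.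

Lemma norm_expi x : `|expi x| = 1.
Proof. by rewrite normc_def /= cos2Dsin2 sqrtr1. Qed.

Lemma expi_neq0 x : expi x != 0.
Proof. by rewrite -normr_gt0 norm_expi. Qed.

Lemma expiN x : expi (- x) = (expi x)^-1.
Proof.
apply: (mulfI (expi_neq0 x)).
by rewrite -expiD subrr expi0 divff ?expi_neq0.
Qed.

End Exponential.

(** * Decay of the Fourier transform of a Schwartz function *)

Section Fourier.
Variable R : realType.
Local Notation mu := (@lebesgue_measure R).
Local Open Scope classical_set_scope.

Lemma Rintegral_derivative_eq0 (F f : R -> R) (C C' : R) :
  (forall x : R, is_derive x 1 F (f x)) -> continuous f ->
  sqdecay C F -> sqdecay C' f -> \int[mu]_x f x = 0.
Proof.
move=> dF cf FC fC.
have h1 := Rintegral_sym_cvg ltr01 (integrable_sqdecay cf fC).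
apply: cvg_unique h1 _ => //.
have C0 : 0 <= C.
  have := FC 0; rewrite expr0n addr0 invr1 mulr1; exact: le_trans.
have s0 := cvg_series_cvg_0 (is_cvg_series_sqdecay (C := 2 * C) (mulr_ge0 (ler0n _ 2) C0) ltr01).
apply: normr_squeeze0 s0 => n.
rewrite (@Rintegral_FTC R F) //; last by rewrite -subr_ge0 opprK mulr1 addr_ge0.
apply: (le_trans (ler_normB _ _)).
rewrite -mulrA [leRHS]mulr_natl mulr2n lerD ?FC //.
by rewrite (le_trans (FC _)) // sqrrN.
Qed.

Lemma derivable1_is_derive (f : R -> R) (x : R) : derivable f x 1 ->
  is_derive x 1 f (f^`() x).
Proof. by move=> df; rewrite derive1E; exact: derivableP. Qed.

Lemma schwartz_real_decay (g : R -> R) k : schwartz_real g ->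
  exists2 C, 0 <= C & sqdecay C (derive1n k g).
Proof.
move=> /(_ k)[_ B]; have [M0 h0] := B 0%N; have [M2 h2] := B 2%N.
have M00 : 0 <= M0 by apply: le_trans (h0 0).
have M20 : 0 <= M2 by apply: le_trans (h2 0).
exists (M0 + M2); first exact: addr_ge0.
move=> x; rewrite ler_pdivlMr ?ltr_pwDl ?sqr_ge0 // mulrDr mulr1 lerD //.
  by have := h0 x; rewrite expr0 mul1r.
by have := h2 x; rewrite normrM mulrC (ger0_norm (sqr_ge0 _)).
Qed.

Lemma schwartz_real_derive (g : R -> R) k (x : R) : schwartz_real g ->
  is_derive x 1 (derive1n k g) (derive1n k.+1 g x).
Proof. by move=> /(_ k)[d _]; exact: derivable1_is_derive. Qed.

(* The derivative of [g' cos (c + s x) + s g sin (c + s x)] is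
   [(g'' + s^2 g) cos (c + s x)], which therefore has integral [0]. *)
Lemma trig_transform_bound (g g1 g2 : R -> R) (C0 C1 C2 : R) :
  (forall x : R, is_derive x 1 g (g1 x)) ->
  (forall x : R, is_derive x 1 g1 (g2 x)) -> continuous g2 ->
  0 <= C0 -> 0 <= C1 -> 0 <= C2 ->
  sqdecay C0 g -> sqdecay C1 g1 -> sqdecay C2 g2 ->
  exists K, forall c, sqdecay K (fun s => \int[mu]_x (g x * cos (c + s * x))).
Proof.
move=> D0 D1 cg2 C00 C10 C20 d0 d1 d2.
have cg := is_derive_continuous D0.
pose I := \int[mu]_x (1 * (1 + x ^+ 2)^-1).
have I0 : 0 <= I by apply: Rintegral_ge0 => x _; rewrite mul1r invr_ge0 addr_ge0 ?sqr_ge0.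
exists (C0 * I + C2 * I) => c s.
have dcos (x : R) : is_derive x 1 (fun x => cos (c + s * x)) (- (s * sin (c + s * x))).
  by apply: is_derive_eq; rewrite /GRing.scale /=; ring.
have dsin (x : R) : is_derive x 1 (fun x => sin (c + s * x)) (s * cos (c + s * x)).
  by apply: is_derive_eq; rewrite /GRing.scale /=; ring.
have ccos := is_derive_continuous dcos; have csin := is_derive_continuous dsin.
have dcy (C : R) (f : R -> R) : sqdecay C f -> sqdecay C (fun x => f x * cos (c + s * x)).
  by move=> fC x; rewrite normrM -[leRHS]mulr1 ler_pM ?fC ?cos_max.
have ct (f : R -> R) : continuous f -> continuous (fun x => f x * cos (c + s * x)).
  by move=> cf x; apply: cvgM; [exact: cf | exact: ccos].
have bnd (C : R) (f : R -> R) : continuous f -> sqdecay C f ->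
    `|\int[mu]_x (f x * cos (c + s * x))| <= C * I.
  move=> cf fC.
  have iF := integrable_sqdecay (ct f cf) (dcy C f fC).
  apply: (le_trans (le_normr_Rintegral measurableT iF)).
  have i1 := integrable_oneDsqrV (1 : R).
  rewrite /I -RintegralZl //; apply: le_Rintegral => //.
  - exact: integrable_norm.
  - have := integrable_oneDsqrV C; apply: eq_integrable => // x _.
    by rewrite /= mul1r.
  - by move=> x _; rewrite mul1r; exact: dcy.
have key : \int[mu]_x (g2 x * cos (c + s * x)) + s ^+ 2 * \int[mu]_x (g x * cos (c + s * x)) = 0.
  have i0 := integrable_sqdecay (ct g cg) (dcy _ g d0).
  have i2 := integrable_sqdecay (ct g2 cg2) (dcy _ g2 d2).
  rewrite -RintegralZl // -RintegralD //; last first.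
    by have := integrableZl measurableT (s ^+ 2) i0; apply: eq_integrable.
  apply: (@Rintegral_derivative_eq0
    (fun x => g1 x * cos (c + s * x) + s * (g x * sin (c + s * x))) _
    (C1 + `|s| * C0) (C2 + s ^+ 2 * C0)).
  - move=> x; have ? := D0 x; have ? := D1 x; have ? := dcos x; have ? := dsin x.
    by apply: is_derive_eq; rewrite /GRing.scale /=; ring.
  - move=> x; apply: cvgD; first exact: ct.
    by apply: cvgM; [exact: cvg_cst | exact: ct].
  - move=> x; rewrite (le_trans (ler_normD _ _)) // mulrDl lerD //.
      by rewrite normrM -[leRHS]mulr1 ler_pM ?d1 ?cos_max.
    rewrite normrM -mulrA ler_wpM2l // normrM -[leRHS]mulr1 ler_pM ?d0 //.
    exact: sin_max.
  - move=> x; rewrite (le_trans (ler_normD _ _)) // mulrDl lerD //; first exact: dcy.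
    by rewrite normrM (ger0_norm (sqr_ge0 s)) -mulrA ler_wpM2l ?sqr_ge0 //; exact: dcy.
have b0 := bnd _ g cg d0; have b2 := bnd _ g2 cg2 d2.
rewrite ler_pdivlMr ?ltr_pwDl ?sqr_ge0 // mulrDr mulr1 lerD //.
rewrite mulrC -[s ^+ 2]ger0_norm ?sqr_ge0 // -normrM.
by rewrite -normrN (_ : - _ = \int[mu]_x (g2 x * cos (c + s * x))) //; move: key; lra.
Qed.

(** The phase [c] lets one constant serve both transforms: c = 0 gives cosines and c = - pi/2 gives
    sines. *)
Lemma schwartz_trig_transform_decay (g : R -> R) : schwartz_real g ->
  exists K, forall c, sqdecay K (fun s => \int[mu]_x (g x * cos (c + s * x))).
Proof.
move=> Sg.
have [C0 C00 d0] := schwartz_real_decay 0 Sg.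
have [C1 C10 d1] := schwartz_real_decay 1 Sg.
have [C2 C20 d2] := schwartz_real_decay 2 Sg.
have D2 (x : R) := schwartz_real_derive 2 x Sg.
have cg2 := is_derive_continuous D2.
exact: (trig_transform_bound (fun x => schwartz_real_derive 0 x Sg)
  (fun x => schwartz_real_derive 1 x Sg) cg2 C00 C10 C20 d0 d1 d2).
Qed.

Lemma fourierE (h : R -> R[i]) s : fourier h s =
  Complex (\int[mu]_x (complex.Re (h x) * cos (2 * pi * s * x) + complex.Im (h x) * sin (2 * pi * s * x)))
    (\int[mu]_x (complex.Im (h x) * cos (2 * pi * s * x) - complex.Re (h x) * sin (2 * pi * s * x))).
Proof.
have E x : h x * expi (- (s * x)) =
   Complex (complex.Re (h x) * cos (2 * pi * s * x) + complex.Im (h x) * sin (2 * pi * s * x))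
    (complex.Im (h x) * cos (2 * pi * s * x) - complex.Re (h x) * sin (2 * pi * s * x)).
  rewrite /expi mulrN sinN cosN mulrA; case: (h x) => a b.
  by apply/eqP; rewrite eq_complex /= mulrN opprK eqxx /= addrC mulrN.
by rewrite /fourier /Cintegral; congr Complex; apply: eq_Rintegral => x _; rewrite E.
Qed.

Lemma fourier_decay (h : R -> R[i]) : schwartz h ->
  exists2 K, 0 <= K & sqdecay K (fun s => complex.Re `|fourier h s|).
Proof.
move=> [S1 S2].
have [K1 k1] := schwartz_trig_transform_decay S1.
have [K2 k2] := schwartz_trig_transform_decay S2.
have [C1 C10 d1] := schwartz_real_decay 0 S1.
have [C2 C20 d2] := schwartz_real_decay 0 S2.
have cr1 := is_derive_continuous (fun x => schwartz_real_derive 0 x S1).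
have cr2 := is_derive_continuous (fun x => schwartz_real_derive 0 x S2).
have K10 : 0 <= K1.
  have := k1 0 0; rewrite expr0n addr0 invr1 mulr1; exact: le_trans.
have K20 : 0 <= K2.
  have := k2 0 0; rewrite expr0n addr0 invr1 mulr1; exact: le_trans.
exists (2 * (K1 + K2)); first by rewrite mulr_ge0 ?addr_ge0.
have sinE (c x : R) : sin (c * x) = cos (- (pi / 2) + c * x).
  by rewrite addrC cosBpihalf.
have Ie (f : R -> R) (C c t : R) : continuous f -> sqdecay C f ->
    mu.-integrable setT (EFin \o (fun x => f x * cos (t + c * x))).
  move=> cf fC; apply: (@integrable_sqdecay _ C).
    move=> x; apply: cvgM; first exact: cf.
    apply: (@is_derive_continuous R _ (fun x => - (c * sin (t + c * x)))) => y.
    by apply: is_derive_eq; rewrite /GRing.scale /=; ring.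
  by move=> x; rewrite normrM -[leRHS]mulr1 ler_pM ?fC ?cos_max.
have Ie0 (f : R -> R) (C c : R) : continuous f -> sqdecay C f ->
    mu.-integrable setT (EFin \o (fun x => f x * cos (c * x))).
  by move=> cf fC; have := Ie f C c 0 cf fC; under [in X in X -> _]eq_fun do rewrite /= add0r.
move=> s; rewrite fourierE.
under eq_Rintegral do rewrite sinE.
under [X in Complex _ X]eq_Rintegral do rewrite sinE.
rewrite RintegralD //; [|exact: Ie0 cr1 d1|exact: Ie cr2 d2].
rewrite RintegralB //; [|exact: Ie0 cr2 d2|exact: Ie cr1 d1].
have decay_le (K : R) : 0 <= K -> K * (1 + (2 * pi * s) ^+ 2)^-1 <= K * (1 + s ^+ 2)^-1.
  move=> K0; rewrite ler_wpM2l // lef_pV2 ?posrE ?ltr_pwDl ?sqr_ge0 // lerD2l.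
  rewrite exprMn ler_peMl ?sqr_ge0 //.
  by have := pi_ge2 R => ?; nra.
have b1 t : `|\int[mu]_x (complex.Re (h x) * cos (t + 2 * pi * s * x))| <= K1 * (1 + s ^+ 2)^-1.
  by apply: le_trans (k1 t _) (decay_le _ K10).
have b2 t : `|\int[mu]_x (complex.Im (h x) * cos (t + 2 * pi * s * x))| <= K2 * (1 + s ^+ 2)^-1.
  by apply: le_trans (k2 t _) (decay_le _ K20).
have b10 : `|\int[mu]_x (complex.Re (h x) * cos (2 * pi * s * x))| <= K1 * (1 + s ^+ 2)^-1.
  by have := b1 0; under eq_Rintegral do rewrite add0r.
have b20 : `|\int[mu]_x (complex.Im (h x) * cos (2 * pi * s * x))| <= K2 * (1 + s ^+ 2)^-1.
  by have := b2 0; under eq_Rintegral do rewrite add0r.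
rewrite ger0_norm; last by rewrite normc_def /= sqrtr_ge0.
apply: (le_trans (Re_norm_le _)) => /=.
have -> : 2 * (K1 + K2) / (1 + s ^+ 2) =
  (K1 / (1 + s ^+ 2) + K2 / (1 + s ^+ 2)) + (K1 / (1 + s ^+ 2) + K2 / (1 + s ^+ 2)).
  by ring.
apply: lerD; first by rewrite (le_trans (ler_normD _ _)) // lerD.
by rewrite (le_trans (ler_normB _ _)) // addrC lerD.
Qed.

End Fourier.

Section ComplexPoisson.
Variable R : realType.
Local Notation mu := (@lebesgue_measure R).
Local Open Scope classical_set_scope.

Lemma zpart_odd_eq0 (F : int -> R) n : F 0 = 0 -> (forall m, F (- m) = - F m) ->
  \sum_(k < n.*2.+1) F (k%:Z - n%:Z) = 0.
Proof.
move=> F0 FN; elim: n => [|n IH]; first by rewrite big_ord_recl big_ord0 addr0.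
by rewrite sum_zsym IH FN add0r subrr.
Qed.

Lemma integrable_trig_sqdecay (f : R -> R) (C c : R) : continuous f -> sqdecay C f ->
  mu.-integrable setT (EFin \o (fun x => f x * cos (c * x))) /\
  mu.-integrable setT (EFin \o (fun x => f x * sin (c * x))).
Proof.
move=> cf fC; split; apply: (@integrable_sqdecay _ C).
- by move=> x; apply: cvgM; [exact: cf | exact: continuous_cos_scale].
- by move=> x; rewrite normrM -[leRHS]mulr1 ler_pM ?fC ?cos_max.
- by move=> x; apply: cvgM; [exact: cf | exact: continuous_sin_scale].
- by move=> x; rewrite normrM -[leRHS]mulr1 ler_pM ?fC ?sin_max.
Qed.

Lemma schwartz_tame (h : R -> R[i]) : schwartz h ->
  exists h1' h2' C, [/\ 0 <= C,
    (forall x : R, is_derive x 1 (fun x => complex.Re (h x)) (h1' x)),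
    (forall x : R, is_derive x 1 (fun x => complex.Im (h x)) (h2' x)) &
    [/\ sqdecay C (fun x => complex.Re (h x)), sqdecay C (fun x => complex.Im (h x)),
     sqdecay C h1' & sqdecay C h2']].
Proof.
move=> [S1 S2].
have [C1 C10 d1] := schwartz_real_decay 0 S1.
have [C2 C20 d2] := schwartz_real_decay 0 S2.
have [C3 C30 d3] := schwartz_real_decay 1 S1.
have [C4 C40 d4] := schwartz_real_decay 1 S2.
have up (K K' : R) (f : R -> R) : K <= K' -> sqdecay K f -> sqdecay K' f.
  move=> KK fK x; rewrite (le_trans (fK x)) // ler_wpM2r // invr_ge0.
  by rewrite addr_ge0 ?sqr_ge0.
exists (derive1n 1 (fun x => complex.Re (h x))), (derive1n 1 (fun x => complex.Im (h x))).
exists (C1 + C2 + C3 + C4); split.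
- by rewrite !addr_ge0.
- by move=> x; exact: (schwartz_real_derive 0 x S1).
- by move=> x; exact: (schwartz_real_derive 0 x S2).
split.
- by apply: up d1; lra.
- by apply: up d2; lra.
- by apply: up d3; lra.
- by apply: up d4; lra.
Qed.

(** The twist is absorbed into the function: g(x) = h(x) e(tx/L) has its Fourier coefficient at k/L
    equal to that of [h] at (k-t)/L. Its real and imaginary parts [g1], [g2] satisfy [real_poisson],
    and the sine coefficients [b], being odd in k, cancel in symmetric sums. *)
Lemma schwartz_poisson (h : R -> R[i]) (L t : R) : 0 < L -> schwartz h ->
  exists l, ccvg (zpart (fun m => h (m%:~R * L) * expi (t * m%:~R))) l /\
    ccvg (zpart (fun k => fourier h ((k%:~R - t) / L))) (real_complex R L * l).
Proof.
move=> L0 /schwartz_tame[h1' [h2' [C [C0 D1 D2 [d1 d2 d1' d2']]]]].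
pose h1 x := complex.Re (h x); pose h2 x := complex.Im (h x).
pose c := 2 * (pi / L) * t.
pose g1 x := h1 x * cos (c * x) - h2 x * sin (c * x).
pose g2 x := h1 x * sin (c * x) + h2 x * cos (c * x).
pose g1' x := (h1' x * cos (c * x) - c * (h1 x * sin (c * x))) -
              (h2' x * sin (c * x) + c * (h2 x * cos (c * x))).
pose g2' x := (h1' x * sin (c * x) + c * (h1 x * cos (c * x))) +
              (h2' x * cos (c * x) - c * (h2 x * sin (c * x))).
have G1 (x : R) : is_derive x 1 g1 (g1' x).
  have ? := D1 x; have ? := D2 x.
  have ? := is_derive_sin_scale c x; have ? := is_derive_cos_scale c x.
  rewrite /g1; apply: is_derive_eq; rewrite /GRing.scale /= /g1' /h1 /h2; ring.
have G2 (x : R) : is_derive x 1 g2 (g2' x).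
  have ? := D1 x; have ? := D2 x.
  have ? := is_derive_sin_scale c x; have ? := is_derive_cos_scale c x.
  rewrite /g2; apply: is_derive_eq; rewrite /GRing.scale /= /g2' /h1 /h2; ring.
pose K := (2 + 2 * `|c|) * C.
have bs (f : R -> R) x : sqdecay C f -> `|f x * sin (c * x)| <= C * (1 + x ^+ 2)^-1.
  by move=> fC; rewrite normrM -[leRHS]mulr1 ler_pM ?fC ?sin_max.
have bc (f : R -> R) x : sqdecay C f -> `|f x * cos (c * x)| <= C * (1 + x ^+ 2)^-1.
  by move=> fC; rewrite normrM -[leRHS]mulr1 ler_pM ?fC ?cos_max.
have E x : K * (1 + x ^+ 2)^-1 =
  (C * (1 + x ^+ 2)^-1 + `|c| * (C * (1 + x ^+ 2)^-1)) +
  (C * (1 + x ^+ 2)^-1 + `|c| * (C * (1 + x ^+ 2)^-1)) by rewrite /K; ring.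
have E0 x : C * (1 + x ^+ 2)^-1 + C * (1 + x ^+ 2)^-1 <= K * (1 + x ^+ 2)^-1.
  by rewrite E; apply: lerD; rewrite lerDl !mulr_ge0 // invr_ge0 addr_ge0 ?sqr_ge0.
have k1 : sqdecay K g1.
  by move=> x; rewrite (le_trans _ (E0 x)) // (le_trans (ler_normB _ _)) // lerD ?bs ?bc.
have k2 : sqdecay K g2.
  by move=> x; rewrite (le_trans _ (E0 x)) // (le_trans (ler_normD _ _)) // lerD ?bs ?bc.
have k1' : sqdecay K g1'.
  move=> x; rewrite E (le_trans (ler_normB _ _)) // lerD //.
    by rewrite (le_trans (ler_normB _ _)) // lerD ?bs ?bc // normrM ler_wpM2l ?bs.
  by rewrite (le_trans (ler_normD _ _)) // lerD ?bs ?bc // normrM ler_wpM2l ?bc.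
have k2' : sqdecay K g2'.
  move=> x; rewrite E (le_trans (ler_normD _ _)) // lerD //.
    by rewrite (le_trans (ler_normD _ _)) // lerD ?bs ?bc // normrM ler_wpM2l ?bc.
  by rewrite (le_trans (ler_normB _ _)) // lerD ?bs ?bc // normrM ler_wpM2l ?bs.
have P1 := real_poisson L0 G1 k1 k1'; have P2 := real_poisson L0 G2 k2 k2'.
have gE x m : x = m%:~R * L -> h x * expi (t * m%:~R) = Complex (g1 x) (g2 x).
  move=> xE; have cE : 2 * pi * (t * m%:~R) = c * x.
    by rewrite xE /c; field; rewrite gt_eqF.
  by rewrite /expi cE /g1 /g2 /h1 /h2; case: (h x) => a b.
exists (Complex (zsum_real (fun m => g1 (m%:~R * L))) (zsum_real (fun m => g2 (m%:~R * L)))).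
split; first split => /=.
- rewrite (_ : (fun n => _) = (fun n => \sum_(k < n.*2.+1) g1 ((k%:Z - n%:Z)%:~R * L))).
    by apply: (@zpart_cvg_decay _ (fun m => g1 (m%:~R * L)) K L) => // m; exact: k1.
  by apply/funext => n; rewrite /zpart Re_sum; apply: eq_bigr => k _; rewrite (gE _ _ erefl).
- rewrite (_ : (fun n => _) = (fun n => \sum_(k < n.*2.+1) g2 ((k%:Z - n%:Z)%:~R * L))).
    by apply: (@zpart_cvg_decay _ (fun m => g2 (m%:~R * L)) K L) => // m; exact: k2.
  by apply/funext => n; rewrite /zpart Im_sum; apply: eq_bigr => k _; rewrite (gE _ _ erefl).
have cg1 := is_derive_continuous G1; have cg2 := is_derive_continuous G2.
pose a (f : R -> R) (k : int) := \int[mu]_x (f x * cos (k%:~R * 2 * (pi / L) * x)).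
pose b (f : R -> R) (k : int) := \int[mu]_x (f x * sin (k%:~R * 2 * (pi / L) * x)).
have fE k : fourier h ((k%:~R - t) / L) = Complex (a g1 k + b g2 k) (a g2 k - b g1 k).
  have [i1 i2] := integrable_trig_sqdecay (k%:~R * 2 * (pi / L)) cg1 k1.
  have [i3 i4] := integrable_trig_sqdecay (k%:~R * 2 * (pi / L)) cg2 k2.
  rewrite fourierE /a /b -RintegralD // -RintegralB //.
  have ang (x : R) : k%:~R * 2 * (pi / L) * x = 2 * pi * ((k%:~R - t) / L) * x + c * x.
    by rewrite /c; field; rewrite gt_eqF.
  have pyth (x : R) : cos (c * x) ^+ 2 = 1 - sin (c * x) ^+ 2 := cos2sin2 _.
  congr Complex; apply: eq_Rintegral => x _; rewrite ang cosD sinD /g1 /g2 -/(h1 x) -/(h2 x).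
  - transitivity (h1 x * cos (2 * pi * ((k%:~R - t) / L) * x) * (cos (c * x) ^+ 2 + sin (c * x) ^+ 2) + h2 x * sin (2 * pi * ((k%:~R - t) / L) * x) * (cos (c * x) ^+ 2 + sin (c * x) ^+ 2)).
      by rewrite cos2Dsin2 !mulr1.
    by ring.
  - transitivity (h2 x * cos (2 * pi * ((k%:~R - t) / L) * x) * (cos (c * x) ^+ 2 + sin (c * x) ^+ 2) - h1 x * sin (2 * pi * ((k%:~R - t) / L) * x) * (cos (c * x) ^+ 2 + sin (c * x) ^+ 2)).
      by rewrite cos2Dsin2 !mulr1.
    by ring.
have b0 (f : R -> R) : b f 0 = 0.
  rewrite /b; under eq_Rintegral do rewrite !mul0r sin0 mulr0.
  by rewrite /Rintegral integral0.
have bN (f : R -> R) K' k : continuous f -> sqdecay K' f -> b f (- k) = - b f k.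
  move=> cf fK; have [_ i2] := integrable_trig_sqdecay (k%:~R * 2 * (pi / L)) cf fK.
  rewrite /b -[RHS]mulN1r -RintegralZl //; apply: eq_Rintegral => x _.
  by rewrite mulrNz !mulNr sinN mulrN mul1r.
split => /=.
- rewrite mul0r subr0.
  rewrite (_ : (fun n => _) = (fun n => \sum_(k < n.*2.+1) a g1 (k%:Z - n%:Z))) //.
  apply/funext => n; rewrite /zpart Re_sum; under eq_bigr do rewrite fE /=.
  rewrite big_split /= (zpart_odd_eq0 (F := b g2)) ?addr0 //.
  by move=> m; exact: bN cg2 k2.
- rewrite mul0r addr0.
  rewrite (_ : (fun n => _) = (fun n => \sum_(k < n.*2.+1) a g2 (k%:Z - n%:Z))) //.
  apply/funext => n; rewrite /zpart Im_sum; under eq_bigr do rewrite fE /=.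
  rewrite big_split /= sumrN (zpart_odd_eq0 (F := b g1)) ?subr0 //.
  by move=> m; exact: bN cg1 k1.
Qed.

End ComplexPoisson.

(** * Finite Fourier transform and twisted Poisson summation *)

Section FiniteFourier.
Variables (R : realType) (q : nat).
Hypothesis q0 : (0 < q)%N.
Implicit Types (F G phi : int -> R[i]).

Local Lemma qR_neq0 : q%:R != 0 :> R. Proof. by rewrite pnatr_eq0 -lt0n. Qed.
Local Lemma qC_neq0 : q%:R != 0 :> R[i]. Proof. by rewrite pnatr_eq0 -lt0n. Qed.

Lemma expi_nat (x : R) (n : nat) : expi (n%:R * x) = expi x ^+ n.
Proof.
elim: n => [|n IH]; first by rewrite mul0r expi0 expr0.
by rewrite -natr1 mulrDl mul1r expiD IH exprSr.
Qed.

Lemma expi_eq1_dvd (d : int) : expi (d%:~R / q%:R : R) = 1 -> (q%:Z %| d)%Z.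
Proof.
move=> e1; apply/dvdz_mod0P/eqP; apply/negP => /negP r0.
have qz : q%:Z != 0 by rewrite eqz_nat -lt0n.
have r_ge0 := modz_ge0 d qz.
have r_lt : (d %% q%:Z)%Z < q%:Z by rewrite ltz_mod.
move: e1; rewrite {1}(divz_eq d q%:Z) intrD intrM mulrDl mulfK ?qR_neq0 //.
rewrite expiD expi_int mul1r.
set r := (d %% q%:Z)%Z in r0 r_ge0 r_lt *.
case=> /eqP + _; apply/negP; rewrite -mulrA mulr_natl cos_mulr2n cos2sin2.
set x := pi * (r%:~R / q%:R).
have x0 : 0 < x < pi.
  rewrite mulr_gt0 ?pi_gt0 ?divr_gt0 ?ltr0z ?ltr0n //=; last by rewrite lt_def r0.
  rewrite gtr_pMr ?pi_gt0 // ltr_pdivrMr ?ltr0n // mul1r.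
  by rewrite -[q%:R]/(q%:Z%:~R) ltr_int.
have s0 := sin_gt0_pi x0; apply/eqP; nra.
Qed.

Lemma sum_expi_mod (d : int) :
  \sum_(t < q) expi (t%:R * (d%:~R / q%:R) : R) = if (q%:Z %| d)%Z then q%:R else 0.
Proof.
case: ifPn => [/dvdzP[c ->]|nd].
  rewrite (eq_bigr (fun=> 1)) ?sumr_const ?card_ord // => t _.
  by rewrite intrM mulfK ?qR_neq0 // expi_nat expi_int expr1n.
under eq_bigr do rewrite expi_nat.
have z1 : expi (d%:~R / q%:R : R) - 1 != 0.
  by rewrite subr_eq0; apply: contraNneq nd => /expi_eq1_dvd.
apply: (mulfI z1); rewrite mulr0 -subrX1 -expi_nat mulrC divfK ?qR_neq0 //.
by rewrite expi_int subrr.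
Qed.

Lemma periodic_eq_mod F (m m' : int) : (forall k, F (k + q%:Z) = F k) ->
  (q%:Z %| m - m')%Z -> F m = F m'.
Proof.
move=> FP /dvdzP[c cE].
have H n k : F (k + q%:Z * n%:Z) = F k.
  elim: n k => [|n IH] k; first by rewrite mulr0 addr0.
  by rewrite -[RHS]IH -[RHS]FP; congr F; rewrite intS mulrDr mulr1 addrAC addrA.
have -> : m = m' + q%:Z * c by rewrite mulrC -cE addrC subrK.
case: c {cE} => n; first exact: H.
by rewrite -[LHS](H n.+1) NegzE mulrN subrK.
Qed.

Lemma periodic_sum_shift F (c : int) : (forall k, F (k + q%:Z) = F k) ->
  \sum_(x < q) F (x%:Z + c) = \sum_(x < q) F x%:Z.
Proof.
move=> FP.
have qz : q%:Z != 0 by rewrite eqz_nat -lt0n.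
have lt_mod (m : int) : (`|(m %% q%:Z)%Z| < q)%N.
  by rewrite -ltz_nat gez0_abs ?modz_ge0 // ltz_mod.
pose s (d : int) (x : 'I_q) : 'I_q := Ordinal (lt_mod (x%:Z + d)).
have sE d x : (s d x)%:Z = ((x%:Z + d) %% q%:Z)%Z by rewrite /= gez0_abs ?modz_ge0.
have sK d : cancel (s d) (s (- d)).
  move=> x; apply/val_inj/eqP; rewrite -eqz_nat sE sE modzDml addrK.
  by rewrite modz_small // ltz_nat ltn_ord.
rewrite [RHS](reindex (s c)) /=; last first.
  exists (s (- c)) => x _; first exact: sK.
  by have := sK (- c) x; rewrite opprK.
apply: eq_bigr => x _; apply: periodic_eq_mod => //.
rewrite (gez0_abs (modz_ge0 _ qz)).
by rewrite {1}(divz_eq (x%:Z + c) q%:Z) addrK dvdz_mull.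
Qed.

Definition dft phi (t : int) : R[i] :=
  q%:R^-1 * \sum_(x < q) phi x%:Z * expi (- (t%:~R * (x%:R / q%:R))).

Lemma dft_periodic phi t : dft phi (t + q%:Z) = dft phi t.
Proof.
congr (_ * _); apply: eq_bigr => x _; congr (_ * _).
rewrite intrD mulrDl opprD expiD [X in _ * X](_ : _ = 1) ?mulr1 //.
rewrite mulrCA divff ?qR_neq0 // mulr1 -(expi_int R (- x%:Z)).
by rewrite mulrNz.
Qed.

Lemma dftK phi m : (forall k, phi (k + q%:Z) = phi k) ->
  \sum_(t < q) dft phi t%:Z * expi (t%:R / q%:R * m%:~R) = phi m.
Proof.
move=> phiP.
have -> : \sum_(t < q) dft phi t%:Z * expi (t%:R / q%:R * m%:~R) =
  q%:R^-1 * \sum_(x < q) (phi x%:Z * \sum_(t < q) expi (t%:R * ((m - x%:Z)%:~R / q%:R))).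
  under [in RHS]eq_bigr do rewrite mulr_sumr.
  rewrite exchange_big mulr_sumr; apply: eq_bigr => t _ /=.
  rewrite /dft -[LHS]mulrA mulr_suml; congr (_ * _); apply: eq_bigr => x _.
  rewrite -mulrA -expiD; congr (_ * expi _).
  by rewrite intrB; field; exact: qR_neq0.
under eq_bigr do rewrite sum_expi_mod.
have qz : q%:Z != 0 by rewrite eqz_nat -lt0n.
have lt_mod : (`|(m %% q%:Z)%Z| < q)%N.
  by rewrite -ltz_nat gez0_abs ?modz_ge0 // ltz_mod.
have xmE : (Ordinal lt_mod)%:Z = (m %% q%:Z)%Z by rewrite /= gez0_abs ?modz_ge0.
have dm : (q%:Z %| m - (m %% q%:Z)%Z)%Z by rewrite {1}(divz_eq m q%:Z) addrK dvdz_mull.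
rewrite (bigD1 (Ordinal lt_mod)) //= big1 ?addr0.
  rewrite xmE dm mulrC mulfK ?qC_neq0 //.
  by apply/esym/periodic_eq_mod.
move=> x xm; rewrite ifN ?mulr0 //; apply: contra xm => dx.
apply/eqP/val_inj/eqP; rewrite -eqz_nat xmE -(modz_small (m := x%:Z) (d := q%:Z)) //.
  by rewrite eq_sym eqz_mod_dvd.
by rewrite ltz_nat ltn_ord.
Qed.

Lemma dft_parseval phi : (forall k, `|phi k| = 1) ->
  \sum_(t < q) `|dft phi t%:Z| ^+ 2 = 1.
Proof.
move=> phi1.
have conj_expi (x : R) : conjc (expi x) = expi (- x).
  by rewrite /expi mulrN cosN sinN.
have conjM (a b : R[i]) : conjc (a * b) = conjc a * conjc b by rewrite rmorphM.
have conjS (F : 'I_q -> R[i]) : conjc (\sum_i F i) = \sum_i conjc (F i) by rewrite rmorph_sum.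
have -> : \sum_(t < q) `|dft phi t%:Z| ^+ 2 =
   q%:R^-1 * q%:R^-1 * \sum_(x < q) \sum_(y < q) (phi x%:Z * conjc (phi y%:Z) *
     \sum_(t < q) expi (t%:R * ((y%:Z - x%:Z)%:~R / q%:R))).
  transitivity (q%:R^-1 * q%:R^-1 * \sum_(t < q) \sum_(x < q) \sum_(y < q)
      (phi x%:Z * conjc (phi y%:Z) * expi (t%:R * ((y%:Z - x%:Z)%:~R / q%:R)))).
    rewrite mulr_sumr; apply: eq_bigr => t _; rewrite sqr_normc /dft conjM conjS.
    rewrite (_ : conjc _ = q%:R^-1); last by rewrite fmorphV /= conjc_nat.
    rewrite mulrACA; congr (_ * _); rewrite mulr_suml; apply: eq_bigr => x _.
    rewrite mulr_sumr; apply: eq_bigr => y _.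
    rewrite conjM conj_expi opprK mulrACA -expiD; congr (_ * expi _).
    by rewrite intrB; field; exact: qR_neq0.
  congr (_ * _); rewrite exchange_big; apply: eq_bigr => x _.
  by rewrite exchange_big; apply: eq_bigr => y _; rewrite mulr_sumr.
have -> : \sum_(x < q) \sum_(y < q) (phi x%:Z * conjc (phi y%:Z) *
     \sum_(t < q) expi (t%:R * ((y%:Z - x%:Z)%:~R / q%:R))) = q%:R * q%:R.
  have E (x : 'I_q) : \sum_(y < q) (phi x%:Z * conjc (phi y%:Z) *
     \sum_(t < q) expi (t%:R * ((y%:Z - x%:Z)%:~R / q%:R))) = q%:R :> R[i].
    rewrite (bigD1 x) //= sum_expi_mod subrr dvdz0 -sqr_normc phi1 expr1n mul1r.
    rewrite big1 ?addr0 // => y yx; rewrite sum_expi_mod ifN ?mulr0 //.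
    apply: contra yx => dx; apply/eqP/val_inj/eqP; rewrite -eqz_nat.
    rewrite -(modz_small (m := x%:Z) (d := q%:Z)) ?ltz_nat ?ltn_ord //.
    by rewrite -(modz_small (m := y%:Z) (d := q%:Z)) ?ltz_nat ?ltn_ord // eqz_mod_dvd.
  by rewrite (eq_bigr _ (fun x _ => E x)) sumr_const card_ord mulr_natl.
by field; exact: qC_neq0.
Qed.

Lemma sum_ord_blocks (g : nat -> R[i]) n :
  \sum_(k < n) \sum_(t < q) g (k * q + t)%N = \sum_(i < n * q) g i.
Proof.
elim: n => [|n IH]; first by rewrite mul0n !big_ord0.
by rewrite big_ord_recr IH mulSn addnC big_split_ord.
Qed.

(** The numbers t - qk with 0 <= t < q and |k| <= K fill the interval from -qK to qK + q - 1, which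
    exceeds the symmetric range by q - 1 terms; [ccvg_decay0] makes these vanish in the limit. *)
Lemma zpart_residues F K :
  \sum_(t < q) \sum_(k < K.*2.+1) F (t%:Z - q%:Z * (k%:Z - K%:Z)) =
  zpart F (q * K) + \sum_(j < q.-1) F ((q * K)%:Z + j.+1%:Z).
Proof.
pose g (i : nat) := F (i%:Z - (q * K)%:Z).
transitivity (\sum_(i < K.*2.+1 * q) g i).
  rewrite -sum_ord_blocks exchange_big /= (reindex_inj rev_ord_inj) /=.
  apply: eq_bigr => k _; apply: eq_bigr => t _; congr F.
  have := ltn_ord k; rewrite subSS => kK.
  rewrite -subzn; last by lia.
  have d2 : Posz K.*2 = 2 * K%:Z by rewrite -mul2n.
  by rewrite PoszD !PoszM d2; ring.
have -> : (K.*2.+1 * q = (q * K).*2.+1 + q.-1)%N.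
  rewrite mulSn -doubleMl mulnC addnC addSnnS prednK //.
rewrite big_split_ord; congr (_ + _); apply: eq_bigr => j _ /=.
by rewrite /g; congr F; rewrite -addnn; lia.
Qed.

End FiniteFourier.

Section TwistedPoisson.
Variable R : realType.
Local Open Scope classical_set_scope.
Implicit Types (F : int -> R[i]).

Lemma Re_norm_ge0 (z : R[i]) : 0 <= complex.Re `|z|.
Proof. by rewrite normc_def sqrtr_ge0. Qed.

Lemma Re_norm_mul (z w : R[i]) :
  complex.Re `|z * w| = complex.Re `|z| * complex.Re `|w|.
Proof. by rewrite normrM !(normc_def _) /= !mulr0 subr0. Qed.

Lemma normr_Re_le (z : R[i]) : `|complex.Re z| <= complex.Re `|z|.
Proof.
by rewrite normc_def /= -sqrtr_sqr ler_wsqrtr // lerDl sqr_ge0.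
Qed.

Lemma normr_Im_le (z : R[i]) : `|complex.Im z| <= complex.Re `|z|.
Proof.
by rewrite normc_def /= -sqrtr_sqr ler_wsqrtr // lerDr sqr_ge0.
Qed.

Section Decay.
Variables (F : int -> R[i]) (C L : R).
Hypotheses (L0 : 0 < L)
  (FC : forall m, complex.Re `|F m| <= C * (1 + (m%:~R * L) ^+ 2)^-1).

Lemma zsummable_decay : zsummable F.
Proof.
rewrite /zsummable /summable.
rewrite (eq_esum (b := fun m => (complex.Re `|F m|)%:E)); last first.
  by move=> m _; rewrite abse_EFin ger0_norm // Re_norm_ge0.
by apply: (esum_int_lty L0) => m; rewrite Re_norm_ge0; exact: FC.
Qed.

Lemma ccvg_zpart_decay : exists l, ccvg (zpart F) l.
Proof.
have c1 : cvgn (fun n => \sum_(k < n.*2.+1) complex.Re (F (k%:Z - n%:Z))).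
  apply: (@zpart_cvg_decay _ (fun m => complex.Re (F m)) C L) => // m.
  exact: le_trans (normr_Re_le _) (FC m).
have c2 : cvgn (fun n => \sum_(k < n.*2.+1) complex.Im (F (k%:Z - n%:Z))).
  apply: (@zpart_cvg_decay _ (fun m => complex.Im (F m)) C L) => // m.
  exact: le_trans (normr_Im_le _) (FC m).
exists (Complex (limn (fun n => \sum_(k < n.*2.+1) complex.Re (F (k%:Z - n%:Z))))
  (limn (fun n => \sum_(k < n.*2.+1) complex.Im (F (k%:Z - n%:Z))))).
split => /=.
  by under eq_fun do rewrite Re_sum.
by under eq_fun do rewrite Im_sum.
Qed.

Lemma ccvg_decay0 (q j : nat) : (0 < q)%N ->
  ccvg (fun K => F ((q * K)%:Z + j%:Z)) 0.
Proof.
move=> q0.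
have C0 : 0 <= C.
  have := le_trans (Re_norm_ge0 _) (FC 0).
  by rewrite mul0r expr0n addr0 invr1 mulr1.
have s0 := cvg_series_cvg_0 (is_cvg_series_sqdecay C0 L0).
have bnd (K : nat) : complex.Re `|F ((q * K)%:Z + j%:Z)| <= C * (1 + (K%:R * L) ^+ 2)^-1.
  rewrite (le_trans (FC _)) // ler_wpM2l // lef_pV2 ?posrE ?ltr_pwDl ?sqr_ge0 // lerD2l.
  rewrite -PoszD ler_pXn2r ?nnegrE ?mulr_ge0 ?(ltW L0) //.
  by rewrite ler_pM2r // -[X in _ <= X]/((q * K + j)%:R) ler_nat; nia.
split.
  by apply: normr_squeeze0 s0 => K; exact: le_trans (normr_Re_le _) (bnd K).
by apply: normr_squeeze0 s0 => K; exact: le_trans (normr_Im_le _) (bnd K).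
Qed.

End Decay.

(** [phi] is expanded in its finite Fourier series, and each of the q resulting linear twists is
    handled by [schwartz_poisson] at spacing 1/B; the frequencies of the q dual sums together run
    once through Z. The decay bound is exported so that summability survives rescaling. *)
Lemma twisted_poisson (q : nat) (phi : int -> R[i]) (h : R -> R[i]) (B al : R) :
  (0 < q)%N -> (forall m, phi (m + q%:Z) = phi m) -> (forall m, `|phi m| = 1) ->
  0 < B -> schwartz h ->
  let lhs m := phi m * expi (al * m%:~R) * h (m%:~R / B) in
  let rhs (t : int) := dft q phi t * fourier h (- (t%:~R / (q%:R / B)) - al * B) in
  [/\ zsummable lhs, zsum lhs = real_complex R B * zsum rhs &
    exists C L : R, 0 < L /\
      forall t, complex.Re `|rhs t| <= C * (1 + (t%:~R * L) ^+ 2)^-1].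
Proof.
move=> q0 phiP phi1 B0 Sh lhs rhs.
have BV : 0 < B^-1 by rewrite invr_gt0.
have qR : 0 < q%:R :> R by rewrite ltr0n.
have qBV : 0 < (q%:R / B)^-1 by rewrite invr_gt0 divr_gt0.
have [h1' [h2' [C [C0 _ _ [d1 d2 _ _]]]]] := schwartz_tame Sh.
have lhsC m : complex.Re `|lhs m| <= (C + C) * (1 + (m%:~R * B^-1) ^+ 2)^-1.
  rewrite /lhs !Re_norm_mul phi1 norm_expi /= !mul1r.
  by rewrite (le_trans (Re_norm_le _)) // mulrDl lerD.
have dft1 t : complex.Re `|dft q phi t| <= 1.
  suff : `|dft q phi t| <= 1 by rewrite lecE => /andP[].
  rewrite normrM normfV normr_nat ler_pdivrMl ?ltr0n // mulr1.
  apply: (le_trans (ler_norm_sum _ _ _)).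
  by under eq_bigr do rewrite normrM phi1 norm_expi mul1r; rewrite sumr_const card_ord.
have [K K0 fK] := fourier_decay Sh.
have gK := sqdecay_shift (- (al * B)) K0 fK.
pose K' := K * (2 * (1 + (- (al * B)) ^+ 2)).
have rhsC t : complex.Re `|rhs t| <= K' * (1 + (t%:~R * (q%:R / B)^-1) ^+ 2)^-1.
  rewrite /rhs Re_norm_mul.
  apply: (@le_trans _ _ (1 * (K' * (1 + (t%:~R * (q%:R / B)^-1) ^+ 2)^-1))); last by rewrite mul1r.
  apply: ler_pM; rewrite ?Re_norm_ge0 //.
  have := gK (- (t%:~R * (q%:R / B)^-1)); rewrite ger0_norm ?Re_norm_ge0 // -/K'.
  by rewrite sqrrN.
have sl := zsummable_decay BV lhsC.
have [l' cl'] := ccvg_zpart_decay qBV rhsC.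
split => //; last by exists K', (q%:R / B)^-1.
pose th (t : nat) : R := t%:R / q%:R + al.
have /choice[l lP] t := schwartz_poisson (th t) BV Sh.
have lhsE : zpart lhs = (fun n => \sum_(t < q) dft q phi t%:Z *
    zpart (fun m => h (m%:~R * B^-1) * expi (th t * m%:~R)) n).
  apply/funext => n; rewrite /zpart.
  under [RHS]eq_bigr do rewrite mulr_sumr.
  rewrite exchange_big; apply: eq_bigr => k _ /=.
  rewrite /lhs -(dftK q0 (k%:Z - n%:Z) phiP) !mulr_suml; apply: eq_bigr => t _.
  by rewrite /th [(_ + al) * _]mulrDl expiD; ring.
have cl : ccvg (zpart lhs) (\sum_(t < q) dft q phi t%:Z * l t).
  rewrite lhsE; apply: (@ccvg_sum _ q (fun t n => dft q phi t%:Z * zpart (fun m => h (m%:~R * B^-1) * expi (th t * m%:~R)) n)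
    (fun t => dft q phi t%:Z * l t)) => t _.
  by apply: ccvgM_l; case: (lP t).
have dftq t k : dft q phi (t - q%:Z * k) = dft q phi t.
  apply: (periodic_eq_mod (q := q)) => [m|]; first exact: dft_periodic.
  by rewrite addrAC subrr add0r -mulrN dvdz_mulr.
(* The frequency k of the t-th twist corresponds to the integer t - qk, where the periodic [dft]
   takes the same value as at t. *)
have rhsE K1 : \sum_(t < q) dft q phi t%:Z * zpart (fun k => fourier h ((k%:~R - th t) / B^-1)) K1 =
   zpart rhs (q * K1) + \sum_(j < q.-1) rhs ((q * K1)%:Z + j.+1%:Z).
  rewrite -(zpart_residues q0); apply: eq_bigr => t _; rewrite mulr_sumr.
  apply: eq_bigr => k _; rewrite /rhs dftq; congr (_ * fourier h _).
  by move: (k%:Z - K1%:Z) => d; rewrite /th intrB intrM; field; rewrite !gt_eqF.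
have c1 : ccvg (fun K1 => \sum_(t < q) dft q phi t%:Z * zpart (fun k => fourier h ((k%:~R - th t) / B^-1)) K1)
    (\sum_(t < q) dft q phi t%:Z * (real_complex R B^-1 * l t)).
  apply: (@ccvg_sum _ q (fun t n => dft q phi t%:Z * zpart (fun k => fourier h ((k%:~R - th t) / B^-1)) n)
    (fun t => dft q phi t%:Z * (real_complex R B^-1 * l t))) => t _.
  by apply: ccvgM_l; case: (lP t).
have c2 : ccvg (fun K1 => \sum_(t < q) dft q phi t%:Z * zpart (fun k => fourier h ((k%:~R - th t) / B^-1)) K1) l'.
  under [X in ccvg X _]eq_fun do rewrite rhsE.
  rewrite -[l']addr0; apply: ccvgD.
    apply: (ccvg_subseq (s := fun K1 => (q * K1)%N)) => //.
    apply/cvgnyPge => A; near=> n; apply: (@leq_trans n); last exact: leq_pmull.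
    near: n; exact: nbhs_infty_ge.
  have H : ccvg (fun K1 => \sum_(j < q.-1) rhs ((q * K1)%:Z + j.+1%:Z))
      (\sum_(j < q.-1) 0).
    apply: (@ccvg_sum _ q.-1 (fun j K1 => rhs ((q * K1)%:Z + j.+1%:Z)) (fun=> 0)) => j _.
    exact: (ccvg_decay0 qBV rhsC _ q0).
  by move: H; rewrite [X in ccvg _ X -> _]big1.
have l'E := ccvg_unique c2 c1.
rewrite (zsumE cl) (zsumE cl') l'E mulr_sumr; apply: eq_bigr => t _.
rewrite mulrCA; congr (_ * _); rewrite mulrA -rmorphM /= divff ?gt_eqF //.
by rewrite mul1r.
Unshelve. all: by end_near. Qed.

Lemma twisted_poisson_scaled (q : nat) (phi G : int -> R[i]) (K : R[i])
    (h : R -> R[i]) (B al : R) :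
  (0 < q)%N -> (forall m, phi (m + q%:Z) = phi m) -> (forall m, `|phi m| = 1) ->
  K != 0 -> (forall t, dft q phi t = K * G t) -> 0 < B -> schwartz h ->
  let lhs m := phi m * expi (al * m%:~R) * h (m%:~R / B) in
  let rhs (t : int) := G t * fourier h (- (t%:~R / (q%:R / B)) - al * B) in
  [/\ zsummable lhs, zsummable rhs & zsum lhs = K * real_complex R B * zsum rhs].
Proof.
move=> q0 phiP phi1 K0 GK B0 Sh lhs rhs.
have [sl sE [C [L [L0 rC]]]] := twisted_poisson al q0 phiP phi1 B0 Sh.
have rhsE t : rhs t = K^-1 * (dft q phi t * fourier h (- (t%:~R / (q%:R / B)) - al * B)).
  by rewrite /rhs GK -mulrA mulKf.
have rhsC t : complex.Re `|rhs t| <= complex.Re `|K^-1| * C * (1 + (t%:~R * L) ^+ 2)^-1.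
  by rewrite rhsE Re_norm_mul -mulrA ler_wpM2l // Re_norm_ge0.
have [l cl] := ccvg_zpart_decay L0 rhsC.
split => //; first exact: zsummable_decay L0 rhsC.
rewrite /lhs sE -mulrA mulrCA; congr (_ * _); rewrite (zsumE cl); apply: zsumE.
suff -> : zpart (fun t => dft q phi t * fourier h (- (t%:~R / (q%:R / B)) - al * B)) =
  (fun n => K * zpart rhs n) by exact: ccvgM_l.
apply/funext => n; rewrite /zpart mulr_sumr; apply: eq_bigr => k _.
by rewrite rhsE mulVKf.
Qed.

End TwistedPoisson.

(** * Divisibility in the p-adic numbers *)

Section PadicIntegers.
Variables (p : nat) (hp : prime p).
Local Notation Zp := (pint hp).
Local Notation P n := (p%:Z ^+ n).
Implicit Types (x y z : Zp).

Lemma pint_exp_neq0 n : P n != 0. Proof. by rewrite expf_neq0 // eqz_nat -lt0n prime_gt0. Qed.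

Lemma pint_res0 x : x 0%N = 0.
Proof. by rewrite pint_resE expr0 modz1. Qed.

Lemma pint_intr (a : int) : a%:~R = pint_const hp a.
Proof.
have N (m : nat) : m%:R = pint_const hp m%:Z.
  elim: m => [|m IH]; first by [].
  rewrite -natr1 IH; apply: pint_ext => n /=.
  by rewrite /pint_mk_res /= /pint_mk_res modzDm addrC -intS.
case: a => m; first exact: N.
rewrite NegzE mulrNz -[m.+1%:~R]/(m.+1%:R) N; apply: pint_ext => n /=.
by rewrite /pint_mk_res /= /pint_mk_res modzNm.
Qed.

Lemma pint_res_intr (a : int) n : (a%:~R : Zp) n = (a %% P n)%Z.
Proof. by rewrite pint_intr. Qed.

Lemma pint_res_natpX k n : (p%:R ^+ k : Zp) n = (P k %% P n)%Z.
Proof. by rewrite -pint_res_intr rmorphXn. Qed.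

Lemma pint_resD x y n : (x + y) n = ((x n + y n) %% P n)%Z.
Proof. by []. Qed.

Lemma pint_resB x y n : (x - y) n = ((x n - y n) %% P n)%Z.
Proof. by rewrite /= /pint_mk_res /= /pint_mk_res modzDmr. Qed.

(** The quotient modulo p^n is read off from [x] modulo p^(n+k). *)
Lemma pint_divp x k : x k = 0 -> exists z, x = p%:R ^+ k * z.
Proof.
move=> xk.
have dv n : (P k %| x (n + k)%N)%Z by apply/dvdz_mod0P; rewrite -pint_res_le ?leq_addl.
have co n : ((x (n.+1 + k)%N %/ P k)%Z %% P n)%Z = ((x (n + k)%N %/ P k)%Z %% P n)%Z.
  apply/eqP; rewrite eqz_mod_dvd -(dvdz_mul2r (pint_exp_neq0 k)) mulrBl !divzK //.
  rewrite -exprD -eqz_mod_dvd; apply/eqP.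
  by rewrite addSn -pint_resE pint_res_mod.
exists (pint_mk hp co : Zp); apply: pint_ext => n.
rewrite pintME pint_res_natpX modzMml /= /pint_mk_res /= -modzMmr modz_mod modzMmr.
by rewrite mulrC divzK // -pint_res_le // leq_addr.
Qed.

(** Bezout gives an inverse modulo each p^n; these inverses are coherent because an inverse modulo
    p^n is unique. *)
Lemma pint_unitE x : (x \is a GRing.unit) = (x 1%N != 0).
Proof.
apply/idP/idP => [/unitrP[y [yx _]]|x1].
  apply/eqP => x1; have := congr1 (fun z : Zp => z 1%N) yx.
  rewrite pintME x1 mulr0 mod0z (_ : (1 : Zp) = 1%:~R) // pint_res_intr expr1.
  by rewrite modz_small // ltz_nat prime_gt1.
have cop n : coprimez (x n) (P n).
  case: n => [|n]; first by rewrite expr0 coprimezE coprimen1.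
  rewrite coprimez_pexpr // coprimez_sym coprimezE prime_coprime //.
  apply: contra x1 => pd; rewrite (@pint_res_le _ _ x 1 n.+1) // expr1.
  exact/eqP/dvdz_mod0P.
have bz n : exists a, ((a * x n) %% P n = 1 %% P n)%Z.
  have [[u v] /= uv] := coprimezP _ _ (cop n).
  by exists u; rewrite -uv -[in RHS]modzDmr modzMl addr0.
have [a aP] := choice bz.
have co n : (a n.+1 %% P n)%Z = (a n %% P n)%Z.
  have h1 : ((a n.+1 * x n) %% P n)%Z = (1 %% P n)%Z.
    rewrite (pint_resE x n) modzMmr -(modz_expS p (a n.+1 * x n.+1) n) aP.
    by rewrite modz_expS.
  rewrite -[a n.+1]mulr1 -modzMmr -(aP n) modzMmr mulrCA -modzMmr h1 modzMmr.
  by rewrite mulr1.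
apply/unitrP; exists (pint_mk hp co : Zp); rewrite mulrC.
suff E : x * (pint_mk hp co : Zp) = 1 by split => //; rewrite mulrC.
apply: pint_ext => n; rewrite pintME /= /pint_mk_res /= modzMmr mulrC aP.
by rewrite /pint_mk_res.
Qed.

Lemma pint_unit_addp x z : x \is a GRing.unit -> x + p%:R * z \is a GRing.unit.
Proof.
rewrite !pint_unitE pint_resD pintME -[p%:R]expr1 pint_res_natpX modzz mul0r mod0z addr0.
by rewrite pint_res_mod.
Qed.

Lemma pint_natp_neq0 : p%:R != 0 :> Zp.
Proof.
apply/eqP => /(congr1 (fun z : Zp => z 2%N)).
rewrite (_ : p%:R = (p%:Z)%:~R) // pint_res_intr pint0E modz_small.
  by apply/eqP; rewrite eqz_nat -lt0n prime_gt0.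
rewrite expr2 -PoszM ltz_nat -[X in (X < _)%N]muln1 ltn_pmul2l ?prime_gt0 //.
exact: prime_gt1.
Qed.

Lemma pint_decomp x : x != 0 -> exists k u, [/\ u \is a GRing.unit,
  x = p%:R ^+ k * u & pint_ord x = k%:Z%:E].
Proof.
move=> x0; rewrite /pint_ord; case: pselect => [ex|]; last by case; exact: pint_neq0.
case: ex_minnP => m xm min.
have : x m = 0.
  case: m {xm} min => [|m] min; first exact: pint_res0.
  by apply/eqP; apply/negPn/negP => /min; rewrite ltnn.
move=> /pint_divp[u uE]; exists m, u; split => //.
rewrite pint_unitE; apply: contra xm => /eqP u1.
have [v vE] := pint_divp u1.
rewrite uE vE expr1 mulrA -exprSr pintME.
by rewrite pint_res_natpX modzz mul0r mod0z.
Qed.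

Lemma pint_unitP_neq0 x : x \is a GRing.unit -> x != 0.
Proof. by rewrite pint_unitE; apply: contraNneq => ->; rewrite pint0E. Qed.

End PadicIntegers.

Section PadicDivisibility.
Variables (p : nat) (hp : prime p).
Local Notation Zp := (pint hp).
Local Notation Qp := (padic hp).
Local Notation tofrac := (@FracField.tofrac Zp).
Implicit Types (x y : Qp) (z : Zp) (v w : int).

Lemma padic_intr (a : int) : (a%:~R : Qp) = tofrac a%:~R.
Proof. by rewrite rmorph_int. Qed.

Lemma padic_natp_neq0 : p%:R != 0 :> Qp.
Proof.
by rewrite -(rmorph_nat tofrac) tofrac_eq0 pint_natp_neq0.
Qed.

Lemma padic_expz_neq0 v : p%:R ^ v != 0 :> Qp.
Proof. by rewrite expfz_neq0 ?padic_natp_neq0. Qed.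

(** Stands for ord x >= v. Unlike the extended valuation it treats 0 like any other element and is
    stable under sums and products without case distinction. *)
Definition pdvd v x := exists z : Zp, x = p%:R ^ v * tofrac z.

Lemma pdvd0 v : pdvd v 0.
Proof. by exists 0; rewrite rmorph0 mulr0. Qed.

Lemma pdvdD v x y : pdvd v x -> pdvd v y -> pdvd v (x + y).
Proof. by move=> [a ->] [b ->]; exists (a + b); rewrite rmorphD mulrDr. Qed.

Lemma pdvdN v x : pdvd v x -> pdvd v (- x).
Proof. by move=> [a ->]; exists (- a); rewrite rmorphN mulrN. Qed.

Lemma pdvdB v x y : pdvd v x -> pdvd v y -> pdvd v (x - y).
Proof. by move=> vx vy; apply: pdvdD vx _; exact: pdvdN. Qed.

Lemma pdvdBC v x y : pdvd v (x - y) -> pdvd v (y - x).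
Proof. by move=> /pdvdN; rewrite opprB. Qed.

Lemma pdvdM v w x y : pdvd v x -> pdvd w y -> pdvd (v + w) (x * y).
Proof.
move=> [a ->] [b ->]; exists (a * b); rewrite rmorphM expfzDr ?padic_natp_neq0 //.
by rewrite mulrACA.
Qed.

Lemma pdvd_le v w x : w <= v -> pdvd v x -> pdvd w x.
Proof.
move=> wv [a ->]; exists (p%:R ^+ `|v - w|%N * a).
rewrite rmorphM rmorphXn rmorph_nat mulrA; congr (_ * _).
rewrite -[p%:R ^+ _]/(p%:R ^ (`|v - w|%N%:Z)) -expfzDr ?padic_natp_neq0 //.
by congr (_ ^ _); lia.
Qed.

Lemma pdvd_tofrac z : pdvd 0 (tofrac z).
Proof. by exists z; rewrite expr0z mul1r. Qed.

Lemma pdvd_int (a : int) : pdvd 0 a%:~R.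
Proof. by rewrite padic_intr; exact: pdvd_tofrac. Qed.

Lemma pdvd_nat (n : nat) : pdvd 0 n%:R.
Proof. exact: (pdvd_int n). Qed.

Lemma pdvd1 : pdvd 0 1. Proof. exact: (pdvd_nat 1). Qed.

Lemma pdvd_expz v : pdvd v (p%:R ^ v).
Proof. by exists 1; rewrite rmorph1 mulr1. Qed.

Lemma pdvdMl v x y : pdvd 0 x -> pdvd v y -> pdvd v (x * y).
Proof. by move=> h1 h2; rewrite -[v]add0r; exact: pdvdM. Qed.

Lemma pdvdMr v x y : pdvd v x -> pdvd 0 y -> pdvd v (x * y).
Proof. by move=> h1 h2; rewrite mulrC; exact: pdvdMl. Qed.

Lemma pdvdX v x n : pdvd v x -> pdvd (v *+ n) (x ^+ n).
Proof.
move=> vx; elim: n => [|n IH]; first by rewrite expr0 mulr0n; exact: pdvd1.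
by rewrite exprS mulrS; exact: pdvdM.
Qed.

Lemma pdvd_sum (I : Type) (r : seq I) (Q : pred I) (F : I -> Qp) v :
  (forall i, Q i -> pdvd v (F i)) -> pdvd v (\sum_(i <- r | Q i) F i).
Proof. by move=> h; apply: big_rec => [|i x Qi vx]; [exact: pdvd0 | apply: pdvdD; [exact: h |]]. Qed.

Lemma pdvd_mul_expz v w x : pdvd (v + w) (p%:R ^ w * x) <-> pdvd v x.
Proof.
split=> [[a aE]|vx]; last by rewrite addrC; exact: pdvdM (pdvd_expz w) vx.
exists a; apply: (mulfI (padic_expz_neq0 w)).
by rewrite aE expfzDr ?padic_natp_neq0 //; rewrite mulrA [p%:R ^ w * _]mulrC.
Qed.

Lemma padic_fracE x : x = tofrac (repr x).1 / tofrac (repr x).2 /\ (repr x).2 != 0.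
Proof.
have d0 := denom_ratioP (repr x); split => //.
apply: (canRL (mulfK _)); first by rewrite tofrac_eq0.
rewrite -{1}[x]reprK; unlock FracField.tofrac; rewrite -[LHS]FracField.pi_mul.
apply/eqP; rewrite FracField.equivf_def /FracField.mulf.
by rewrite !numden_Ratio ?oner_neq0 ?mulr1 // mulrC.
Qed.

End PadicDivisibility.

Section RationalsInCharacteristicZero.
Variable F : fieldType.
Hypothesis char0 : forall n, (n%:R == 0 :> F) = (n == 0%N).

Lemma char0_intr_eq0 (a : int) : (a%:~R == 0 :> F) = (a == 0).
Proof.
case: a => n; first exact: char0.
by rewrite NegzE mulrNz oppr_eq0 -[n.+1%:~R]/(n.+1%:R) char0 oppr_eq0.
Qed.

(** [ratr] uses the reduced numerator and denominator, whereas a/b need not be reduced; cross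
    multiplication, legitimate in characteristic zero, bridges the two. No order on [F] is involved,
    so it applies to Q_p. *)
Lemma char0_ratrE (a b : int) : b != 0 -> ratr (a%:~R / b%:~R) = a%:~R / b%:~R :> F.
Proof.
move=> b0; rewrite /ratr; set r := a%:~R / b%:~R.
have d0 : denq r != 0 by rewrite denq_neq0.
have /eqP : (numq r)%:~R / (denq r)%:~R = a%:~R / b%:~R :> rat := divq_num_den r.
rewrite eqr_div ?intr_eq0 // => /eqP.
rewrite -!intrM => /eqP; rewrite eqr_int => /eqP E.
apply/eqP; rewrite eqr_div ?char0_intr_eq0 //.
by rewrite -!intrM E.
Qed.

Lemma char0_ratrD r s : ratr (r + s) = ratr r + ratr s :> F.
Proof.
rewrite -(divq_num_den r) -(divq_num_den s); move: (denq_neq0 r) (denq_neq0 s).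
move: (numq r) (denq r) (numq s) (denq s) => a b c d b0 d0.
have -> : a%:~R / b%:~R + c%:~R / d%:~R = (a * d + c * b)%:~R / (b * d)%:~R :> rat.
  by rewrite intrD !intrM; field; rewrite !intr_eq0 b0 d0.
rewrite !char0_ratrE ?mulf_neq0 // intrD !intrM; field.
by rewrite !char0_intr_eq0 b0 d0.
Qed.

Lemma char0_ratrM r s : ratr (r * s) = ratr r * ratr s :> F.
Proof.
rewrite -(divq_num_den r) -(divq_num_den s); move: (denq_neq0 r) (denq_neq0 s).
move: (numq r) (denq r) (numq s) (denq s) => a b c d b0 d0.
have -> : a%:~R / b%:~R * (c%:~R / d%:~R) = (a * c)%:~R / (b * d)%:~R :> rat.
  by rewrite !intrM; field; rewrite !intr_eq0 b0 d0.
rewrite !char0_ratrE ?mulf_neq0 // !intrM; field.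
by rewrite !char0_intr_eq0 b0 d0.
Qed.

Lemma char0_ratrN r : ratr (- r) = - ratr r :> F.
Proof. by rewrite -mulN1r char0_ratrM (ratr_int _ (-1)) mulN1r. Qed.

Lemma char0_ratrV r : ratr r^-1 = (ratr r)^-1 :> F.
Proof.
have [->|r0] := eqVneq r 0; first by rewrite invr0 (ratr_int _ 0) invr0.
have h : ratr r * ratr r^-1 = 1 :> F by rewrite -char0_ratrM divff // (ratr_int _ 1).
have r0' : ratr r != 0 :> F.
  by apply/eqP => E; move: h; rewrite E mul0r => /esym/eqP; rewrite oner_eq0.
by apply: (mulfI r0'); rewrite h divff.
Qed.

Lemma char0_ratrXz (n : nat) (v : int) : ratr (n%:R ^ v) = n%:R ^ v :> F.
Proof.
have N k : ratr (n%:R ^+ k) = n%:R ^+ k :> F by rewrite -natrX ratr_nat natrX.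
by case: v => k; [exact: N | rewrite NegzE -!exprnN char0_ratrV N].
Qed.

End RationalsInCharacteristicZero.

Section PadicOrder.
Variables (p : nat) (hp : prime p).
Local Notation Zp := (pint hp).
Local Notation Qp := (padic hp).
Local Notation tofrac := (@FracField.tofrac Zp).
Implicit Types (x y : Qp) (z : Zp) (v w : int).

Lemma tofrac_inj : injective tofrac.
Proof. by move=> a b /eqP; rewrite tofrac_eq => /eqP. Qed.

Lemma tofrac_unitV z : z \is a GRing.unit -> tofrac z^-1 = (tofrac z)^-1.
Proof. exact: rmorphV. Qed.

Lemma pdvd_expz_unit v w z : z \is a GRing.unit ->
  pdvd v (p%:R ^ w * tofrac z) -> v <= w.
Proof.
move=> uz; rewrite leNgt => -[a aE]; apply/negP => wv.
have /tofrac_inj zE : tofrac z = tofrac (p%:R ^+ `|v - w|%N * a).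
  apply: (mulfI (padic_expz_neq0 hp w)); rewrite aE rmorphM rmorphXn rmorph_nat mulrA.
  congr (_ * _); rewrite -[p%:R ^+ _]/(p%:R ^ (`|v - w|%N%:Z)).
  by rewrite -expfzDr ?padic_natp_neq0 //; congr (_ ^ _); lia.
move: uz; rewrite pint_unitE zE pintME pint_res_natpX.
have -> : (p%:Z ^+ `|v - w|%N %% p%:Z ^+ 1)%Z = 0.
  have -> : `|v - w|%N = (`|v - w|%N.-1 + 1)%N by lia.
  by rewrite exprD modzMl.
by rewrite mul0r mod0z eqxx.
Qed.

Lemma padic_decomp x : x != 0 -> exists v u, [/\ u \is a GRing.unit,
  x = p%:R ^ v * tofrac u & padic_ord x = v%:E].
Proof.
have [xE d0] := padic_fracE x; rewrite {1}xE => x0.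
have n0 : (repr x).1 != 0 by apply: contraNneq x0 => ->; rewrite rmorph0 mul0r.
have [k [a [ua aE ak]]] := pint_decomp n0; have [l [b [ub bE bl]]] := pint_decomp d0.
exists (k%:Z - l%:Z), (a * b^-1); split.
- by rewrite unitrMl ?unitrV.
- rewrite {1}xE aE bE !rmorphM /= !rmorphXn /= !rmorph_nat tofrac_unitV //.
  rewrite expfzDr ?padic_natp_neq0 // invfM mulrACA; congr (_ * _ * _).
  exact: exprnN.
- by rewrite /padic_ord ak bl.
Qed.

Lemma pint_ord0 : pint_ord (0 : Zp) = +oo%E.
Proof.
rewrite /pint_ord; case: pselect => // h; exfalso.
by case: h => n; rewrite pint0E eqxx.
Qed.

Lemma padic_abs0 : padic_abs (0 : Qp) = 0.
Proof.
rewrite /padic_abs /padic_ord; have [xE d0] := padic_fracE (0 : Qp).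
have n0 : (repr (0 : Qp)).1 = 0.
  apply/eqP; rewrite -tofrac_eq0; apply/eqP; apply: (mulIf (x := (tofrac (repr (0 : Qp)).2)^-1)).
    by rewrite invr_eq0 tofrac_eq0.
  by rewrite -xE mul0r.
by have [l [b [_ _ bl]]] := pint_decomp d0; rewrite n0 pint_ord0 bl.
Qed.

Let p0 : 0 < p%:R :> rat. Proof. by rewrite ltr0n prime_gt0. Qed.
Let p1 : 1 < p%:R :> rat. Proof. by rewrite ltr1n prime_gt1. Qed.

Lemma padic_abs_le v x : padic_abs x <= p%:R ^ (- v) <-> pdvd v x.
Proof.
have [->|x0] := eqVneq x 0.
  by rewrite padic_abs0; split => _; [exact: pdvd0 | rewrite exprz_ge0 // ltW].
have [w [u [uu xE xo]]] := padic_decomp x0.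
rewrite /padic_abs xo ler_eXz2l // lerN2; split.
  by move=> vw; apply: pdvd_le vw _; exists u.
by rewrite xE; exact: pdvd_expz_unit.
Qed.

Lemma padic_cvgP (s : nat -> Qp) l : padic_cvg s l <->
  forall v : nat, exists n0, forall n, (n0 <= n)%N -> pdvd v%:Z (s n - l).
Proof.
split=> [h v|h e e0].
  have [n0 H] := h (p%:R ^ (- v%:Z)) (exprz_gt0 _ p0); exists n0 => n nn.
  by apply/padic_abs_le/ltW/H.
pose v := (Num.truncn e^-1).+1.
have [n0 H] := h v; exists n0 => n nn.
apply: (le_lt_trans ((padic_abs_le _ _).2 (H n nn))).
rewrite -exprnN invf_plt ?posrE ?exprn_gt0 //.
apply: (lt_trans (truncnS_gt _)).
by rewrite -natrX ltr_nat ltn_expl // prime_gt1.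
Qed.

Lemma pint_ord_ge v z : (v%:E <= pint_ord z)%E <-> pdvd v (tofrac z).
Proof.
have [->|z0] := eqVneq z 0.
  by rewrite pint_ord0 leey rmorph0; split => // _; exact: pdvd0.
have [k [u [uu zE zo]]] := pint_decomp z0.
have zE' : tofrac z = p%:R ^ k%:Z * tofrac u by rewrite zE rmorphM rmorphXn rmorph_nat.
rewrite zo lee_fin zE'; split => [vk|]; last exact: pdvd_expz_unit.
by apply: pdvd_le vk _; exists u.
Qed.

Lemma pdvd_res (k : nat) a b : pdvd k%:Z (tofrac a - tofrac b) <-> a k = b k.
Proof.
split=> [[c]|ab].
  rewrite -rmorphB -[p%:R ^ _]/(p%:R ^+ k) -(rmorph_nat tofrac) -rmorphXn -rmorphM.
  move/tofrac_inj => abE; have -> : a = b + p%:R ^+ k * c by rewrite -abE addrC subrK.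
  by rewrite pint_resD pintME pint_res_natpX modzz mul0r mod0z addr0 pint_res_mod.
have /pint_divp[c cE] : (a - b) k = 0 by rewrite pint_resB ab subrr mod0z.
by exists c; rewrite -rmorphB cE rmorphM rmorphXn rmorph_nat.
Qed.

(* Completeness: the residue of the limit modulo [p^k] is the eventual
   residue of the sequence. *)
Lemma pint_complete (z : nat -> Zp) :
  (forall v : nat, exists n0, forall n, (n0 <= n)%N ->
     pdvd v%:Z (tofrac (z n.+1) - tofrac (z n))) ->
  exists l : Zp, forall v : nat, exists n0, forall n, (n0 <= n)%N ->
     pdvd v%:Z (tofrac (z n) - tofrac l).
Proof.
move=> /choice[N NP].
have cst k n : (N k <= n)%N -> z n k = z (N k) k.
  move=> /subnK <-; elim: (n - N k)%N => [|m IH]; first by rewrite add0n.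
  by rewrite addSn -IH; apply/pdvd_res/NP; rewrite leq_addl.
have co k : (z (N k.+1) k.+1 %% p%:Z ^+ k)%Z = (z (N k) k %% p%:Z ^+ k)%Z.
  rewrite -(cst k.+1 (maxn (N k) (N k.+1))) ?leq_maxr // -pint_resE.
  by rewrite (cst k (maxn (N k) (N k.+1))) ?leq_maxl // pint_res_mod.
exists (pint_mk hp co : Zp) => k; exists (N k) => n nk; apply/pdvd_res.
by rewrite (cst k n nk) /= /pint_mk_res pint_res_mod.
Qed.

(** From an index [n0] on the increments are integral, so [s n - s n0] stays in Z_p and completeness
    of Z_p applies. *)
Lemma padic_complete (s : nat -> Qp) :
  (forall v : nat, exists n0, forall n, (n0 <= n)%N -> pdvd v%:Z (s n.+1 - s n)) ->
  exists l, padic_cvg s l.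
Proof.
move=> H; have [n0 H0] := H 0%N.
have H1 n : exists z, s (n0 + n)%N - s n0 = tofrac z.
  elim: n => [|n [z zE]]; first by exists 0; rewrite addn0 subrr rmorph0.
  have [w wE] := H0 (n0 + n)%N (leq_addr _ _).
  exists (w + z); rewrite addnS -(subrKA (s (n0 + n)%N)) zE rmorphD wE.
  by rewrite expr0z mul1r.
have [z zE] := choice H1.
have [l lP] : exists l : Zp, forall v : nat, exists n1, forall n, (n1 <= n)%N ->
     pdvd v%:Z (tofrac (z n) - tofrac l).
  apply: pint_complete => v; have [m Hm] := H v; exists m => n mn.
  rewrite -!zE addnS opprB addrA subrK.
  by apply: Hm; rewrite (leq_trans mn) // leq_addl.
exists (tofrac l + s n0); apply/padic_cvgP => v; have [m Hm] := lP v.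
exists (n0 + m)%N => n nn; have -> : n = (n0 + (n - n0))%N by lia.
have -> : s (n0 + (n - n0))%N - (tofrac l + s n0) = tofrac (z (n - n0)%N) - tofrac l.
  by rewrite -zE; ring.
by apply: Hm; lia.
Qed.

(** Whatever limit [xget] picks has the required property; completeness provides a limit and thereby
    excludes the default value. *)
Lemma pseval_partial (f : nat -> Qp) x :
  (forall v : nat, exists n0, forall k, (n0 <= k)%N -> pdvd v%:Z (f k * x ^+ k)) ->
  forall v : nat, exists n0, forall n, (n0 <= n)%N ->
    pdvd v%:Z (pseval f x - \sum_(k < n) f k * x ^+ k).
Proof.
move=> H v; rewrite /pseval; case: xgetP => [y -> /padic_cvgP/(_ v)[n0 h]|nex].
  by exists n0 => n nn; apply: pdvdBC; exact: h.
exfalso; have [l lP] : exists l, padic_cvg (fun n => \sum_(k < n) f k * x ^+ k) l.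
  apply: padic_complete => w; have [n0 h] := H w; exists n0 => n nn.
  by rewrite big_ord_recr /= addrAC subrr add0r; exact: h.
exact: nex l lP.
Qed.

Lemma padic_nat_unit n : (0 < n)%N ->
  exists2 u, u \is a GRing.unit & n%:R = p%:R ^ (logn p n)%:Z * tofrac u.
Proof.
move=> n0; have [m pm nE] := pfactor_coprime hp n0.
exists m%:R.
  rewrite pint_unitE (_ : m%:R = m%:Z%:~R) // pint_res_intr expr1.
  by apply: contraTneq pm => /dvdz_mod0P; rewrite prime_coprime // negbK.
by rewrite {1}nE natrM natrX mulrC rmorph_nat.
Qed.

Lemma tofrac_unit_neq0 z : z \is a GRing.unit -> tofrac z != 0.
Proof. by move=> uz; rewrite tofrac_eq0 pint_unitP_neq0. Qed.

Lemma padic_nat_neq0 n : (0 < n)%N -> n%:R != 0 :> Qp.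
Proof.
move=> /padic_nat_unit[u uu ->].
by rewrite mulf_neq0 ?padic_expz_neq0 ?tofrac_unit_neq0.
Qed.

Lemma padic_pchar0 n : (n%:R == 0 :> Qp) = (n == 0%N).
Proof. by case: n => [|n]; [rewrite !eqxx | apply/negbTE/padic_nat_neq0]. Qed.

Lemma padic_ratrD r s : ratr (r + s) = ratr r + ratr s :> Qp.
Proof. exact: (char0_ratrD padic_pchar0). Qed.

Lemma padic_ratrM r s : ratr (r * s) = ratr r * ratr s :> Qp.
Proof. exact: (char0_ratrM padic_pchar0). Qed.

Lemma padic_ratrN r : ratr (- r) = - ratr r :> Qp.
Proof. exact: (char0_ratrN padic_pchar0). Qed.

Lemma padic_ratrV r : ratr r^-1 = (ratr r)^-1 :> Qp.
Proof. exact: (char0_ratrV padic_pchar0). Qed.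

Lemma padic_ratrXz (v : int) : ratr (p%:R ^ v) = p%:R ^ v :> Qp.
Proof. exact: (char0_ratrXz padic_pchar0). Qed.

Lemma padic_ratr_unit (y : rat) : y != 0 ->
  exists2 u, u \is a GRing.unit & ratr y = p%:R ^ (ordq p y) * tofrac u.
Proof.
move=> y0; rewrite /ratr /ordq.
have I (a : int) : a != 0 -> exists2 u : Zp, u \is a GRing.unit &
    a%:~R = p%:R ^ (logn p `|a|)%:Z * tofrac u.
  move=> a0; have [u uu uE] := @padic_nat_unit `|a| (ltac:(by rewrite absz_gt0)).
  have [a1|a1] := leP 0 a.
    by exists u => //; rewrite -uE -[in LHS](gez0_abs a1).
  exists (- u); rewrite ?unitrN // rmorphN mulrN -uE.
  by rewrite -[in LHS](opprK a) -(ltz0_abs a1) mulrNz.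
have [|a ua ->] := I (numq y); first by rewrite numq_eq0.
have [|b ub ->] := I (denq y); first by rewrite denq_eq0.
exists (a * b^-1); first by rewrite unitrMl ?unitrV.
rewrite rmorphM /= tofrac_unitV // expfzDr ?padic_natp_neq0 // invfM mulrACA.
by congr (_ * _ * _); rewrite invr_expz.
Qed.

Lemma pdvd_div_unit v w x u : u \is a GRing.unit -> pdvd v x ->
  pdvd (v - w) (x / (p%:R ^ w * tofrac u)).
Proof.
move=> uu vx; rewrite invfM; apply: pdvdM vx _; rewrite -tofrac_unitV // invr_expz.
by exists u^-1.
Qed.

Lemma pdvd_div_nat v x n : (0 < n)%N -> pdvd v x -> pdvd (v - (logn p n)%:Z) (x / n%:R).
Proof. by move=> /padic_nat_unit[u uu ->]; exact: pdvd_div_unit. Qed.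

Lemma pdvd_nat_dvd (k m : nat) : (p ^ k %| m)%N -> pdvd k%:Z (m%:R : Qp).
Proof.
move=> /dvdnP[c ->]; rewrite natrM natrX; apply: pdvdMl; first exact: pdvd_nat.
exact: pdvd_expz.
Qed.

Lemma pdvd_int_dvd (k : nat) (a : int) : pdvd k%:Z (a%:~R : Qp) <-> (p%:Z ^+ k %| a)%Z.
Proof.
rewrite -[a%:~R]subr0 padic_intr -(rmorph0 tofrac) pdvd_res pint0E pint_res_intr.
by split => /dvdz_mod0P.
Qed.

End PadicOrder.

(** * Formal inverses and slopes *)

Section FormalInverse.
Variable F : fieldType.
Implicit Types (P Q B Y Z : {poly F}).

Definition dvdX n P := exists Q, P = Q * 'X^n.

Lemma dvdXP n P : dvdX n P <-> forall m, (m < n)%N -> P`_m = 0.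
Proof.
split=> [[Q ->] m mn|H]; first by rewrite coefMXn mn.
exists (drop_poly n P); rewrite -{1}(poly_take_drop n P).
rewrite (_ : take_poly n P = 0) ?add0r //.
by apply/polyP => i; rewrite coef_take_poly coef0; case: ifP => // /H.
Qed.

Lemma dvdX0 n : dvdX n 0. Proof. by exists 0; rewrite mul0r. Qed.

Lemma dvdXD n P Q : dvdX n P -> dvdX n Q -> dvdX n (P + Q).
Proof. by move=> [A ->] [B ->]; exists (A + B); rewrite mulrDl. Qed.

Lemma dvdXB n P Q : dvdX n P -> dvdX n Q -> dvdX n (P - Q).
Proof. by move=> [A ->] [B ->]; exists (A - B); rewrite mulrBl. Qed.

Lemma dvdX_le m n P : (m <= n)%N -> dvdX n P -> dvdX m P.
Proof.
move=> mn [Q ->]; exists (Q * 'X^(n - m)).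
by rewrite -mulrA -exprD subnK.
Qed.

Lemma dvdXM m n P Q : dvdX m P -> dvdX n Q -> dvdX (m + n) (P * Q).
Proof. by move=> [A ->] [B ->]; exists (A * B); rewrite exprD mulrACA. Qed.

Lemma dvdXMl n P Q : dvdX n Q -> dvdX n (P * Q).
Proof. by move=> [B ->]; exists (P * B); rewrite mulrA. Qed.

Lemma dvdXMr n P Q : dvdX n P -> dvdX n (P * Q).
Proof. by rewrite mulrC; exact: dvdXMl. Qed.

Lemma dvdXZ n c P : dvdX n P -> dvdX n (c *: P).
Proof. by rewrite -mul_polyC; exact: dvdXMl. Qed.

Lemma dvdX_exp n P k : dvdX n P -> dvdX (n * k) (P ^+ k).
Proof.
move=> dP; elim: k => [|k IH]; first by exists 1; rewrite muln0 mul1r.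
by rewrite exprS mulnS; exact: dvdXM.
Qed.

Lemma dvdX_sum (I : Type) (r : seq I) (p : pred I) n (G : I -> {poly F}) :
  (forall i, p i -> dvdX n (G i)) -> dvdX n (\sum_(i <- r | p i) G i).
Proof. by move=> h; apply: big_rec => [|i x pi dx]; [exact: dvdX0 | apply: dvdXD => //; exact: h]. Qed.

Lemma dvdX_comp n P Y : dvdX n P -> dvdX 1 Y -> dvdX n (P \Po Y).
Proof.
move=> [Q ->] dY; rewrite comp_polyM; apply: dvdXMl.
by rewrite rmorphXn /= comp_polyX -[n in dvdX n]mul1n; exact: dvdX_exp.
Qed.

Lemma dvdX_subX n Y Z i : dvdX n (Y - Z) -> dvdX n (Y ^+ i - Z ^+ i).
Proof. by move=> d; rewrite subrXX; exact: dvdXMr. Qed.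

Lemma comp_polyB_sum B Y Z :
  (B \Po Y) - (B \Po Z) = \sum_(i < size B) B`_i *: (Y ^+ i - Z ^+ i).
Proof.
rewrite !comp_polyE -sumrB; apply: eq_bigr => i _.
by rewrite scalerBr.
Qed.

Lemma dvdX_deriv n P : dvdX n.+1 P -> dvdX n P^`().
Proof.
move/dvdXP => h; apply/dvdXP => m mn.
by rewrite coef_deriv h ?mul0rn.
Qed.

Section InverseSeries.
Variable b : nat -> F.

Definition trunc M : {poly F} := \poly_(k < M) b k.

(** The compositional inverse, one coefficient at a time: adding c X^(m+1) to the argument adds b_1
    c to the coefficient of X^(m+1) in the composite, whose target is X. Truncation at [m.+2] loses
    nothing in that degree because the argument has no constant term. *)
Fixpoint invp n : {poly F} :=
  if n is m.+1 then
    invp m + (((m == 0%N)%:R - (trunc m.+2 \Po invp m)`_m.+1) / b 1%N) *: 'X^(m.+1)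
  else 0.

Definition invser k := (invp k)`_k.

Lemma dvdX_invp n : dvdX 1 (invp n).
Proof.
elim: n => [|n IH] /=; first exact: dvdX0.
apply: dvdXD => //; apply: dvdXZ; apply: (@dvdX_le 1 n.+1) => //.
by exists 1; rewrite mul1r.
Qed.

Lemma size_invp n : (size (invp n) <= n.+1)%N.
Proof.
elim: n => [|n IH] /=; first by rewrite size_poly0.
rewrite (leq_trans (size_polyD _ _)) // geq_max (leq_trans IH) //=.
by rewrite (leq_trans (size_scale_leq _ _)) // size_polyXn.
Qed.

Lemma coef_invp n k : (k <= n)%N -> (invp n)`_k = invser k.
Proof.
move=> /subnK <-; elim: (n - k)%N => [|m IH]; first by rewrite add0n.
rewrite addSn /= coefD coefZ coefXn IH (_ : (k == _) = false) ?mulr0 ?addr0 //.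
by apply/negbTE; rewrite neq_ltn ltnS leq_addl.
Qed.

Lemma invpE n : invp n = \poly_(k < n.+1) invser k.
Proof.
apply/polyP => k; rewrite coef_poly ltnS; case: leqP => [|kn]; first exact: coef_invp.
by rewrite nth_default // (leq_trans (size_invp n)).
Qed.

Lemma invser0 : invser 0 = 0. Proof. by rewrite /invser /= coef0. Qed.

Lemma trunc_dvdX M M' : (M <= M')%N -> dvdX M (trunc M' - trunc M).
Proof.
move=> MM; apply/dvdXP => m mM.
by rewrite coefB !coef_poly mM (leq_trans mM MM) subrr.
Qed.

Lemma size_trunc M : (size (trunc M) <= M)%N. Proof. exact: size_poly. Qed.

Hypothesis b1 : b 1%N != 0.
Hypothesis b0 : b 0%N = 0.

Lemma invp_comp_small n : dvdX n.+1 (trunc n.+1 \Po invp n - 'X).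
Proof.
elim: n => [|n IH].
  apply/dvdXP => -[|//] _; rewrite coefB coefX subr0 comp_poly0r.
  by rewrite coefC coef_poly /= b0.
set c := (((n == 0%N)%:R - (trunc n.+2 \Po invp n)`_n.+1) / b 1%N).
have dc : dvdX n.+1 (c *: 'X^(n.+1)) by apply: dvdXZ; exists 1; rewrite mul1r.
(* The new monomial is visible modulo X^(n+2) only in the first power; in higher powers it is
   multiplied by a further factor without constant term. *)
have step i : dvdX n.+2 (invp n.+1 ^+ i - invp n ^+ i - (i == 1%N)%:R *: (c *: 'X^(n.+1))).
  case: i => [|i]; first by rewrite !expr0 subrr scale0r subr0; exact: dvdX0.
  have Yd : invp n.+1 - invp n = c *: 'X^(n.+1) by rewrite /= addrAC subrr add0r.
  case: i => [|i]; first by rewrite !expr1 Yd eqxx scale1r subrr; exact: dvdX0.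
  rewrite scale0r subr0.
  have -> : invp n.+1 ^+ i.+2 - invp n ^+ i.+2 =
    invp n.+1 * (invp n.+1 ^+ i.+1 - invp n ^+ i.+1) + (invp n.+1 - invp n) * invp n ^+ i.+1.
    by rewrite !(exprS _ i.+1); ring.
  apply: dvdXD.
    rewrite -(add1n n.+1); apply: dvdXM; first exact: dvdX_invp.
    by apply: dvdX_subX; rewrite Yd.
  rewrite Yd -addn1; apply: dvdXM => //; apply: (@dvdX_le 1 i.+1) => //.
  by rewrite -[X in dvdX X]mul1n; apply: dvdX_exp; exact: dvdX_invp.
have main : dvdX n.+2 ((trunc n.+2 \Po invp n.+1) - (trunc n.+2 \Po invp n) - (b 1%N * c) *: 'X^(n.+1)).
  have -> : (b 1%N * c) *: 'X^(n.+1) = \sum_(i < n.+2) (trunc n.+2)`_i *: ((nat_of_ord i == 1%N)%:R *: (c *: 'X^(n.+1))).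
    have l1 : (1 < n.+2)%N by [].
    rewrite (bigD1 (Ordinal l1)) //= scale1r coef_poly /= scalerA big1 ?addr0 //.
    by move=> i; rewrite -val_eqE /= => /negbTE ->; rewrite scale0r scaler0.
  have -> : (trunc n.+2 \Po invp n.+1) - (trunc n.+2 \Po invp n) =
     \sum_(i < n.+2) (trunc n.+2)`_i *: (invp n.+1 ^+ i - invp n ^+ i).
    rewrite comp_polyB_sum (big_ord_widen n.+2 (fun i => (trunc n.+2)`_i *: (invp n.+1 ^+ i - invp n ^+ i)) (size_trunc _)).
    rewrite big_mkcond; apply: eq_bigr => i _; case: ifPn => //.
    by rewrite -leqNgt => /leq_sizeP h; rewrite h ?scale0r.
  rewrite -sumrB; apply: dvdX_sum => i _; rewrite -scalerBr; apply: dvdXZ.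
  exact: step.
have low : dvdX n.+1 (trunc n.+2 \Po invp n - 'X).
  have -> : trunc n.+2 \Po invp n - 'X =
    (trunc n.+2 - trunc n.+1) \Po invp n + (trunc n.+1 \Po invp n - 'X).
    by rewrite comp_polyB; ring.
  apply: dvdXD => //; apply: dvdX_comp; last exact: dvdX_invp.
  exact: trunc_dvdX.
have split : trunc n.+2 \Po invp n.+1 - 'X =
  ((trunc n.+2 \Po invp n.+1) - (trunc n.+2 \Po invp n) - (b 1%N * c) *: 'X^(n.+1)) +
  (trunc n.+2 \Po invp n - 'X + (b 1%N * c) *: 'X^(n.+1)) by ring.
rewrite split; apply: dvdXD => //; apply/dvdXP => m mn.
move/dvdXP : low => low.
rewrite coefD coefZ coefXn.
move: mn; rewrite ltnS leq_eqVlt => /predU1P[->|mn].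
  rewrite eqxx mulr1 coefB coefX eqSS mulrC divfK //.
  by ring.
by rewrite low // (ltn_eqF mn) mulr0 addr0.
Qed.

Lemma invp_comp M n : (n < M)%N -> dvdX n.+1 (trunc M \Po invp n - 'X).
Proof.
move=> nM.
have -> : trunc M \Po invp n - 'X =
    (trunc M - trunc n.+1) \Po invp n + (trunc n.+1 \Po invp n - 'X).
  by rewrite comp_polyB; ring.
apply: dvdXD; last exact: invp_comp_small.
by apply: dvdX_comp; [exact: trunc_dvdX | exact: dvdX_invp].
Qed.

End InverseSeries.

(* If [phi] satisfies [(1 + A x) phi' = a A phi] and [phi(x(t)) = 1 + beta t],
   then [x] satisfies the linear equation [a A (1 + beta t) x' = beta (1 + A x)]. *)
Lemma binomial_inverse (phi b : nat -> F) (A a beta : F) :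
  A != 0 -> a != 0 -> beta != 0 -> phi 0%N = 1 -> (forall k, k.+1%:R * phi k.+1 = A * (a - k%:R) * phi k) ->
  b 0%N = 0 -> (forall k, b k.+1 = phi k.+1 / beta) ->
  invser b 1%N = beta / (a * A) /\
  forall k, (0 < k)%N -> k.+1%:R * invser b k.+1 = beta * (a^-1 - k%:R) * invser b k.
Proof.
move=> A0 a0 be0 phi0 phiS b0 bS.
have b1 : b 1%N != 0.
  have := phiS 0%N; rewrite mul1r phi0 subr0 mulr1 => phi1.
  by rewrite bS phi1 !mulf_neq0 ?invr_neq0.
suff H n : (((n == 0%N)%:R + A * invser b n) * beta =
    a * A * (n.+1%:R * invser b n.+1 + beta * (n%:R * invser b n))).
  split.
    have := H 0%N; rewrite invser0 mulr0 addr0 !mul1r !mul0r mulr0 addr0 => ->.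
    by field; rewrite A0 a0.
  case=> // k _; have := H k.+1; rewrite /= add0r => E.
  have {}E : k.+2%:R * invser b k.+2 = (A * invser b k.+1 * beta) / (a * A) - beta * (k.+1%:R * invser b k.+1).
    by rewrite E; field; rewrite A0 a0.
  by rewrite E; field; rewrite A0 a0.
pose M := n.+2; pose Y := invp b n.+1.
pose Phi := \poly_(k < M) phi k.
have PhiE : Phi = 1 + beta *: trunc b M.
  apply/polyP => -[|k]; rewrite coefD coefZ !coef_poly coefC /=.
    by rewrite b0 mulr0 addr0 phi0.
  by rewrite add0r bS mulrC; case: ifP => _; rewrite ?divfK // mul0r.
have ode : dvdX n.+1 ((1 + A *: 'X) * Phi^`() - (a * A) *: Phi).
  apply/dvdXP => m mn; rewrite mulrDl mul1r -scalerAl !coefB coefD !coefZ coefXM.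
  rewrite !coef_deriv !coef_poly.
  have -> : (m.+1 < M)%N by []; have -> : (m < M)%N by exact: ltnW.
  case: m mn => [|m] mn /=.
    by have := phiS 0%N; rewrite mulr0 addr0 mul1r phi0 subr0 !mulr1 mulr1n => ->; ring.
  have -> : (m.+1 < M)%N by exact: ltnW.
  rewrite -[_ *+ m.+2]mulr_natl phiS -mulr_natl; ring.
have odeY := dvdX_comp ode (dvdX_invp b n.+1).
have PhiY : dvdX n.+2 (Phi \Po Y - (1 + beta *: 'X)).
  have -> : Phi \Po Y - (1 + beta *: 'X) = beta *: (trunc b M \Po Y - 'X).
    by rewrite PhiE comp_polyD comp_polyZ comp_polyC scalerBr; ring.
  by apply: dvdXZ; apply: invp_comp.
have dPhiY := dvdX_deriv PhiY.
(* The equation for [Phi] is composed with [Y] and multiplied by Y'; by the chain rule (Phi' o Y) Y'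
   is the derivative of [Phi \Po Y], that is, beta modulo X^(n+1). *)
have fin : dvdX n.+1 (beta *: (1 + A *: Y) - (a * A) *: ((1 + beta *: 'X) * Y^`())).
  have -> : beta *: (1 + A *: Y) - (a * A) *: ((1 + beta *: 'X) * Y^`()) =
    (((1 + A *: 'X) * Phi^`() - (a * A) *: Phi) \Po Y) * Y^`()
    - (1 + A *: Y) * (Phi \Po Y - (1 + beta *: 'X))^`()
    + (a * A) *: ((Phi \Po Y - (1 + beta *: 'X)) * Y^`()).
    have dE : (1 + beta *: 'X)^`() = beta%:P :> {poly F}.
      by rewrite derivD derivC derivZ derivX add0r alg_polyC.
    rewrite derivB deriv_comp dE.
    rewrite comp_polyB comp_polyM comp_polyD !comp_polyZ comp_polyC comp_polyX.
    by rewrite -!mul_polyC; ring.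
  apply: dvdXD; [apply: dvdXB|].
  - exact: dvdXMr.
  - exact: dvdXMl.
  - by apply: dvdXZ; apply: dvdXMr; apply: dvdX_le PhiY.
move/dvdXP/(_ n (leqnn _))/eqP : fin.
rewrite coefB !coefZ mulrDl mul1r -scalerAl !coefD !coefZ coefXM coefC !coef_deriv.
rewrite subr_eq0 => /eqP E.
have Yn : Y`_n = invser b n by rewrite coef_invp.
have YSn : Y`_n.+1 = invser b n.+1 by rewrite coef_invp.
rewrite Yn YSn in E.
have -> : ((n == 0%N)%:R + A * invser b n) * beta = beta * ((if n == 0%N then 1 else 0) + A * invser b n).
  by rewrite mulrC; case: (n == 0%N).
rewrite E mulr_natl (_ : (if _ then 0 else _) = n%:R * invser b n) //.
by rewrite -Yn; case: (n) => [|k] /=; rewrite ?mul0r // mulr_natl.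
Qed.

End FormalInverse.

(** The slope estimates rest on these closure properties of [pdvd] alone, so they are proved for any
    field with such a family. *)
Record filtration (F : fieldType) := Filtration {
  fdvd :> int -> F -> Prop;
  fdvd0 : forall v, fdvd v 0;
  fdvdD : forall v x y, fdvd v x -> fdvd v y -> fdvd v (x + y);
  fdvdN : forall v x, fdvd v x -> fdvd v (- x);
  fdvdM : forall v w x y, fdvd v x -> fdvd w y -> fdvd (v + w) (x * y);
  fdvd_le : forall v w x, w <= v -> fdvd v x -> fdvd w x;
  fdvd1 : fdvd 0 1 }.

Section Slopes.
Variables (R : realType) (F : fieldType) (D : filtration F) (mu : R).
Implicit Types (d e : R) (P Q Y Z : {poly F}).

(** Slopes are real numbers while valuations are integers: ord x >= r amounts to ord x >=
    ceil(r). *)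
Definition rdvd (r : R) (x : F) := D (Num.ceil r) x.

Lemma rdvd_le r s x : s <= r -> rdvd r x -> rdvd s x.
Proof. by move=> sr; apply: fdvd_le; exact: le_ceil. Qed.

Lemma rdvdM r s x y : rdvd r x -> rdvd s y -> rdvd (r + s) (x * y).
Proof.
move=> rx sy; apply: fdvd_le (fdvdM rx sy).
by rewrite ceil_le_int intrD lerD // ceil_ge.
Qed.

Lemma rdvd0 r : rdvd r 0. Proof. exact: fdvd0. Qed.

Lemma rdvdD r x y : rdvd r x -> rdvd r y -> rdvd r (x + y).
Proof. exact: fdvdD. Qed.

Lemma rdvdN r x : rdvd r x -> rdvd r (- x).
Proof. exact: fdvdN. Qed.

Lemma rdvdB r x y : rdvd r x -> rdvd r y -> rdvd r (x - y).
Proof. by move=> rx ry; apply: rdvdD => //; exact: rdvdN. Qed.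

Lemma rdvd1 : rdvd 0 1. Proof. by rewrite /rdvd ceil0; exact: fdvd1. Qed.

Lemma rdvd_sum (I : Type) (r : seq I) (p : pred I) s (G : I -> F) :
  (forall i, p i -> rdvd s (G i)) -> rdvd s (\sum_(i <- r | p i) G i).
Proof. by move=> h; apply: big_rec => [|i x pi dx]; [exact: rdvd0 | apply: rdvdD => //; exact: h]. Qed.

(* The coefficients of [P] grow as those of [p^d x^r] where [x] is a power
   series without constant term and of slope [mu]. *)
Definition sloped d (r : nat) P := forall n, rdvd (d + (n%:R - r%:R) * mu) P`_n.

Lemma sloped0 d r : sloped d r 0. Proof. by move=> n; rewrite coef0; exact: rdvd0. Qed.

Lemma slopedD d r P Q : sloped d r P -> sloped d r Q -> sloped d r (P + Q).
Proof. by move=> h1 h2 n; rewrite coefD; exact: rdvdD. Qed.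

Lemma slopedB d r P Q : sloped d r P -> sloped d r Q -> sloped d r (P - Q).
Proof. by move=> h1 h2 n; rewrite coefB; exact: rdvdB. Qed.

Lemma sloped_sum (I : Type) (s : seq I) (p : pred I) d r (G : I -> {poly F}) :
  (forall i, p i -> sloped d r (G i)) -> sloped d r (\sum_(i <- s | p i) G i).
Proof. by move=> h; apply: big_rec => [|i x pi dx]; [exact: sloped0 | apply: slopedD => //; exact: h]. Qed.

Lemma slopedM d e r s P Q : sloped d r P -> sloped e s Q -> sloped (d + e) (r + s) (P * Q).
Proof.
move=> h1 h2 n; rewrite coefM; apply: rdvd_sum => i _.
apply: rdvd_le (rdvdM (h1 i) (h2 (n - i)%N)).
have -> : (n - i)%:R = n%:R - i%:R :> R by rewrite natrB // -ltnS.
by rewrite natrD le_eqVlt; apply/orP; left; apply/eqP; ring.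
Qed.

Lemma slopedX k Y : sloped 0 1 Y -> sloped 0 k (Y ^+ k).
Proof.
move=> sY; elim: k => [|k IH].
  move=> n; rewrite expr0 coefC; case: ifP => [/eqP ->|_]; last exact: rdvd0.
  by rewrite subrr mul0r addr0; exact: rdvd1.
by rewrite exprS -[0]addr0 -add1n; exact: slopedM.
Qed.

Lemma slopedZ (d e : R) r c P : rdvd e c -> sloped d r P -> sloped (e + d) r (c *: P).
Proof.
by move=> ec sP n; rewrite coefZ -addrA; exact: rdvdM.
Qed.

(** The normalization (n-1) mu is stable under composition: (i-1) mu from a coefficient of [P] and
    (n-i) mu from Y^i add up to (n-1) mu. *)
Lemma sloped_comp d P Y : sloped d 1 P -> sloped 0 1 Y -> sloped d 1 (P \Po Y).
Proof.
move=> sP sY; rewrite comp_polyE; apply: sloped_sum => i _ n.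
apply: rdvd_le (slopedZ (sP i) (slopedX i sY) n).
by rewrite le_eqVlt; apply/orP; left; apply/eqP; ring.
Qed.

Lemma sloped_subX d Y Z k : sloped 0 1 Y -> sloped 0 1 Z -> sloped d 1 (Y - Z) ->
  sloped d k (Y ^+ k - Z ^+ k).
Proof.
move=> sY sZ sYZ; elim: k => [|k IH]; first by rewrite !expr0 subrr; exact: sloped0.
have -> : Y ^+ k.+1 - Z ^+ k.+1 = Y * (Y ^+ k - Z ^+ k) + (Y - Z) * Z ^+ k.
  by rewrite !exprS; ring.
apply: slopedD.
  by rewrite -[d]add0r -add1n; exact: slopedM.
by rewrite -[d]addr0 -add1n; apply: slopedM => //; exact: slopedX.
Qed.

Lemma sloped_comp_sub d P Y Z : sloped 0 1 P -> sloped 0 1 Y -> sloped 0 1 Z ->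
  sloped d 1 (Y - Z) -> sloped d 1 ((P \Po Y) - (P \Po Z)).
Proof.
move=> sP sY sZ sYZ; rewrite comp_polyB_sum; apply: sloped_sum => i _ n.
apply: rdvd_le (slopedZ (sP i) (sloped_subX i sY sZ sYZ) n).
by rewrite le_eqVlt; apply/orP; left; apply/eqP; ring.
Qed.

Lemma sloped_trunc d (b : nat -> F) M :
  (forall k, rdvd (d + (k%:R - 1) * mu) (b k)) -> sloped d 1 (trunc b M).
Proof. by move=> h n; rewrite coef_poly; case: ifP => _; [exact: h | exact: rdvd0]. Qed.

Lemma slopedXn d c n r : rdvd (d + (n%:R - r%:R) * mu) c -> sloped d r (c *: 'X^n).
Proof.
move=> h m; rewrite coefZ coefXn; case: eqVneq => [->|_]; first by rewrite mulr1.
by rewrite mulr0; exact: rdvd0.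
Qed.

Lemma sloped_invp (b : nat -> F) n :
  (forall k, rdvd ((k%:R - 1) * mu) (b k)) -> rdvd 0 (b 1%N)^-1 -> sloped 0 1 (invp b n).
Proof.
move=> hb hb1; elim: n => [|n IH] /=; first exact: sloped0.
apply: slopedD => //; apply: slopedXn; rewrite add0r -[X in rdvd X _]addr0.
apply: rdvdM => //; apply: rdvdB.
  case: eqVneq => [->|_]; last exact: rdvd0.
  by rewrite subrr mul0r; exact: rdvd1.
have hb' k : rdvd (0 + (k%:R - 1) * mu) (b k) by rewrite add0r.
by have := sloped_comp (sloped_trunc n.+2 hb') IH n.+1; rewrite add0r.
Qed.

(** Perturbing a series by p^d perturbs its inverse by p^d with the same slope: each new coefficient
    depends on the series, on the earlier coefficients and on 1/b_1, and all of these carry the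
    estimate. *)
Lemma sloped_invp_sub d (b c : nat -> F) n : 0 <= d ->
  (forall k, rdvd ((k%:R - 1) * mu) (b k)) -> rdvd 0 (b 1%N)^-1 ->
  (forall k, rdvd ((k%:R - 1) * mu) (c k)) -> rdvd 0 (c 1%N)^-1 ->
  b 1%N != 0 -> c 1%N != 0 ->
  (forall k, rdvd (d + (k%:R - 1) * mu) (b k - c k)) ->
  sloped d 1 (invp b n - invp c n).
Proof.
move=> d0 hb hb1 hc hc1 b1 c1 hbc; elim: n => [|n IH] /=.
  by rewrite subrr; exact: sloped0.
set B := (n == 0%N)%:R - (trunc b n.+2 \Po invp b n)`_n.+1.
set C := (n == 0%N)%:R - (trunc c n.+2 \Po invp c n)`_n.+1.
have sb := sloped_invp n hb hb1; have sc := sloped_invp n hc hc1.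
have hb' k : rdvd (0 + (k%:R - 1) * mu) (b k) by rewrite add0r.
have hc' k : rdvd (0 + (k%:R - 1) * mu) (c k) by rewrite add0r.
have tb := sloped_trunc n.+2 hb'; have tc := sloped_trunc n.+2 hc'.
have tbc : sloped d 1 (trunc b n.+2 - trunc c n.+2).
  move=> k; rewrite coefB !coef_poly; case: ifP => _; last by rewrite subrr; exact: rdvd0.
  exact: hbc.
have C0 : rdvd (0 + (n.+1%:R - 1) * mu) C.
  apply: rdvdB; last exact: (sloped_comp tc sc n.+1).
  case: eqVneq => [->|_]; last exact: rdvd0.
  by rewrite subrr mul0r addr0; exact: rdvd1.
have BC : rdvd (d + (n.+1%:R - 1) * mu) (B - C).
  have -> : B - C = - ((trunc b n.+2 - trunc c n.+2) \Po invp b n)`_n.+1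
     - ((trunc c n.+2 \Po invp b n) - (trunc c n.+2 \Po invp c n))`_n.+1.
    by rewrite comp_polyB !coefB /B /C; ring.
  apply: rdvdB; first exact/rdvdN/(sloped_comp tbc sb n.+1).
  exact: (sloped_comp_sub tc sb sc IH n.+1).
have -> : invp b n + (B / b 1%N) *: 'X^(n.+1) - (invp c n + (C / c 1%N) *: 'X^(n.+1)) =
  (invp b n - invp c n) + (B / b 1%N - C / c 1%N) *: 'X^(n.+1).
  by rewrite scalerBl; ring.
apply: slopedD => //; apply: slopedXn.
have -> : B / b 1%N - C / c 1%N = (B - C) / b 1%N - C * ((b 1%N - c 1%N) / b 1%N / c 1%N).
  by field; rewrite b1 c1.
apply: rdvdB; first by rewrite -[X in rdvd X _]addr0; exact: rdvdM.
rewrite -[d]add0r addrAC; apply: rdvdM => //.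
rewrite -[d]addr0; apply: rdvdM => //; rewrite -[d]addr0; apply: rdvdM => //.
by have := hbc 1%N; rewrite subrr mul0r addr0.
Qed.

Lemma rdvd_invser (b : nat -> F) n :
  (forall k, rdvd ((k%:R - 1) * mu) (b k)) -> rdvd 0 (b 1%N)^-1 ->
  rdvd ((n%:R - 1) * mu) (invser b n).
Proof. by move=> hb hb1; have := sloped_invp n hb hb1 n; rewrite add0r. Qed.

Lemma rdvd_invser_sub d (b c : nat -> F) n : 0 <= d ->
  (forall k, rdvd ((k%:R - 1) * mu) (b k)) -> rdvd 0 (b 1%N)^-1 ->
  (forall k, rdvd ((k%:R - 1) * mu) (c k)) -> rdvd 0 (c 1%N)^-1 ->
  b 1%N != 0 -> c 1%N != 0 ->
  (forall k, rdvd (d + (k%:R - 1) * mu) (b k - c k)) ->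
  rdvd (d + (n%:R - 1) * mu) (invser b n - invser c n).
Proof.
move=> *; have := sloped_invp_sub (d := d) (b := b) (c := c) n.
by move=> /(_ _ _ _ _ _ _ _ _ n); rewrite coefB; apply.
Qed.

Lemma deriv_antiderivative (b : nat -> F) M : (forall k, (k.+1%:R : F) != 0) ->
  (\poly_(k < M.+1) (if k is k'.+1 then b k' / k%:R else 0))^`() = trunc b M.
Proof.
move=> char0; apply/polyP => k; rewrite coef_deriv !coef_poly ltnS.
by rewrite -[LHS]mulr_natr; case: ifP => _; rewrite ?divfK ?mul0r ?char0.
Qed.

(* The critical value of [psi(x) - t x] in terms of the critical point
   [x(t)]: both sides have derivative [- x(t)]. *)
Lemma legendre_poly (b : nat -> F) M n :
  (forall k, (k.+1%:R : F) != 0) -> b 0%N = 0 -> b 1%N != 0 ->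
  (forall k, rdvd ((k%:R - 1) * mu) (b k)) -> rdvd 0 (b 1%N)^-1 -> (n < M)%N ->
  let psi := \poly_(k < M.+1) (if k is k'.+1 then b k' / k%:R else 0) in
  let Y := invp b n in
  let L := \poly_(k < n.+2) (if k is k'.+1 then - invser b k' / k%:R else 0) in
  let E := (psi \Po Y) - 'X * Y - L in
  forall k, if (k <= n.+1)%N then E`_k = 0 else
    exists2 c, rdvd ((k%:R - 2) * mu) c & E`_k = c / k%:R.
Proof.
move=> char0 b0 b1 hb hb1 nM psi Y L E.
have dpsi : psi^`() = trunc b M by exact: deriv_antiderivative.
have dL : L^`() = - Y.
  apply/polyP => k; rewrite coef_deriv coefN /Y invpE !coef_poly ltnS.
  by rewrite -[LHS]mulr_natr; case: ifP => _; rewrite ?divfK ?mul0r ?oppr0 ?char0.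
(* Since L' = -Y, the terms of the product rule without the factor Y' cancel. *)
have dE : E^`() = ((trunc b M \Po Y) - 'X) * Y^`().
  by rewrite !derivB derivM deriv_comp dpsi dL derivX; ring.
have dX : dvdX n.+1 E^`().
  by rewrite dE; apply: dvdXMr; apply: invp_comp.
have sY := sloped_invp n hb hb1.
have hb' k : rdvd (0 + (k%:R - 1) * mu) (b k) by rewrite add0r.
have sE : sloped 0 1 E^`().
  rewrite dE => k.
  have s1 : sloped 0 1 ((trunc b M \Po Y) - 'X).
    apply: slopedB; first exact: sloped_comp (sloped_trunc M hb') sY.
    move=> m; rewrite coefX; case: eqVneq => [->|_]; last exact: rdvd0.
    by rewrite subrr mul0r addr0; exact: rdvd1.
  have s2 : sloped 0 0 Y^`().
    move=> m; rewrite coef_deriv -[X in rdvd _ X]mulr_natl -[X in rdvd X _]add0r.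
    apply: rdvdM; last first.
      by have := sY m.+1; rewrite -natr1 addrK subr0.
    elim: m.+1 => [|j IH]; first exact: rdvd0.
    by rewrite -natr1; apply: rdvdD => //; exact: rdvd1.
  by have := slopedM s1 s2 k; rewrite addr0 addn0.
case=> [|k] /=.
  rewrite !coefB coefXM /= coef_poly /= !subr0.
  have /dvdXP/(_ 0%N isT) := dvdX_invp b n; rewrite -/Y => Y0.
  have : dvdX 1 (psi \Po Y).
    apply: dvdX_comp; last exact: dvdX_invp.
    by apply/dvdXP => -[|//] _; rewrite coef_poly.
  by move/dvdXP/(_ 0%N isT).
have Ek : E`_k.+1 = E^`()`_k / k.+1%:R.
  by rewrite coef_deriv -[_ *+ _.+1 in RHS]mulr_natr mulfK.
rewrite ltnS; case: ifP => kn.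
  by rewrite Ek; move/dvdXP : dX => ->; rewrite ?mul0r // ltnS.
exists E^`()`_k => //; have := sE k; rewrite add0r; apply: rdvd_le.
by rewrite -natr1 le_eqVlt; apply/orP; left; apply/eqP; ring.
Qed.

End Slopes.

Lemma frac_add_common (F : fieldType) (p : nat) (a b : int) (k l : nat) :
  p%:R ^+ k != 0 :> F -> p%:R ^+ l != 0 :> F ->
  a%:~R / p%:R ^+ k + b%:~R / p%:R ^+ l =
  (a * p%:Z ^+ l + b * p%:Z ^+ k)%:~R / p%:R ^+ (k + l) :> F.
Proof.
by move=> pk pl; rewrite intrD !intrM !rmorphXn /= exprD; field; rewrite pk pl.
Qed.

Lemma frac_sub_common (F : fieldType) (p : nat) (a b : int) (k l : nat) :
  p%:R ^+ k != 0 :> F -> p%:R ^+ l != 0 :> F ->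
  b%:~R / p%:R ^+ l - a%:~R / p%:R ^+ k =
  (b * p%:Z ^+ k - a * p%:Z ^+ l)%:~R / p%:R ^+ (l + k) :> F.
Proof.
by move=> pk pl; rewrite intrB !intrM !rmorphXn /= exprD; field; rewrite pk pl.
Qed.

(** * Stationary phase *)

Section PadicCharacter.
Variables (R : realType) (p : nat) (hp : prime p).
Local Notation Zp := (pint hp).
Local Notation Qp := (padic hp).
Local Notation tofrac := (@FracField.tofrac Zp).
Local Notation e := (@expi_padic R p hp).
Implicit Types (x y : Qp).

Local Lemma padic_ratr_frac (a : int) k :
  ratr (a%:~R / p%:R ^+ k) = a%:~R / p%:R ^+ k :> Qp.
Proof. by rewrite padic_ratrM padic_ratrV ratr_int -natrX ratr_nat natrX. Qed.

Lemma padic_frac_approx x : exists (a : int) (k : nat), pdvd 0 (x - a%:~R / p%:R ^+ k).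
Proof.
have [->|x0] := eqVneq x 0.
  by exists 0, 0%N; rewrite mul0r subr0; exact: pdvd0.
have [v [u [uu xE _]]] := padic_decomp x0.
have [v0|v0] := leP 0 v.
  by exists 0, 0%N; rewrite mul0r subr0; apply: pdvd_le v0 _; exists u.
pose k := `|v|%N; exists (u k), k.
have -> : x - (u k)%:~R / p%:R ^+ k = p%:R ^ v * (tofrac u - tofrac (u k)%:~R).
  rewrite xE mulrBr -padic_intr; congr (_ - _); rewrite mulrC; congr (_ * _).
  by rewrite exprnN; congr (_ ^ _); rewrite /k; lia.
rewrite -[0](addNr v) addrC -[X in X + - v]opprK addrC.
have -> : - v - - v = k%:Z + v by rewrite /k; lia.
apply/pdvd_mul_expz/pdvd_res.
by rewrite pint_res_intr pint_res_mod.
Qed.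

Lemma expi_frac_int (c : int) k : pdvd 0 (c%:~R / p%:R ^+ k : Qp) ->
  expi (c%:~R / p%:R ^+ k : R) = 1.
Proof.
move=> [z zE]; have : pdvd k%:Z (c%:~R : Qp).
  exists z; rewrite expr0z mul1r in zE; rewrite -zE mulrC divfK //.
  exact: (padic_expz_neq0 hp k%:Z).
move/pdvd_int_dvd/dvdzP => [d ->]; rewrite intrM rmorphXn /= mulfK ?expi_int //.
by rewrite expf_neq0 // pnatr_eq0 -lt0n prime_gt0.
Qed.

(** Two admissible rationals differ by a fraction with p-power denominator that is p-adically
    integral, hence by an integer. *)
Lemma expi_padicE x (a : int) k : pdvd 0 (x - a%:~R / p%:R ^+ k) ->
  e x = expi (a%:~R / p%:R ^+ k).
Proof.
move=> xa; rewrite /expi_padic.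
case: xgetP => [r _ [[b [l rE]] [z zE]]|nex]; last first.
  exfalso; case: xa => z zE; apply: (nex (a%:~R / p%:R ^+ k)); split; first by exists a, k.
  by exists z; rewrite padic_ratr_frac zE expr0z mul1r.
have rR : ratr r = b%:~R / p%:R ^+ l :> R.
  by rewrite rE fmorph_div /= ratr_int rmorphXn /= ratr_nat.
have rQ : ratr r = b%:~R / p%:R ^+ l :> Qp by rewrite rE padic_ratr_frac.
rewrite rR; have pR n : p%:R ^+ n != 0 :> R.
  by rewrite expf_neq0 // pnatr_eq0 -lt0n prime_gt0.
have h : pdvd 0 ((b * p%:Z ^+ k - a * p%:Z ^+ l)%:~R / p%:R ^+ (l + k) : Qp).
  have -> : (b * p%:Z ^+ k - a * p%:Z ^+ l)%:~R / p%:R ^+ (l + k) =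
      (x - a%:~R / p%:R ^+ k) - (x - ratr r) :> Qp.
    rewrite -frac_sub_common; try exact: (padic_expz_neq0 hp _%:Z).
    by rewrite rQ opprB [RHS]addrC addrA subrK.
  by apply: pdvdB => //; rewrite zE; exact: pdvd_tofrac.
have := expi_frac_int h; move: (pR k) (pR l) => pk pl.
have -> : (b * p%:Z ^+ k - a * p%:Z ^+ l)%:~R / p%:R ^+ (l + k) =
   b%:~R / p%:R ^+ l - a%:~R / p%:R ^+ k :> R.
  by rewrite frac_sub_common.
rewrite expiD expiN => /(congr1 (fun z => z * expi (a%:~R / p%:R ^+ k))).
by rewrite divfK ?expi_neq0 // mul1r.
Qed.

Lemma expi_padic_frac (a : int) k : e (a%:~R / p%:R ^+ k) = expi (a%:~R / p%:R ^+ k).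
Proof. by apply: expi_padicE; rewrite subrr; exact: pdvd0. Qed.

Lemma expi_padicD x y : e (x + y) = e x * e y.
Proof.
have [a [k xa]] := padic_frac_approx x; have [b [l yb]] := padic_frac_approx y.
rewrite (expi_padicE xa) (expi_padicE yb) -expiD.
have pR n : p%:R ^+ n != 0 :> R.
  by rewrite expf_neq0 // pnatr_eq0 -lt0n prime_gt0.
have P n : p%:R ^+ n != 0 :> Qp by exact: (padic_expz_neq0 hp n%:Z).
rewrite frac_add_common ?pR //; apply: expi_padicE; rewrite -frac_add_common ?P //.
have -> : x + y - (a%:~R / p%:R ^+ k + b%:~R / p%:R ^+ l) =
   (x - a%:~R / p%:R ^+ k) + (y - b%:~R / p%:R ^+ l) by rewrite opprD addrACA.
exact: pdvdD.
Qed.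

Lemma expi_padic_int x : pdvd 0 x -> e x = 1.
Proof.
move=> x0; rewrite (@expi_padicE x 0 0%N); first by rewrite mul0r expi0.
by rewrite mul0r subr0.
Qed.

Lemma norm_expi_padic x : `|e x| = 1.
Proof. by have [a [k /expi_padicE ->]] := padic_frac_approx x; rewrite norm_expi. Qed.

Lemma expi_padic_eq x y : pdvd 0 (x - y) -> e x = e y.
Proof.
by move=> xy; rewrite -[x](subrK y) expi_padicD (expi_padic_int xy) mul1r.
Qed.

End PadicCharacter.

Lemma frac_block (F : fieldType) (a b k y d : F) : a != 0 -> b != 0 ->
  y * (a * k) / (a * b) - k * d / b = k * ((y - d) / b).
Proof. by move=> a0 b0; field; rewrite a0 b0. Qed.

Section PhaseShifts.
Variables (F : comNzRingType) (a b c d x y h t : F).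

(** In this and the next three identities a is psi at the shifted point, b = psi(x), d = psi'(x) and
    c = psi(h): Taylor remainders of psi are rewritten for the tilted phase psi(x) - tx. *)
Lemma shift_phase1 : a - (b + d * h) = (a - t * (x + h)) - ((b - t * x) + (d - t) * h).
Proof. by ring. Qed.

Lemma shift_phase2 : a - (b + d * h) + (d - t) * h = (a - t * (x + h)) - (b - t * x).
Proof. by ring. Qed.

Lemma shift_phase3 : a - (b + d * (y - x)) + (d - t) * (y - x) = (a - t * y) - (b - t * x).
Proof. by ring. Qed.

Lemma shift_phase4 : a - (b + d * h) - c + (d - t) * h = (a - t * (x + h)) - ((b - t * x) + c).
Proof. by ring. Qed.

End PhaseShifts.

Section StationaryPhase.
Variables (R : realType) (p : nat) (hp : prime p).
Local Notation Zp := (pint hp).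
Local Notation Qp := (padic hp).
Local Notation tofrac := (@FracField.tofrac Zp).
Implicit Types (x y z h : Qp).

Lemma pdvd_horner v (P : {poly Qp}) x : (forall i, pdvd v P`_i) -> pdvd 0 x ->
  pdvd v P.[x].
Proof.
move=> hP x0; rewrite horner_coef; apply: pdvd_sum => i _.
apply: pdvdMr; first exact: hP.
by have := pdvdX i x0; rewrite mul0rn.
Qed.

Lemma pdvd_horner_sub0 v (P : {poly Qp}) x : (forall i, pdvd v P`_i.+1) -> pdvd 0 x ->
  pdvd v (P.[x] - P.[0]).
Proof.
move=> hP x0; rewrite -[P.[0]](hornerC _ x) horner_coef0 -hornerN -hornerD.
apply: pdvd_horner => // -[|i]; first by rewrite coefB coefC subrr; exact: pdvd0.
by rewrite coefB coefC subr0; exact: hP.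
Qed.

Variables (N s r : nat) (psi : {poly Qp}).
Hypotheses (sr : N = (s + r)%N) (rs : (r <= s)%N).
Hypothesis psi00 : psi`_0 = 0.
Hypothesis psi10 : psi`_1 = 0.
(** The elements psi_k C(k,j) are the coefficients of the j-th divided derivative. [coarse] kills
    every Taylor term of order j >= 2 at steps in p^s; [fine], restricted to j < k, leaves out the
    constant term of that derivative, so at steps in p^r it only makes the Taylor terms independent
    of the base point. *)
Hypothesis coarse : forall k j, (1 < j)%N -> (j <= k)%N ->
  pdvd (N%:Z - (j * s)%N%:Z) (psi`_k *+ 'C(k, j)).
Hypothesis fine : forall k j, (1 < j)%N -> (j < k)%N ->
  pdvd (N%:Z - (j * r)%N%:Z) (psi`_k *+ 'C(k, j)).
Variable u : Zp.
Hypotheses (uu : u \is a GRing.unit) (psi2 : psi`_2 *+ 2 = tofrac u).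
Hypothesis psi3 : forall k, (2 < k)%N -> pdvd 1 (psi`_k *+ k).

Local Notation E x := (@expi_padic R p hp (x / p%:R ^+ N)).

Lemma phaseD x y : E (x + y) = E x * E y.
Proof. by rewrite mulrDl expi_padicD. Qed.

Lemma phase_int x : pdvd N%:Z x -> E x = 1.
Proof.
move=> xN; apply: expi_padic_int; rewrite mulrC exprnN.
by rewrite -(addrN N%:Z) ; apply/pdvd_mul_expz.
Qed.

Lemma phase_eq x y : pdvd N%:Z (x - y) -> E x = E y.
Proof. by move=> xy; rewrite -[x](subrK y) phaseD (phase_int xy) mul1r. Qed.

Lemma deriv_coef_pdvd k : pdvd 0 psi^`()`_k.
Proof.
rewrite coef_deriv; case: k => [|[|k]]; first by rewrite psi10 mul0rn; exact: pdvd0.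
  by rewrite psi2; exact: pdvd_tofrac.
by apply: pdvd_le (psi3 _).
Qed.

Lemma deriv_pdvd x : pdvd 0 x -> pdvd 0 psi^`().[x].
Proof. by move=> x0; apply: pdvd_horner => //; exact: deriv_coef_pdvd. Qed.

Lemma deriv_at0 : psi^`().[0] = 0.
Proof. by rewrite horner_coef0 coef_deriv psi10 mul0rn. Qed.

Lemma psi_at0 : psi.[0] = 0.
Proof. by rewrite horner_coef0. Qed.

Lemma taylor2 x h : psi.[x + h] = psi.[x] + psi^`().[x] * h +
  \sum_(i < size psi) psi^`N(i.+2).[x] * h ^+ i.+2.
Proof.
have sz : (size psi <= (size psi).+2)%N by rewrite -addn2 leq_addr.
rewrite (nderiv_taylor_wide (mulrC x h) sz).
rewrite big_ord_recl big_ord_recl /= nderivn0 nderivn1 expr0 expr1 mulr1 addrA.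
by congr (_ + _); apply: eq_bigr => i _.
Qed.

Lemma nderivn_coef j i : psi^`N(j)`_i = psi`_(j + i) *+ 'C(j + i, j).
Proof. exact: coef_nderivn. Qed.

Lemma taylor_coarse x h : pdvd 0 x -> pdvd s%:Z h ->
  pdvd N%:Z (psi.[x + h] - (psi.[x] + psi^`().[x] * h)).
Proof.
move=> x0 hs; rewrite taylor2 [X in pdvd _ X]addrC addKr.
apply: pdvd_sum => i _.
rewrite -[N%:Z](subrK (i.+2 * s)%N%:Z); apply: pdvdM; last first.
  by have := pdvdX i.+2 hs; rewrite -[_ *+ _]mulr_natr natz mulnC PoszM.
apply: pdvd_horner => // k; rewrite nderivn_coef; apply: coarse => //.
exact: leq_addr.
Qed.

Lemma taylor_fine x h : pdvd 0 x -> pdvd r%:Z h ->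
  pdvd N%:Z (psi.[x + h] - (psi.[x] + psi^`().[x] * h) - psi.[h]).
Proof.
move=> x0 hr; rewrite taylor2 [X in pdvd _ (X - _)]addrC addKr.
have := taylor2 0 h; rewrite add0r psi_at0 deriv_at0 mul0r !add0r => ->.
rewrite -sumrB; apply: pdvd_sum => i _; rewrite -mulrBl.
rewrite -[N%:Z](subrK (i.+2 * r)%N%:Z); apply: pdvdM; last first.
  by have := pdvdX i.+2 hr; rewrite -[_ *+ _]mulr_natr natz mulnC PoszM.
apply: pdvd_horner_sub0 => // k; rewrite nderivn_coef; apply: fine => //.
by rewrite -addSnnS leq_addr.
Qed.

(** The linear coefficient of psi' is a unit and the higher ones are divisible by p, so psi' is a
    p-adic isometry. *)
Lemma deriv_increment x h : pdvd 0 x -> pdvd 0 h ->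
  exists2 v : Zp, v \is a GRing.unit & psi^`().[x + h] - psi^`().[x] = h * tofrac v.
Proof.
move=> x0 h0.
have xh0 : pdvd 0 (x + h) by exact: pdvdD.
have X i y : pdvd 0 y -> pdvd 0 (y ^+ i).
  by move=> y0; have := pdvdX i y0; rewrite mul0rn.
have [w wE] : exists w, psi^`().[x + h] - psi^`().[x] = h * (tofrac u + w) /\ pdvd 1 w.
  pose n := (size psi^`()).
  pose G k := \sum_(i < k) (x + h) ^+ (k.-1 - i) * x ^+ i.
  exists (\sum_(k < n) psi^`()`_k.+2 * G k.+2); split; last first.
    apply: pdvd_sum => k _; apply: pdvdMr; first by rewrite coef_deriv; exact: psi3.
    by apply: pdvd_sum => i _; apply: pdvdMr; exact: X.
  have sn : (n <= n.+2)%N by rewrite -addn2 leq_addr.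
  rewrite !(horner_coef_wide _ sn) -sumrB.
  rewrite big_ord_recl big_ord_recl /= !expr0 subrr add0r expr1 -mulrBr [x + h]addrC addrK.
  rewrite coef_deriv psi2 mulrDr [tofrac u * h]mulrC; congr (_ + _).
  rewrite mulr_sumr; apply: eq_bigr => k _.
  rewrite /bump /= -mulrBr subrXX [h + x]addrC.
  by rewrite [x + h - x]addrAC subrr add0r mulrCA.
case: wE => E [z zE].
exists (u + p%:R * z); first exact: pint_unit_addp.
by rewrite E zE rmorphD rmorphM rmorph_nat.
Qed.

Lemma deriv_localize x y : pdvd 0 x -> pdvd 0 y ->
  pdvd r%:Z (psi^`().[x] - psi^`().[y]) <-> pdvd r%:Z (x - y).
Proof.
move=> x0 y0; have [|v uv] := @deriv_increment y (x - y) y0; first exact: pdvdB.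
rewrite [y + _]addrC subrK => ->; split => [|h]; last by apply: pdvdMr => //; exact: pdvd_tofrac.
move=> h; have v0 := tofrac_unit_neq0 uv.
rewrite -[x - y](mulfK v0); apply: pdvdMr => //.
by rewrite -tofrac_unitV //; exact: pdvd_tofrac.
Qed.

Local Notation ps := (p ^ s)%N.
Local Notation pr := (p ^ r)%N.
Local Notation q := (p ^ N)%N.
Local Notation S t := (\sum_(x < q) E (psi.[x%:R] - t * x%:R)).

Let p_gt0 n : (0 < p ^ n)%N. Proof. by rewrite expn_gt0 prime_gt0. Qed.

Lemma pint_approx_int y k : pdvd 0 y -> exists d : int, pdvd k%:Z (y - d%:~R).
Proof.
move=> [z zE]; exists (z k); rewrite zE expr0z mul1r padic_intr; apply/pdvd_res.
by rewrite pint_res_intr pint_res_mod.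
Qed.

(** Since N = s + r, the terms are the values of a character of Z/p^r, and the sum is the
    orthogonality relation. *)
Lemma phase_block_sum (y : Qp) : pdvd 0 y ->
  \sum_(k < pr) E (y * (p%:R ^+ s * k%:R)) =
  if `[< pdvd r%:Z y >] then pr%:R else 0.
Proof.
move=> y0; have [d yd] := pint_approx_int r y0.
have pp n : p%:R ^+ n != 0 :> Qp by exact: (padic_expz_neq0 hp n%:Z).
have Ek (k : nat) : E (y * (p%:R ^+ s * k%:R)) = expi (k%:R * (d%:~R / pr%:R) : R).
  have -> : k%:R * (d%:~R / pr%:R) = (k%:Z * d)%:~R / p%:R ^+ r :> R.
    by rewrite intrM natrX mulrA.
  rewrite -(expi_padic_frac R hp); apply: expi_padic_eq.
  have -> : y * (p%:R ^+ s * k%:R) / p%:R ^+ N - (k%:Z * d)%:~R / p%:R ^+ r =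
      k%:R * ((y - d%:~R) / p%:R ^+ r).
    by rewrite sr exprD intrM; exact: (frac_block _ _ _ (pp s) (pp r)).
  apply: pdvdMl; first exact: pdvd_nat.
  rewrite mulrC exprnN -(addrN r%:Z); apply/pdvd_mul_expz.
  by [].
rewrite (eq_bigr (fun k : 'I_pr => expi (k%:R * (d%:~R / pr%:R)))); last by move=> k _; exact: Ek.
rewrite (sum_expi_mod R (p_gt0 r)).
have -> : `[< pdvd r%:Z y >] = ((pr : nat)%:Z %| d)%Z.
  have -> : (pr : nat)%:Z = p%:Z ^+ r by rewrite -[LHS]natz natrX natz.
  apply/asboolP/idP => [yr|dr].
    apply/(pdvd_int_dvd hp); rewrite -[d%:~R](subrK y) addrC -[_ - _]opprB.
    by apply: pdvdB.
  rewrite -[y](subrK d%:~R); apply: pdvdD => //; exact/(pdvd_int_dvd hp).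
by [].
Qed.

Definition near_critical (t : Qp) (z : int) : R[i] :=
  if `[< pdvd r%:Z (psi^`().[z%:~R] - t) >] then E (psi.[z%:~R] - t * z%:~R) else 0.

(** With x = x0 + p^s k the coarse expansion makes the phase linear in k, so the sum over k vanishes
    unless psi'(x0) = t modulo p^r. *)
Lemma phase_localize t : pdvd 0 t ->
  S t = pr%:R * \sum_(x < ps) near_critical t x%:Z.
Proof.
move=> t0; have -> : q = (pr * ps)%N by rewrite sr expnD mulnC.
rewrite -(@sum_ord_blocks _ ps (fun x : nat => E (psi.[x%:R] - t * x%:R))).
rewrite exchange_big mulr_sumr; apply: eq_bigr => x _ /=.
have xd : pdvd 0 (x%:R : Qp) by exact: pdvd_nat.
have d0 : pdvd 0 (psi^`().[x%:R] - t) by apply: pdvdB => //; exact: deriv_pdvd.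
have blk (k : nat) : E (psi.[(k * ps + x)%N%:R] - t * (k * ps + x)%N%:R) =
    E (psi.[x%:R] - t * x%:R) * E ((psi^`().[x%:R] - t) * (p%:R ^+ s * k%:R)).
  rewrite -phaseD; apply: phase_eq; rewrite natrD natrM natrX [k%:R * _]mulrC [_ * k%:R + _]addrC.
  have hs : pdvd s%:Z (p%:R ^+ s * k%:R : Qp).
    by apply: pdvdMr; [exact: pdvd_expz | exact: pdvd_nat].
  move: (taylor_coarse xd hs); congr (pdvd _ _).
  exact: shift_phase1.
under eq_bigr do rewrite blk.
by rewrite -mulr_sumr phase_block_sum // /near_critical; case: ifP; rewrite ?mulr0 // mulrC.
Qed.

(** Allows the sum over residues modulo p^s to be recentred at the critical point. A shift by p^s
    changes the phase by (psi' - t) p^s, which is divisible by p^(r+s). *)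
Lemma near_critical_periodic t (z : int) : near_critical t (z + ps%:Z) = near_critical t z.
Proof.
rewrite /near_critical.
have zd : pdvd 0 (z%:~R : Qp) by exact: pdvd_int.
have hs : pdvd s%:Z (ps%:R : Qp) by exact: pdvd_nat_dvd.
have hr : pdvd r%:Z (ps%:R : Qp) by apply: pdvd_le hs; rewrite lez_nat.
have d : pdvd r%:Z (psi^`().[(z + ps%:Z)%:~R] - psi^`().[z%:~R]).
  by apply/deriv_localize; rewrite ?intrD 1?addrAC ?subrr ?add0r // -intrD; exact: pdvd_int.
have -> : `[< pdvd r%:Z (psi^`().[(z + ps%:Z)%:~R] - t) >] =
    `[< pdvd r%:Z (psi^`().[z%:~R] - t) >].
  apply/asboolP/asboolP => h; last by rewrite -(subrKA psi^`().[z%:~R]); exact: pdvdD.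
  by rewrite -(subrKA psi^`().[(z + ps%:Z)%:~R]); apply: pdvdD => //; exact: pdvdBC.
case: asboolP => // h; apply: phase_eq.
have := pdvdM h hs; rewrite -PoszD addnC -sr => hN.
rewrite intrD; move: (pdvdD (taylor_coarse zd hs) hN); congr (pdvd _ _).
exact: shift_phase2.
Qed.

(** [X] may be replaced by an integer d. By isometry the surviving points are d + z with p^r
    dividing z, and the fine expansion at d gives psi(d+z) - t(d+z) = psi(d) - td + psi(z) modulo
    p^N: the sum over z is the localized sum at t = 0. *)
Lemma critical_value t X : pdvd 0 t -> pdvd 0 X -> pdvd N%:Z (psi^`().[X] - t) ->
  S t = E (psi.[X] - t * X) * S 0.
Proof.
move=> t0 X0 Xt; have [d Xd] := pint_approx_int N X0.
have dX : pdvd 0 (d%:~R : Qp) by exact: pdvd_int.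
have hd : pdvd N%:Z (d%:~R - X) by exact: pdvdBC.
have hd0 : pdvd 0 (d%:~R - X) by apply: pdvd_le hd.
have hds : pdvd s%:Z (d%:~R - X) by apply: pdvd_le hd; rewrite lez_nat sr leq_addr.
have hNr (x : Qp) : pdvd N%:Z x -> pdvd r%:Z x.
  by apply: pdvd_le; rewrite lez_nat sr leq_addl.
have dt : pdvd N%:Z (psi^`().[d%:~R] - t).
  have [v uv] := deriv_increment X0 hd0; rewrite [X + _]addrC subrK => dE.
  rewrite -(subrKA psi^`().[X]) dE; apply: pdvdD => //.
  by apply: pdvdMr => //; exact: pdvd_tofrac.
have -> : E (psi.[X] - t * X) = E (psi.[d%:~R] - t * d%:~R).
  apply/esym/phase_eq.
  have := taylor_coarse X0 hds; rewrite [X + _]addrC subrK => ht.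
  have hX := pdvdMr Xt hd0.
  move: (pdvdD ht hX); congr (pdvd _ _).
  exact: shift_phase3.
rewrite !phase_localize //; last exact: pdvd0.
rewrite mulrCA; congr (_ * _).
rewrite -(periodic_sum_shift (p_gt0 s) d (near_critical_periodic t)) mulr_sumr.
apply: eq_bigr => x _; rewrite /near_critical.
set z := x%:Z; have zd : pdvd 0 (z%:~R : Qp) by exact: pdvd_int.
have zdd : pdvd 0 ((z + d)%:~R : Qp) by exact: pdvd_int.
have -> : `[< pdvd r%:Z (psi^`().[(z + d)%:~R] - t) >] = `[< pdvd r%:Z (psi^`().[z%:~R] - 0) >].
  have e1 : pdvd r%:Z (psi^`().[(z + d)%:~R] - psi^`().[d%:~R]) <-> pdvd r%:Z (z%:~R : Qp).
    have -> : z%:~R = (z + d)%:~R - d%:~R :> Qp by rewrite intrD addrK.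
    exact: deriv_localize.
  have e2 : pdvd r%:Z (psi^`().[z%:~R] - 0) <-> pdvd r%:Z (z%:~R : Qp).
    by have := deriv_localize zd (pdvd0 hp 0); rewrite deriv_at0 [z%:~R - 0]subr0.
  have e3 := hNr _ dt.
  apply/asboolP/asboolP => h.
    by apply/e2/e1; rewrite -(subrKA t); apply: pdvdD => //; exact: pdvdBC.
  by rewrite -(subrKA psi^`().[d%:~R]); apply: pdvdD => //; apply/e1/e2.
case: asboolP => h; last by rewrite mulr0.
rewrite -phaseD mul0r subr0; apply: phase_eq.
have zr : pdvd r%:Z (z%:~R : Qp).
  have /(_ zd (pdvd0 hp 0)) := @deriv_localize z%:~R 0.
  by rewrite deriv_at0 !subr0 => <-; move: h; rewrite subr0.
have ht := taylor_fine dX zr.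
have hz := pdvdMr dt zd.
rewrite intrD [z%:~R + _]addrC; move: (pdvdD ht hz); congr (pdvd _ _).
exact: shift_phase4.
Qed.

Local Notation phase := (fun m : int => E psi.[m%:~R]).

Lemma phase_periodic (m : int) : phase (m + q%:Z) = phase m.
Proof.
have md : pdvd 0 (m%:~R : Qp) by exact: pdvd_int.
have qN : pdvd N%:Z (q%:R : Qp) by exact: pdvd_nat_dvd.
have qs : pdvd s%:Z (q%:R : Qp) by apply: pdvd_le qN; rewrite lez_nat sr leq_addr.
apply: phase_eq; rewrite intrD.
have := pdvdD (taylor_coarse md qs) (pdvdMl (deriv_pdvd md) qN).
by rewrite opprD addrA subrK.
Qed.

Lemma dft_phase t : dft q phase t = q%:R^-1 * S t%:~R.
Proof.
congr (_ * _); apply: eq_bigr => x _.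
rewrite -[x%:Z%:~R]/(x%:R) phaseD; congr (_ * _).
have -> : - (t%:~R * (x%:R / q%:R)) = (- t * x%:Z)%:~R / p%:R ^+ N :> R.
  by rewrite intrM intrN natrX mulrA !mulNr.
by rewrite -(expi_padic_frac R hp) intrM intrN mulNr.
Qed.

Lemma stationary_phase (X : int -> Qp) :
  (forall t, pdvd 0 (X t)) -> (forall t, pdvd N%:Z (psi^`().[X t] - t%:~R)) ->
  exists2 eps : R[i], `|eps| = 1 & forall t : int,
    dft q phase t = eps / real_complex R (Num.sqrt q%:R) * E (psi.[X t] - t%:~R * X t).
Proof.
move=> X0 Xt.
have St (t : int) : S t%:~R = E (psi.[X t] - t%:~R * X t) * S 0.
  exact: (critical_value (pdvd_int hp t) (X0 t) (Xt t)).
pose c := real_complex R (Num.sqrt q%:R).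
have cc : c * c = q%:R.
  by rewrite -rmorphM /= -expr2 sqr_sqrtr ?ler0n // rmorph_nat.
have q0 : q%:R != 0 :> R[i] by rewrite pnatr_eq0 -lt0n.
have c0 : c != 0 by apply: contraNneq q0 => c0; rewrite -cc c0 mul0r.
(* All complete sums have the same absolute value, so Parseval's identity determines it. *)
have S0 : `|S 0| ^+ 2 = q%:R.
  have := dft_parseval (p_gt0 N) (fun k => norm_expi_padic R (psi.[k%:~R] / p%:R ^+ N)).
  rewrite (eq_bigr (fun=> `|q%:R^-1 * S 0| ^+ 2)) => [|t _]; last first.
    by rewrite dft_phase St !normrM norm_expi_padic mul1r.
  rewrite sumr_const card_ord normrM normfV normr_nat exprMn.
  rewrite -[X in X = 1 -> _]mulr_natl; move: (`|_| ^+ 2) (q%:R) q0 => n2 z z0 hz.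
  by rewrite -[RHS]mulr1 -hz exprVn; field.
exists (S 0 / c) => [|t].
  apply/eqP; rewrite -(@sqrp_eq1 _ `|S 0 / c|) // normf_div expr_div_n S0.
  by rewrite -normrX expr2 cc normr_nat divff.
rewrite dft_phase St -cc -/c; move: (E _) (S 0) => a b; field.
exact: c0.
Qed.

End StationaryPhase.

(** * Bounds on factorials and binomial coefficients *)

Section LogarithmBounds.
Local Open Scope nat_scope.

Lemma logn_pfactor p k : prime p -> 0 < k -> exists2 c, 0 < c & k = c * p ^ logn p k.
Proof.
move=> hp k0; have [c cE] := dvdnP (pfactor_dvdnn p k).
by exists c => //; move: k0; rewrite {1}cE muln_gt0 => /andP[].
Qed.

(** Integration costs the valuation of k, which slope 1/(p-1) repays for each k > 2 except k = p;
    there p divides the binomial coefficients instead. *)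
Lemma logn_bound_odd p k : prime p -> 2 < p -> 2 < k -> k != p ->
  p.-1 * logn p k < k - 2.
Proof.
move=> hp p2 k2 kp; have [|c c0] := @logn_pfactor p k hp; first by lia.
case: (logn p k) => [|[|l]] kE; first by lia.
  move: c0 kE kp; case: c => [|[|c]] // _; rewrite expn1 => kE; first by rewrite kE mul1n eqxx.
  by nia.
have hl : p.-1 * l.+2 + 2 < p ^ l.+2.
  elim: l {kE} => [|l IH]; first by rewrite expnS expn1; nia.
  by rewrite expnS; move: IH; set a := p ^ _; nia.
have : p ^ l.+2 <= k by rewrite kE leq_pmull.
by move: hl; set a := p ^ _; lia.
Qed.

(** The stronger bound fails at k = 4, where the even number C(4,2) = 6 makes up for it. *)
Lemma logn_bound_2 k : 2 < k -> (logn 2 k + 1 < k) && ((k != 4) ==> (logn 2 k + 2 < k)).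
Proof.
move=> k2; have [|c c0] := @logn_pfactor 2 k isT; first by lia.
case: (logn 2 k) => [|[|[|l]]] kE; [by lia | by lia | by lia |].
have hl : l.+3 + 5 <= 2 ^ l.+3.
  by elim: l {kE} => [//|l IH]; rewrite expnS; move: IH; set a := 2 ^ _; lia.
have : 2 ^ l.+3 <= k by rewrite kE leq_pmull.
by move: hl; set a := 2 ^ _; lia.
Qed.

(** With l the valuation of k and C + 1 >= 1/eps, one has k >= p^l >= (l-C-1)(C+1) as soon as l > C
    + 1. *)
Lemma logn_le_linear (R : realType) p (eps : R) : prime p -> (0 < eps)%R ->
  exists C : nat, forall k, 0 < k -> ((logn p k)%:R <= C%:R + eps * k%:R)%R.
Proof.
move=> hp e0; pose C := Num.truncn (eps^-1)%R; exists C.+1 => k k0.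
have p1 := prime_gt1 hp.
set l := logn p k; have plk : p ^ l <= k by apply: dvdn_leq => //; exact: pfactor_dvdnn.
have [lC|Cl] := leqP l C.+1.
  by apply: (@le_trans _ _ C.+1%:R)%R; rewrite ?ler_nat // lerDl mulr_ge0 // ltW.
have h n : n * C.+1 <= p ^ (n + C.+1).
  have h1 m : m < p ^ m by exact: ltn_expl.
  by rewrite expnD leq_mul // ltnW.
have := h (l - C.+1); rewrite subnK ?(ltnW Cl) // => hl.
have {}hl : ((l - C.+1)%:R * C.+1%:R <= k%:R :> R)%R.
  by rewrite -natrM ler_nat (leq_trans hl).
have C1 : (eps^-1 <= C.+1%:R)%R.
  by rewrite ltW // truncnS_gt.
rewrite -lerBlDl -natrB ?(ltnW Cl) //.
apply: (@le_trans _ _ (eps * ((l - C.+1)%:R * C.+1%:R)))%R; last by rewrite ler_wpM2l // ltW.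
rewrite mulrCA ler_peMr // -[X in (X <= _)%R](mulfV (lt0r_neq0 e0)).
by rewrite ler_wpM2l // ltW.
Qed.

End LogarithmBounds.

Section PhaseBounds.
Variables (p : nat) (hp : prime p).
Local Notation Qp := (padic hp).
Variable b : nat -> Qp.
(** Slope 1/(p-1) in terms of natural numbers: ord b_(k+1) >= ceil(k/(p-1)). For p = 2 this means
    ord b_k >= k - 1, and [hb2] asks for one more. *)
Hypothesis hb : forall k l, (l * p.-1 < k)%N -> pdvd l.+1%:Z (b k.+1).
Hypothesis hb0 : forall k, pdvd 0 (b k).
Hypothesis hb2 : p = 2%N -> forall k, (1 < k)%N -> pdvd k%:Z (b k).

Local Notation psi M := (\poly_(k < M.+1) (if k is k'.+1 then b k' / k%:R else 0)).

Lemma coef_psi v M k : pdvd (v + (logn p k)%:Z) (b k.-1) -> pdvd v (psi M)`_k.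
Proof.
move=> h; rewrite coef_poly; case: ifP => _; last exact: pdvd0.
case: k h => [|k] h; first exact: pdvd0.
by have := pdvd_div_nat (ltn0Sn k) h; rewrite addrK.
Qed.

Lemma pdvd_mulrn v w (x : Qp) n : pdvd v x -> pdvd w (n%:R : Qp) -> pdvd (v + w) (x *+ n).
Proof. by move=> hx hn; rewrite -mulr_natr; exact: pdvdM. Qed.

Lemma pdvd_mulrn0 v (x : Qp) n : pdvd v x -> pdvd v (x *+ n).
Proof. by move=> hx; rewrite -mulr_natr; apply: pdvdMr => //; exact: pdvd_nat. Qed.

(** For odd p, s and r are the two halves of N. For p = 2 the coefficient psi_2 = b_1/2 may have
    valuation -1, so s = floor(N/2) + 1; then N > 2 keeps r positive, which the orders j >= 3
    require. *)
Lemma phase_bounds M N : (p = 2%N -> (2 < N)%N) -> exists s r, [/\ N = (s + r)%N, (r <= s)%N,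
  forall k j, (1 < j)%N -> (j <= k)%N -> pdvd (N%:Z - (j * s)%N%:Z) ((psi M)`_k *+ 'C(k, j)) &
  forall k j, (1 < j)%N -> (j < k)%N -> pdvd (N%:Z - (j * r)%N%:Z) ((psi M)`_k *+ 'C(k, j))].
Proof.
move=> hN; have [p2|np2] := eqVneq p 2%N.
  exists (N./2).+1, (N - N./2.+1)%N.
  have N2 := hN p2; have hh : (N = N./2 + N./2 + odd N)%N by rewrite -{1}(odd_double_half N) -addnn addnC.
  have k2 k : (2 < k)%N -> pdvd (k.-1%:Z - (logn p k)%:Z) (psi M)`_k.
    by move=> k2; apply: coef_psi; rewrite subrK; apply: hb2 => //; lia.
  split; [by case: (odd N) hh; lia | by case: (odd N) hh; lia | |].
    move=> k j j1 jk; apply: pdvd_mulrn0.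
    have [k2'|->] : (2 < k)%N \/ k = 2%N by lia.
      have /andP[l1 _] := logn_bound_2 k2'.
      apply: pdvd_le (k2 _ k2'); rewrite p2.
      by case: (odd N) hh; nia.
    apply: coef_psi; apply: pdvd_le (hb0 _).
    have -> : logn p 2 = 1%N by rewrite p2.
    by case: (odd N) hh; nia.
  move=> k j j1 jk.
  have k2' : (2 < k)%N by lia.
  have /andP[l1 l2] := logn_bound_2 k2'.
  have [j3|j3] : (2 < j)%N \/ j = 2%N by lia.
    apply: pdvd_mulrn0; apply: pdvd_le (k2 _ k2'); rewrite p2.
    by case: (odd N) hh; nia.
  (* The exceptional index of [logn_bound_2]: the missing factor 2 comes from C(4,2) = 6. *)
  have [k4|k4] := eqVneq k 4%N.
    have h6 : pdvd 1 (6%:R : Qp) by apply: (@pdvd_nat_dvd _ _ 1); rewrite p2.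
    have -> : 'C(k, j) = 6%N by rewrite k4 j3.
    apply: pdvd_le (pdvd_mulrn (k2 _ k2') h6); rewrite p2 k4 j3 /=.
    have -> : logn 2 4 = 2%N by [].
    by case: (odd N) hh; lia.
  apply: pdvd_mulrn0; apply: pdvd_le (k2 _ k2'); rewrite p2 j3.
  by move: l2; rewrite k4 /=; case: (odd N) hh; lia.
have p2 : (2 < p)%N by have := prime_gt1 hp; lia.
exists (uphalf N), N./2.
have hh : (N = N./2 + N./2 + odd N)%N by rewrite -{1}(odd_double_half N) -addnn addnC.
have hu : uphalf N = (odd N + N./2)%N by rewrite uphalf_half.
have lp : logn p p = 1%N by rewrite logn_prime // eqxx.
have kbig k : (2 < k)%N -> k != p -> pdvd 1 (psi M)`_k.
  move=> k2 kp; apply: coef_psi.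
  have := logn_bound_odd hp p2 k2 kp.
  case: k k2 {kp} => [|[|k]] // _ h; rewrite -PoszD add1n; apply: hb.
  by rewrite mulnC; move: h; rewrite subn2.
have kge0 k : (1 < k)%N -> pdvd 0 (psi M)`_k.
  have [->|kp] := eqVneq k p => k1.
    apply: coef_psi; rewrite add0r lp.
    have -> : p.-1 = (p.-2).+1 by lia.
    by apply: hb; lia.
  have [k2|->] : (2 < k)%N \/ k = 2%N by lia.
    by apply: pdvd_le (kbig _ k2 kp).
  apply: coef_psi; rewrite add0r lognE /=.
  by case: ifP => [/andP[_ /(@dvdn_leq p 2 isT)]|_]; [lia | exact: hb0].
split; [by rewrite hu; lia | by rewrite hu; lia | |] => k j j1 jk.
  apply: pdvd_mulrn0; apply: pdvd_le (kge0 _ _); last by lia.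
  by rewrite hu; case: (odd N) hh; nia.
have hle : N%:Z - (j * N./2)%N%:Z <= 1 by case: (odd N) hh; nia.
apply: pdvd_le hle _; have [kp|kp] := eqVneq k p; last first.
  by apply: pdvd_mulrn0; apply: kbig => //; lia.
(* At k = p the coefficient of psi is merely integral, and the factor p comes from C(p,j) with 0 < j
   < p. *)
rewrite -[1]add0r; apply: pdvd_mulrn; first by apply: kge0; lia.
by apply: (@pdvd_nat_dvd _ _ 1); rewrite kp expn1 prime_dvd_bin // -?kp; lia.
Qed.

End PhaseBounds.

Lemma logn_fact_le p k : prime p -> (0 < k)%N -> (p.-1 * logn p k`! <= k.-1)%N.
Proof.
move=> hp k0; have p1 := prime_gt1 hp; rewrite logn_fact //.
(* Legendre's formula in telescoped form: each further quotient is paid for by the drop of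
   floor(k/p^m). The maximum with 1 records that the last nonzero quotient is at least 1, whence the
   bound k - 1. *)
have h m : (p.-1 * \sum_(1 <= i < m.+1) k %/ p ^ i + maxn 1 (k %/ p ^ m) <= k)%N.
  elim: m => [|m IH]; first by rewrite big_geq // muln0 add0n expn0 divn1; lia.
  rewrite big_nat_recr //= expnSr divnMA mulnDr.
  set a := (k %/ p ^ m)%N in IH *; have := leq_divM a p.
  move: IH; move: (a %/ p)%N (\sum_(_ <= _ < _) _)%N => [|b] S IH hb; first by lia.
  by have : (p.-1 * b.+1 + b.+1 = b.+1 * p)%N; nia.
by have := h k; lia.
Qed.

Lemma binomial_step (F : fieldType) (m n a d c e : F) : m != 0 -> n != 0 ->
  m * (a * d / (m * n) * (c * e)) = c * d * (a / n * e).
Proof. by move=> m0 n0; field; rewrite m0 n0. Qed.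

Section PadicBinomial.
Variables (p : nat) (hp : prime p).
Local Notation Zp := (pint hp).
Local Notation Qp := (padic hp).
Local Notation tofrac := (@FracField.tofrac Zp).

Definition padic_filtration : filtration Qp :=
  Filtration (@pdvd0 p hp) (@pdvdD p hp) (@pdvdN p hp) (@pdvdM p hp)
    (@pdvd_le p hp) (pdvd1 hp).

Lemma ratr_nat (n : nat) : ratr n%:R = n%:R :> Qp.
Proof. by rewrite -[n%:R]/(n%:Z%:~R) ratr_int. Qed.

Lemma ratr_prod_shift (y : rat) k :
  ratr (\prod_(i < k) (y - i%:R)) = \prod_(i < k) (ratr y - i%:R) :> Qp.
Proof.
elim: k => [|k IH]; first by rewrite !big_ord0 -[1]/(1%:R) ratr_nat.
by rewrite !big_ord_recr /= padic_ratrM IH padic_ratrD padic_ratrN ratr_nat.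
Qed.

Lemma psbinomE (y : rat) (c : Qp) k :
  psbinom y c k = (\prod_(i < k) (ratr y - i%:R)) / k`!%:R * c ^+ k.
Proof. by rewrite /psbinom padic_ratrM padic_ratrV ratr_prod_shift ratr_nat. Qed.

Lemma psbinom0 (y : rat) (c : Qp) : psbinom y c 0 = 1.
Proof. by rewrite psbinomE big_ord0 expr0 mulr1 fact0 divr1. Qed.

Lemma psbinomS (y : rat) (c : Qp) k :
  k.+1%:R * psbinom y c k.+1 = c * (ratr y - k%:R) * psbinom y c k.
Proof.
rewrite !psbinomE big_ord_recr factS natrM exprS /=.
have h1 : k.+1%:R != 0 :> Qp by exact: padic_nat_neq0.
have h2 : k`!%:R != 0 :> Qp by rewrite padic_nat_neq0 ?fact_gt0.
exact: binomial_step.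
Qed.

Lemma prod_shift_ffact m k : \prod_(i < k) (m%:R - i%:R) = (m ^_ k)%:R :> Qp.
Proof.
elim: k => [|k IH]; first by rewrite big_ord0 ffactn0.
rewrite big_ord_recr /= IH ffactnSr natrM; have [mk|km] := ltnP m k.
  by rewrite ffact_small // !mul0r.
by rewrite natrB.
Qed.

(** Density of the natural numbers in Z_p: replacing z by m with z = m modulo p^v, where v is the
    valuation of k!, alters the numerator by a multiple of p^v, and C(m,k) is an integer. *)
Lemma pdvd_binomial_int (z : Zp) k :
  pdvd 0 (\prod_(i < k) (tofrac z - i%:R) / k`!%:R).
Proof.
set v := logn p k`!; pose m := `|z v|%N.
have zm : pdvd v%:Z (tofrac z - m%:R).
  rewrite -[m%:R]/(m%:Z%:~R) padic_intr; apply/pdvd_res.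
  rewrite pint_res_intr /m gez0_abs ?pint_res_mod //.
  by rewrite -pint_res_mod modz_ge0 // pint_exp_neq0.
have diff j : pdvd v%:Z (\prod_(i < j) (tofrac z - i%:R) - \prod_(i < j) (m%:R - i%:R)).
  have zi i : pdvd 0 (tofrac z - i%:R : Qp).
    by apply: pdvdB; [exact: pdvd_tofrac | exact: pdvd_nat].
  elim: j => [|j IH]; first by rewrite !big_ord0 subrr; exact: pdvd0.
  rewrite !big_ord_recr /= -(subrKA ((\prod_(i < j) (m%:R - i%:R)) * (tofrac z - j%:R))).
  rewrite -mulrBl -mulrBr; apply: pdvdD; first exact: pdvdMr IH (zi j).
  apply: pdvdMl; first by rewrite prod_shift_ffact; exact: pdvd_nat.
  by rewrite opprB addrA subrK.
rewrite -[X in X / _](subrK (\prod_(i < k) (m%:R - i%:R))) mulrDl; apply: pdvdD.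
  by have := pdvd_div_nat (fact_gt0 k) (diff k); rewrite subrr.
rewrite prod_shift_ffact -bin_ffact natrM mulfK; first exact: pdvd_nat.
by rewrite padic_nat_neq0 ?fact_gt0.
Qed.

(** If ord y = 0 this is an integral binomial coefficient. Otherwise the factor i = 0 has valuation
    ord y = iota' - iota, each other factor has valuation at least -iota, and k! is lost in the
    denominator. *)
Lemma pdvd_psbinom (y : rat) k : y != 0 -> (0 < k)%N ->
  pdvd (iotap' p y - iotap p y *+ k - (if ordq p y == 0 then 0 else logn p k`!)%:Z)
    (\prod_(i < k) (ratr (- y) - i%:R) / k`!%:R : Qp).
Proof.
move=> y0 k0; have [u uu yE] := padic_ratr_unit hp y0; rewrite padic_ratrN yE.
rewrite /iotap /iotap'; case: eqVneq => [v0|v0].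
  rewrite v0 expr0z mul1r oppr0 maxxx mul0rn subr0 -rmorphN; exact: pdvd_binomial_int.
set v := ordq p y in v0 yE *; apply: pdvd_div_nat; first exact: fact_gt0.
case: k k0 => // k _; rewrite big_ord_recl subr0 /=.
have vE : Num.max 0 v = v + Num.max 0 (- v) by lia.
rewrite mulrS opprD addrA vE addrK; apply: pdvdM.
  by rewrite -mulrN -rmorphN; exists (- u).
elim: k => [|k IH]; first by rewrite big_ord0 mulr0n oppr0; exact: pdvd1.
rewrite big_ord_recr mulrSr opprD; apply: pdvdM => //; apply: pdvdB.
  by apply: (@pdvd_le _ _ v); [lia | rewrite -mulrN -rmorphN; exists (- u)].
by apply: pdvd_le (pdvd_nat hp _); lia.
Qed.

End PadicBinomial.

Section PadicSlopes.
Variables (R : realType) (p : nat) (hp : prime p).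
Local Notation Zp := (pint hp).
Local Notation Qp := (padic hp).
Local Notation tofrac := (@FracField.tofrac Zp).
Local Notation rd := (@rdvd R Qp (padic_filtration hp)).
Local Notation P v := (p%:R ^ v : Qp).

Lemma rdvd_pdvd (r : R) (v : int) (x : Qp) : r <= v%:~R -> pdvd v x -> rd r x.
Proof. by move=> rv; apply: pdvd_le; rewrite ceil_le_int. Qed.

Lemma pdvd_rdvd (r : R) (v : int) (x : Qp) : (v - 1)%:~R < r -> rd r x -> pdvd v x.
Proof. by rewrite -ceil_gt_int => rv h; apply: (pdvd_le _ (h : pdvd (Num.ceil r) x)); rewrite -ltzD1 -ltrBlDr. Qed.

Lemma padic_expzD v v' : P (v + v') = P v * P v'.
Proof. by rewrite expfzDr // padic_natp_neq0. Qed.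

Lemma padic_expz_cancel v : P v * P (- v) = 1.
Proof. by rewrite -padic_expzD subrr. Qed.

(** A positive slope outweighs the division by k + 1 from integration: half of mu absorbs the
    logarithmic loss, the other half yields p^v. All truncation errors of primitives are controlled
    in this way. *)
Lemma slope_log_cvg (mu : R) : 0 < mu -> forall v : nat, exists K, forall k (x : Qp),
  (K <= k)%N -> rd ((k%:R - 1) * mu) x -> pdvd v%:Z (x / k.+1%:R).
Proof.
move=> mu0 v; have mu2 : 0 < mu / 2 by rewrite divr_gt0.
have [C hC] := logn_le_linear hp mu2.
exists (Num.truncn ((v + C)%:R * 2 / mu + 3)).+1 => k x kK hx.
have {kK} : (v + C)%:R * 2 / mu + 3 <= k%:R.
  by apply/ltW/(lt_le_trans (truncnS_gt _)); rewrite ler_nat.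
rewrite -lerBrDr ler_pdivrMr // => hk.
have L := hC k.+1 isT.
apply: pdvd_le (pdvd_div_nat (ltn0Sn k) hx).
rewrite -(ler_int R) intrB.
have := ceil_ge ((k%:R - 1) * mu).
rewrite -[v%:Z%:~R]/(v%:R) -[(logn p k.+1)%:Z%:~R]/((logn p k.+1)%:R).
by move: L hk; rewrite -(natr1 k) (natrD _ v C); lra.
Qed.

Lemma slope_cvg (mu : R) (x : nat -> Qp) : 0 < mu ->
  (forall k, rd (k%:R * mu) (x k)) ->
  forall v : nat, exists K, forall k, (K <= k)%N -> pdvd v%:Z (x k).
Proof.
move=> mu0 hx v; exists (Num.truncn (v%:R / mu)).+1 => k kK.
have {kK} : v%:R / mu <= k%:R.
  by apply/ltW/(lt_le_trans (truncnS_gt _)); rewrite ler_nat.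
rewrite ler_pdivrMr // => hk; apply: pdvd_le (hx k).
by rewrite -(ler_int R); apply: le_trans (ceil_ge _).
Qed.

Lemma pseval_trunc (f : nat -> Qp) v K :
  (forall m : nat, exists n0, forall k, (n0 <= k)%N -> pdvd m%:Z (f k)) ->
  (forall k, (K <= k)%N -> pdvd v%:Z (f k)) ->
  forall n x, (K <= n)%N -> pdvd 0 x ->
    pdvd v%:Z (pseval f x - \sum_(k < n) f k * x ^+ k).
Proof.
move=> fcvg fK n x Kn x0.
have x0X k : pdvd 0 (x ^+ k) by have := pdvdX k x0; rewrite mul0rn.
have fcvgX (m : nat) : exists n0, forall k, (n0 <= k)%N -> pdvd m%:Z (f k * x ^+ k).
  by have [n0 h] := fcvg m; exists n0 => k nk; apply: pdvdMr => //; exact: h.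
have [n1 h1] := pseval_partial fcvgX v.
rewrite -(subrKA (\sum_(k < n + n1) f k * x ^+ k)); apply: pdvdD; first by apply: h1; exact: leq_addl.
rewrite big_split_ord /= addrAC subrr add0r; apply: pdvd_sum => k _; apply: pdvdMr => //.
by apply: fK; rewrite (leq_trans Kn) ?leq_addr.
Qed.

(** All but finitely many coefficients are integral, so one power of p clears the denominators of
    all. *)
Lemma psI0_scaled (x : nat -> Qp) :
  (forall v : nat, exists K, forall k, (K <= k)%N -> pdvd v%:Z (x k)) ->
  exists c a, [/\ c != 0, psI0 a & forall k, x k = c * tofrac (a k)].
Proof.
move=> hx; have [K hK] := hx 0%N.
have [M hM] : exists M : nat, forall k, pdvd (- M%:Z) (x k).
  have low k : exists m : nat, pdvd (- m%:Z) (x k).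
    have [->|xk0] := eqVneq (x k) 0; first by exists 0%N; exact: pdvd0.
    have [v [z [_ ->]]] := padic_decomp xk0; exists `|v|%N.
    by apply: (@pdvd_le _ _ v); [lia | exists z].
  suff [M hM] : exists M : nat, forall k, (k < K)%N -> pdvd (- M%:Z) (x k).
    exists M => k; have [kK|Kk] := ltnP k K; first exact: hM.
    by apply: pdvd_le (hK k Kk); lia.
  elim: (K) => [|K' [M hM]]; first by exists 0%N.
  have [m hm] := low K'; exists (maxn M m) => k; rewrite ltnS leq_eqVlt => /predU1P[->|kK].
    by apply: pdvd_le hm; lia.
  by apply: pdvd_le (hM k kK); lia.
have [a ha] := choice hM.
exists (P (- M%:Z)), a; split=> //; first exact: padic_expz_neq0.
apply/padic_cvgP => v; have [n0 h0] := hx v.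
exists n0 => n n0n; rewrite subr0.
have -> : tofrac (a n) = P M%:Z * x n by rewrite ha mulrA padic_expz_cancel mul1r.
by apply: pdvdMl; [exact: pdvd_le (pdvd_expz hp M%:Z) | exact: h0].
Qed.

End PadicSlopes.

Lemma ordq_int (p n : nat) : (0 < n)%N -> ordq p n%:R = (logn p n)%:Z.
Proof. by move=> n0; rewrite /ordq -[n%:R]/(n%:Z%:~R) numq_int denq_int /= logn1 subr0. Qed.

Lemma ordqV p y : ordq p y^-1 = - ordq p y.
Proof.
rewrite /ordq; have [->|y0] := eqVneq y 0; first by rewrite invr0 /= logn1 logn0.
have yE : y^-1 = (denq y)%:~R / (numq y)%:~R by rewrite -{1}(divq_num_den y) invf_div.
have cop : coprime `|denq y| `|numq y| by rewrite coprime_sym coprime_num_den.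
have n0 : numq y != 0 by rewrite numq_eq0.
rewrite {1 2}yE (coprimeq_num cop) (coprimeq_den cop) (negbTE n0) opprB abszM absz_sg n0 mul1n.
by first [rewrite absz_id | rewrite -abszE].
Qed.

Lemma iota_sub p y : iotap' p y - iotap p y = ordq p y.
Proof. by rewrite /iotap /iotap'; lia. Qed.

Lemma field_cancel3 (F : fieldType) (a b c d e : F) : a != 0 -> b != 0 ->
  b * c * (a * d) * ((b * a)^-1 * e) = c * d * e.
Proof. by move=> a0 b0; field; rewrite a0 b0. Qed.

(** * The binomial main term and its inverse series *)

Section MainTerm.
Variables (R : realType) (p : nat) (hp : prime p).
Local Notation Zp := (pint hp).
Local Notation Qp := (padic hp).
Local Notation tofrac := (@FracField.tofrac Zp).
Local Notation rd := (@rdvd R Qp (padic_filtration hp)).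
Local Notation P v := (p%:R ^ v : Qp).
Variables (kappa : nat) (y : rat) (omega omega' : Zp).
Hypotheses (y0 : 0 < y) (uo : omega \is a GRing.unit) (uo' : omega' \is a GRing.unit).

Local Notation iota := (iotap p y).
Local Notation iota' := (iotap' p y).

(** The two parameters are tied by (1 + alpha x)^(-y) = 1 + beta t, equivalently (1 + beta t)^(-1/y)
    = 1 + alpha x. Passing to the inverse exchanges y with 1/y and iota with iota', which is the
    duality of the two classes. *)
Definition main_alpha : Qp := P (iota + kappa%:Z) * tofrac omega.
Definition main_beta : Qp := P (kappa%:Z + iota') * tofrac omega'^-1.

Definition main_coef (k : nat) : Qp :=
  if k == 0%N then 0 else psbinom (- y) main_alpha k / main_beta.

Let p1 : (1 < p)%N. Proof. exact: prime_gt1. Qed.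

Lemma main_betaV : main_beta^-1 = P (- (kappa%:Z + iota')) * tofrac omega'.
Proof.
by rewrite /main_beta tofrac_unitV // invfM invrK -invr_expz.
Qed.

(** The valuation is at least (k-1) kappa, less that of k! when ord y is nonzero, and the latter is
    at most (k-1)/(p-1). This is the origin of kappa - rho_p(y). *)
Lemma main_coef_slope k : rd ((k%:R - 1) * (kappa%:R - rho_at p R y)) (main_coef k).
Proof.
rewrite /main_coef; case: eqVneq => [_|k0]; first exact: rdvd0.
have {}k0 : (0 < k)%N by rewrite lt0n.
have ny : y != 0 by rewrite gt_eqF.
have h1 := pdvd_psbinom hp ny k0.
have h2 : pdvd ((iota + kappa%:Z) *+ k) (main_alpha ^+ k).
  by apply: pdvdX; exists omega.
have h3 : pdvd (- (kappa%:Z + iota')) (main_beta^-1) by rewrite main_betaV; exists omega'.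
rewrite psbinomE; apply: rdvd_pdvd (pdvdM (pdvdM h1 h2) h3).
set L := if _ then _ else _.
have -> : iota' - iota *+ k - L%:Z + (iota + kappa%:Z) *+ k - (kappa%:Z + iota') =
    kappa%:Z *+ k - kappa%:Z - L%:Z by rewrite mulrnDl; ring.
have LE : (L%:R : R) <= (k%:R - 1) * rho_at p R y.
  rewrite /L /rho_at; case: eqVneq => [_|_]; first by rewrite mulr0.
  have p10 : 0 < p%:R - 1 :> R by rewrite subr_gt0 ltr1n.
  rewrite ler_pdivlMr // mulrC.
  have := logn_fact_le hp k0; rewrite -(ler_nat R) natrM.
  by rewrite -!subn1 !natrB ?(ltnW p1).
rewrite mulrBr !intrB rmorphMn /= mulrBl mul1r.
rewrite -[L%:Z%:~R]/(L%:R) -[kappa%:Z%:~R]/(kappa%:R).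
by rewrite -[kappa%:R *+ k]mulr_natl lerB.
Qed.

(** The coefficient is -y alpha/beta, of valuation ord y + iota - iota' = 0. *)
Lemma main_coef1 : exists2 u, u \is a GRing.unit & main_coef 1 = tofrac u.
Proof.
have ny : y != 0 by rewrite gt_eqF.
have [u uu yE] := padic_ratr_unit hp ny.
exists (- (u * omega * omega')); first by rewrite unitrN !unitrM uu uo uo'.
rewrite /main_coef /= psbinomE big_ord1 subr0 divr1 expr1 main_betaV /main_alpha.
rewrite padic_ratrN yE rmorphN !rmorphM /= !mulNr; congr (- _).
have -> : - (kappa%:Z + iota') = - (ordq p y + (iota + kappa%:Z)).
  by rewrite -iota_sub; lia.
rewrite -[P (- _)]invr_expz (padic_expzD hp (ordq p y)).
have := padic_expz_neq0 hp (ordq p y); have := padic_expz_neq0 hp (iota + kappa%:Z).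
move=> h1 h2; exact: field_cancel3.
Qed.

Lemma main_invser k : (0 < k)%N ->
  invser main_coef k = psbinom (- y^-1) main_beta k / main_alpha.
Proof.
move=> k0.
have ny : y != 0 by rewrite gt_eqF.
have rny : ratr (- y) != 0 :> Qp.
  have [u uu yE] := padic_ratr_unit hp ny.
  by rewrite padic_ratrN oppr_eq0 yE mulf_neq0 ?padic_expz_neq0 ?tofrac_unit_neq0.
have a0 : main_alpha != 0 by rewrite mulf_neq0 ?padic_expz_neq0 ?tofrac_unit_neq0.
have b0 : main_beta != 0 by rewrite mulf_neq0 ?padic_expz_neq0 ?tofrac_unit_neq0 ?unitrV.
have [h1 hS] := @binomial_inverse _ (psbinom (- y) main_alpha) main_coef main_alpha
  (ratr (- y)) main_beta a0 rny b0 (psbinom0 _ _) (psbinomS _ _) erefl (fun k => erefl).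
have rV : (ratr (- y))^-1 = ratr (- y^-1) :> Qp by rewrite -padic_ratrV invrN.
case: k k0 => // k _; elim: k => [|k IH].
  by rewrite h1 psbinomE big_ord1 subr0 divr1 expr1 -rV invfM mulrCA mulrA.
have k2 : k.+2%:R != 0 :> Qp by exact: padic_nat_neq0.
apply: (mulfI k2); by rewrite hS // IH [RHS]mulrA psbinomS rV mulrA.
Qed.

End MainTerm.

Lemma field_cancel4 (F : fieldType) (a b c d : F) : a != 0 ->
  a * c * d / (a * b) = d * (b^-1 * c).
Proof. by move=> a0; rewrite -(mulrA a c d) -mulf_div divff // mul1r [c * d]mulrC -mulrA [c / b]mulrC. Qed.

Lemma field_cancel5 (F : fieldType) (a b o x : F) : b != 0 ->
  a * b * (x / (b * o)) = a / o * x.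
Proof. by move=> b0; rewrite invfM [x * _]mulrC -!mulrA mulVKf. Qed.

(** * The dual phase *)

Section DualPhase.
Variables (R : realType) (p : nat) (hp : prime p).
Local Notation Zp := (pint hp).
Local Notation Qp := (padic hp).
Local Notation tofrac := (@FracField.tofrac Zp).
Local Notation rd := (@rdvd R Qp (padic_filtration hp)).
Local Notation P v := (p%:R ^ v : Qp).
Variables (w : int) (u kappa : nat) (lambda : R) (y : rat) (omega omega' : Zp).
Variables (f : nat -> Qp) (gamma0 : Zp) (g : nat -> Zp).

Local Notation iota := (iotap p y).
Local Notation iota' := (iotap' p y).
Local Notation mu := (Num.min (kappa%:R - rho_at p R y) lambda).
Local Notation alpha := (main_alpha kappa y omega).
Local Notation beta := (main_beta kappa y omega').
Local Notation main := (main_coef kappa y omega omega').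

Hypotheses (y0 : 0 < y) (uo : omega \is a GRing.unit) (uo' : omega' \is a GRing.unit).
Hypothesis lP : exists2 l : nat, (0 < l)%N & lambda = rho p R * l%:R.
Hypothesis hg : psI0_slope lambda g.
Hypothesis hder : forall k, psder f k =
      p%:R ^ w * tofrac omega' *
        psbinom (- y) (p%:R ^ (iota + kappa%:Z) * tofrac omega) k
      + (if k == 0%N then p%:R ^ w * tofrac gamma0 else 0)
      + p%:R ^ (u%:Z + w) * tofrac (g k).
Hypothesis hk4 : 1 + iotap' p 4 <= kappa%:Z.
Hypothesis hu : kappa%:Z + iota' < u%:Z + Num.floor lambda.
Hypothesis mu0 : 0 < mu.

Let p1 : (1 < p)%N. Proof. exact: prime_gt1. Qed.
Let pR : 0 < p%:R - 1 :> R. Proof. by rewrite subr_gt0 ltr1n. Qed.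

Definition phase_scale : Qp := P (w + kappa%:Z + iota').
Local Notation c0 := phase_scale.

(** The coefficients of psi'. Removing the constant term takes out the linear phase f'(0) m, which
    becomes the shift of the Fourier transform, and [gamma0] disappears with it. *)
Definition phase_coef (k : nat) : Qp := if k == 0%N then 0 else psder f k / c0.
Local Notation b := phase_coef.

(** The gain in the comparison with the main term: k lambda >= floor(lambda) + (k-1) mu for k >= 1.
    The hypothesis [hu] says D >= 1, so that the perturbation leaves the first coefficient a
    unit. *)
Let D : R := (u%:Z - kappa%:Z - iota' + Num.floor lambda)%:~R.

Let D1 : 1 <= D.
Proof. by rewrite /D -[1]/(1%:~R) ler_int; move: hu; lia. Qed.

Lemma phase_coefE k : (0 < k)%N ->
  b k = main k + P (u%:Z - kappa%:Z - iota') * tofrac (g k).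
Proof.
rewrite lt0n /b /main_coef => k0; rewrite hder (negbTE k0) addr0 main_betaV // -/alpha.
have -> : u%:Z + w = (u%:Z - kappa%:Z - iota') + (w + kappa%:Z + iota') by ring.
rewrite padic_expzD mulrDl [X in _ + X](_ : _ = P (u%:Z - kappa%:Z - iota') * tofrac (g k)).
  congr (_ + _); rewrite /phase_scale -addrA padic_expzD -invr_expz.
  have := padic_expz_neq0 hp w; move: (P w) => a a0.
  exact: field_cancel4.
by rewrite mulrAC mulfK ?padic_expz_neq0.
Qed.

Lemma rho_gt0 : 0 < rho p R. Proof. by rewrite invr_gt0. Qed.

Lemma rho_le1 : rho p R <= 1.
Proof. by rewrite invf_le1 // lerBrDr -(natrD _ 1 1) ler_nat. Qed.

Lemma rho_at_le : 0 <= rho_at p R y <= rho p R.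
Proof. by rewrite /rho_at; case: ifP => _; rewrite ?lexx ?(ltW rho_gt0). Qed.

Lemma kappa_ge : 1 + (if p == 2%N then 2 else 0) <= kappa%:R :> R.
Proof.
have : (1 + (p == 2%N) * 2 <= kappa)%N.
  move: hk4; rewrite /iotap' (ordq_int p (n := 4)) //.
  by case: eqVneq => [->|_]; [have -> : logn 2 4 = 2%N by []; lia | lia].
by rewrite -(ler_nat R) natrD natrM; case: (p == 2%N); rewrite ?mul1r ?mul0r.
Qed.

(** [lambda] is a positive multiple of rho. As for kappa - rho_p(y): if p is odd, kappa >= 1 and rho
    <= 1/2; if p = 2, the hypothesis [hk4] gives kappa >= 3 while rho = 1. *)
Lemma rho_le_mu : rho p R <= mu.
Proof.
rewrite le_min; apply/andP; split; last first.
  by have [l l0 ->] := lP; rewrite ler_peMr ?(ltW rho_gt0) // ler1n.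
have /andP[_ h1] := rho_at_le; have := kappa_ge; have h2 := rho_le1.
case: eqVneq => [_|p2] hk; first by lra.
have h3 : rho p R <= 2^-1.
  rewrite lef_pV2 ?posrE // lerBrDr -(natrD _ 2 1) ler_nat.
  by move: p1 p2; lia.
by lra.
Qed.

Lemma main_slope k : rd ((k%:R - 1) * mu) (main k).
Proof.
case: k => [|k]; first exact: rdvd0.
apply: rdvd_le (main_coef_slope R kappa omega y0 uo' k.+1).
by rewrite ler_wpM2l ?ge_min ?lexx // subr_ge0 ler1n.
Qed.

Lemma phase_main_sub k : rd (D + (k%:R - 1) * mu) (b k - main k).
Proof.
have [->|k0] := posnP k; first by rewrite /b /main_coef /= subrr; exact: pdvd0.
rewrite phase_coefE // [main k + _]addrC addrK.
have gk : pdvd (Num.ceil (k%:R * lambda)) (tofrac (g k)) by apply/pint_ord_ge; exact: hg.2.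
apply: rdvd_pdvd (pdvdM (pdvd_expz hp _) gk).
rewrite /D !intrD -!addrA !lerD2l.
apply: le_trans (ceil_ge _).
have h1 : (Num.floor lambda)%:~R <= lambda by exact: floor_le.
have h2 : (k%:R - 1) * mu <= (k%:R - 1) * lambda.
  by rewrite ler_wpM2l ?ge_min ?lexx ?orbT // subr_ge0 ler1n.
by lra.
Qed.

Lemma phase_slope k : rd ((k%:R - 1) * mu) (b k).
Proof.
rewrite -[b k](subrK (main k)); apply: rdvdD (main_slope k).
by apply: rdvd_le (phase_main_sub k); rewrite lerDr (le_trans _ D1).
Qed.

Lemma phase_coef1 : exists2 v, v \is a GRing.unit & b 1 = tofrac v.
Proof.
have [v uv vE] := main_coef1 kappa y0 uo uo'.
have : pdvd 1 (b 1 - main 1).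
  by apply: pdvd_rdvd (phase_main_sub 1); rewrite !subrr mul0r addr0; exact: lt_le_trans ltr01 D1.
case=> z zE; exists (v + p%:R * z).
  exact: pint_unit_addp.
by rewrite -[b 1](subrK (main 1)) zE vE addrC rmorphD rmorphM /= rmorph_nat.
Qed.

Lemma phase_coef_pdvd0 k : pdvd 0 (b k).
Proof.
case: k => [|k]; first exact: pdvd0.
apply: pdvd_rdvd (phase_slope k.+1).
rewrite -natr1 addrK (@lt_le_trans _ _ 0) // mulr_ge0 // ltW //.
Qed.

Lemma phase_coef_hb k m : (m * p.-1 < k)%N -> pdvd m.+1%:Z (b k.+1).
Proof.
move=> mk; apply: pdvd_rdvd (phase_slope k.+1).
rewrite -natr1 addrK; apply: (@lt_le_trans _ _ (k%:R * rho p R)); last first.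
  by rewrite ler_wpM2l // rho_le_mu.
rewrite ltr_pdivlMr // -addn1 PoszD addrK -[m%:Z%:~R]/(m%:R).
have -> : p%:R - 1 = p.-1%:R :> R by rewrite -subn1 natrB // ltnW.
by rewrite -natrM ltr_nat.
Qed.

(** The extra factor 2 comes from D >= 1 for the perturbation, and for the main term from kappa >=
    3, which makes its slope at least 2. *)
Lemma phase_coef_2 k : p = 2%N -> (1 < k)%N -> pdvd k%:Z (b k).
Proof.
move=> p2 k1; rewrite -[b k](subrK (main k)).
have k0 : 1 <= k%:R :> R by rewrite ler1n ltnW.
apply: pdvdD.
  apply: pdvd_rdvd (phase_main_sub k).
  rewrite intrD -[k%:Z%:~R]/(k%:R) (@lt_le_trans _ _ (1 + (k%:R - 1))) //; first by lra.
  apply: lerD => //; rewrite ler_peMr ?subr_ge0 //.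
  by apply: le_trans rho_le_mu; rewrite /rho p2 (_ : 2 - 1 = 1) ?invr1 //; lra.
apply: pdvd_rdvd (main_coef_slope R kappa omega y0 uo' k).
have /andP[_ h1] := rho_at_le; have h2 := rho_le1.
have h3 : 3 <= kappa%:R :> R by have := kappa_ge; rewrite p2 eqxx; lra.
rewrite intrD -[k%:Z%:~R]/(k%:R).
have k2 : 2 <= k%:R :> R by rewrite ler_nat.
apply: (@lt_le_trans _ _ ((k%:R - 1) * 2)); first by lra.
by rewrite ler_wpM2l ?subr_ge0 //; lra.
Qed.

Lemma phase_coef1_neq0 : b 1 != 0.
Proof. by have [v uv ->] := phase_coef1; exact: tofrac_unit_neq0. Qed.

Lemma phase_coef1V : rd 0 (b 1)^-1.
Proof.
have [v uv ->] := phase_coef1.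
by rewrite -tofrac_unitV //; apply: (rdvd_pdvd (v := 0)) => //; exact: pdvd_tofrac.
Qed.

Definition dual_phase (k : nat) : Qp :=
  if k is k'.+1 then - c0 * invser b k' / k%:R else f 0%N.

Lemma dual_slope k : rd ((k%:R - 1) * mu) (invser b k).
Proof. by apply: rdvd_invser; [exact: phase_slope | exact: phase_coef1V]. Qed.

Lemma dual_main_sub k : rd (D + (k%:R - 1) * mu) (invser b k - invser main k).
Proof.
have [v uv vE] := main_coef1 kappa y0 uo uo'.
apply: rdvd_invser_sub; rewrite ?phase_coef1_neq0 //.
- exact: le_trans D1.
- exact: phase_slope.
- exact: phase_coef1V.
- exact: main_slope.
- by rewrite vE -tofrac_unitV //; apply: (rdvd_pdvd (v := 0)) => //; exact: pdvd_tofrac.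
- by rewrite vE; exact: tofrac_unit_neq0.
- exact: phase_main_sub.
Qed.

Lemma psder_dual k : psder dual_phase k = - c0 * invser b k.
Proof. by rewrite /psder /dual_phase mulrC divfK // padic_nat_neq0. Qed.

Lemma main_dual_coef k : (0 < k)%N ->
  - c0 * invser main k = P (w + ordq p y) * tofrac (- omega^-1) * psbinom (- y^-1) beta k.
Proof.
move=> k0; rewrite main_invser // rmorphN /= tofrac_unitV // mulrN !mulNr; congr (- _).
rewrite /main_alpha /phase_scale.
have -> : w + kappa%:Z + iota' = w + ordq p y + (iota + kappa%:Z).
  by rewrite -iota_sub; ring.
by rewrite (padic_expzD hp (w + ordq p y)); apply/field_cancel5/padic_expz_neq0.
Qed.

Lemma dual_cvg (v : nat) : exists K, forall k, (K <= k)%N -> pdvd v%:Z (dual_phase k).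
Proof.
have [K hK] := slope_log_cvg hp mu0 (v + `|(w + kappa%:Z + iota')%R|)%N.
exists K.+1 => -[//|k] kK; rewrite /dual_phase -mulrA.
have h1 : pdvd (w + kappa%:Z + iota') (- c0) by exact/pdvdN/pdvd_expz.
by apply: pdvd_le (pdvdM h1 (hK k _ kK (dual_slope k))); lia.
Qed.

Lemma mu_rho : exists2 m : nat, (0 < m)%N & mu = rho p R * m%:R.
Proof.
have r0 := rho_gt0.
have rp : rho p R * p.-1%:R = 1.
  by rewrite -subn1 natrB ?(ltnW p1) // mulVf // gt_eqF.
suff [m mE] : exists m : nat, mu = rho p R * m%:R.
  exists m => //; rewrite lt0n; apply: contraTneq mu0 => m0.
  by rewrite mE m0 mulr0 ltxx.
rewrite minElt; case: ifP => _; last by have [l _ lE] := lP; exists l.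
(* Here rho (p-1) = 1, so kappa - rho_p(y) is rho times this natural number. *)
exists (p.-1 * kappa - (ordq p y != 0))%N; rewrite /rho_at.
have k1 : (0 < kappa)%N by move: hk4; rewrite /iotap'; lia.
have pk : (0 < p.-1 * kappa)%N by rewrite muln_gt0 k1 -subn1 subn_gt0 p1.
rewrite natrB; last by case: (_ != 0).
rewrite mulrBr natrM mulrA rp mul1r; case: (ordq p y != 0); by rewrite ?mulr1 ?mulr0.
Qed.

Lemma dual_phaseF : 1 + iotap' p 2 <= kappa%:Z ->
  phaseF (w + ordq p y) y^-1 kappa mu (u%:Z + (Num.floor lambda - Num.ceil mu) - ordq p y)
    omega'^-1 (- omega^-1) dual_phase.
Proof.
move=> hk2; have cm : Num.ceil mu <= kappa%:Z.
  rewrite ceil_le_int ge_min; apply/orP; left.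
  by have /andP[h _] := rho_at_le; rewrite -[kappa%:Z%:~R]/(kappa%:R); lra.
split=> //.
- by move: hu cm; rewrite /iotap'; lia.
- exact: mu_rho.
- by rewrite invr_gt0.
- by rewrite unitrV.
- by rewrite unitrN unitrV.
- exact/psI0_scaled/dual_cvg.
set e := u%:Z + (Num.floor lambda - Num.ceil mu) - ordq p y + (w + ordq p y).
(* The perturbation in the dual class. After multiplication by [c0] the distance to the main inverse
   has valuation at least w + u + floor(lambda) + (k-1) mu, which is at least e + k mu because mu <=
   ceil(mu). *)
pose x k := P (- e) * (- c0 * (invser b k - invser main k)).
have xs k : rd (k%:R * mu) (x k).
  rewrite /x mulrA mulrN mulNr; apply: rdvdN; rewrite /phase_scale -padic_expzD.
  apply: rdvd_le (rdvdM (r := (- e + (w + kappa%:Z + iota'))%:~R) _ (dual_main_sub k)).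
    rewrite addrA /D -intrD.
    have -> : - e + (w + kappa%:Z + iota') + (u%:Z - kappa%:Z - iota' + Num.floor lambda) =
        Num.ceil mu by rewrite /e; ring.
    by rewrite mulrBl mul1r addrCA lerDl subr_ge0 ceil_ge.
  by apply: (rdvd_pdvd (v := - e + (w + kappa%:Z + iota'))) => //; exact: pdvd_expz.
have xz k : exists z : Zp, tofrac z = x k.
  have : pdvd 0 (x k).
    apply: pdvd_rdvd (xs k); rewrite (@lt_le_trans _ _ 0) // mulr_ge0 // ltW //.
  by case=> z ->; exists z; rewrite expr0z mul1r.
have [gd gdE] := choice xz.
(* The critical point is 0 at t = 0, so the additive constant of the dual class has to cancel its
   binomial term there, whose unit is -omega^-1. *)
exists omega^-1, gd; split.
  split=> [|k]; last by apply/pint_ord_ge; rewrite gdE; exact: xs.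
  apply/padic_cvgP => v; have [K hK] := slope_cvg mu0 xs v.
  by exists K => k kK; rewrite subr0 gdE; exact: hK.
move=> k; have -> : P e * tofrac (gd k) = - c0 * (invser b k - invser main k).
  by rewrite gdE /x mulrA padic_expz_cancel mul1r.
rewrite psder_dual.
have -> : P (iotap p y^-1 + kappa%:Z) * tofrac omega'^-1 = beta.
  by rewrite /main_beta /iotap ordqV opprK addrC.
case: eqVneq => [->|k0]; last by rewrite addr0 -main_dual_coef ?lt0n // mulrBr addrC subrK.
by rewrite psbinom0 !invser0 subrr !mulr0 addr0 mulr1 rmorphN mulrN addNr.
Qed.

Local Notation psi M := (\poly_(k < M.+1) (if k is k'.+1 then b k' / k%:R else 0)).

Lemma phase_partial M (x : Qp) : (0 < M)%N ->
  \sum_(k < M.+1) f k * x ^+ k = f 0%N + f 1%N * x + c0 * (psi M).[x].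
Proof.
case: M => // M _.
have step (k : nat) : (k < M)%N -> c0 * ((psi M.+1)`_k.+2 * x ^+ k.+2) = f k.+2 * x ^+ k.+2.
  move=> kM; rewrite coef_poly !ltnS kM mulrA; congr (_ * _).
  have c00 : c0 != 0 by exact: padic_expz_neq0.
  have n0 : k.+2%:R != 0 :> Qp by exact: padic_nat_neq0.
  by rewrite /b /psder [_ / c0]mulrC mulrA mulrA mulfV // mul1r mulrC mulKf.
have e0 : c0 * ((psi M.+1)`_0 * x ^+ 0) = 0 by rewrite coef_poly mul0r mulr0.
have e1 : c0 * ((psi M.+1)`_1 * x ^+ 1) = 0.
  by rewrite coef_poly /b mul0r mul0r mulr0.
rewrite (horner_coef_wide _ (size_poly _ _)) mulr_sumr.
rewrite [LHS]big_ord_recl [X in _ + X = _]big_ord_recl.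
rewrite [X in _ = _ + X]big_ord_recl [X in _ = _ + (_ + X)]big_ord_recl.
rewrite [X in _ = _ + (X + _)]e0 [X in _ = _ + (_ + (X + _))]e1 !add0r addrA.
rewrite expr0 mulr1; congr (_ + _).
by apply: eq_bigr => k _; apply/esym/step.
Qed.

Lemma dual_partial n (t : Qp) :
  \sum_(k < n.+2) dual_phase k * t ^+ k = f 0%N +
    c0 * (\poly_(k < n.+2) (if k is k'.+1 then - invser b k' / k%:R else 0)).[t].
Proof.
set L := \poly_(k < _) _.
have step (k : nat) : (k < n.+1)%N -> dual_phase k.+1 * t ^+ k.+1 = c0 * (L`_k.+1 * t ^+ k.+1).
  move=> kn; rewrite coef_poly ltnS kn mulrA; congr (_ * _).
  by rewrite /dual_phase mulrA mulrN mulNr.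
have e0 : c0 * (L`_0 * t ^+ 0) = 0 by rewrite coef_poly mul0r mulr0.
rewrite (horner_coef_wide _ (size_poly _ _)) mulr_sumr.
rewrite [LHS]big_ord_recl [X in _ = _ + X]big_ord_recl [X in _ = _ + (X + _)]e0 add0r.
rewrite expr0 mulr1; congr (_ + _).
by apply: eq_bigr => k _; apply: step.
Qed.
Lemma dual_coef_pdvd0 k : pdvd 0 (invser b k).
Proof.
case: k => [|k]; first by rewrite invser0; exact: pdvd0.
apply: pdvd_rdvd (dual_slope k.+1).
rewrite -natr1 addrK (@lt_le_trans _ _ 0) // mulr_ge0 // ltW //.
Qed.

(** The point is the value at t of the truncated formal inverse. All identities hold formally up to
    degree n, and in higher degrees the coefficients are divisible by p^N once n exceeds [K]. The
    bounds [n0] and [M0] leave room for the truncations of [f] and of its dual. *)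
Lemma critical_points (N n0 M0 : nat) : exists M n, [/\ (M0 <= M)%N, (n0 <= n)%N &
  forall t : int, exists X : Qp, [/\ pdvd 0 X, pdvd N%:Z ((psi M)^`().[X] - t%:~R) &
    pdvd N%:Z ((psi M).[X] - t%:~R * X -
      (\poly_(k < n.+2) (if k is k'.+1 then - invser b k' / k%:R else 0)).[t%:~R])]].
Proof.
have [K hK] := slope_log_cvg hp mu0 N.
pose n := maxn n0 K; pose M := maxn M0 n.+1; exists M, n.
have nM : (n < M)%N by rewrite /M; lia.
have char0 k : k.+1%:R != 0 :> Qp by exact: padic_nat_neq0.
split; [exact: leq_maxl | exact: leq_maxl | move=> t].
have t0 : pdvd 0 (t%:~R : Qp) by exact: pdvd_int.
exists (invp b n).[t%:~R]; split.
- apply: pdvd_horner => // k; rewrite invpE coef_poly; case: ifP => _; last exact: pdvd0.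
  exact: dual_coef_pdvd0.
- rewrite deriv_antiderivative // -horner_comp -[X in _ - X]hornerX -hornerN -hornerD.
  apply: pdvd_horner => // k.
  have := invp_comp phase_coef1_neq0 (erefl : b 0 = 0) nM; move/dvdXP.
  have [kn /(_ k kn) ->|kn _] := ltnP k n.+1; first exact: pdvd0.
  have b' j : rd (0 + (j%:R - 1) * mu) (b j) by rewrite add0r; exact: phase_slope.
  have sY := sloped_invp n phase_slope phase_coef1V.
  have s1 : rd ((k%:R - 1) * mu) ((trunc b M \Po invp b n) - 'X)`_k.
    have s2 := sloped_comp (sloped_trunc M b') sY k.
    rewrite coefB; apply: rdvdB; first by rewrite add0r in s2.
    rewrite coefX; case: eqVneq => [->|_]; last exact: rdvd0.
    by rewrite subrr mul0r; exact: rdvd1.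
  have kK : (K <= k)%N by move: kn; rewrite /n; lia.
  by rewrite -[X in pdvd _ X](divfK (char0 k)); apply: pdvdMr (hK k _ kK s1) (pdvd_nat hp _).
- have leg := legendre_poly (n := n) (M := M) char0 (erefl : b 0 = 0) phase_coef1_neq0
    phase_slope phase_coef1V nM.
  rewrite -horner_comp -[X in _ - X * _]hornerX -hornerM -!hornerN -!hornerD.
  apply: pdvd_horner => // k; have := leg k.
  case: ifP => [_ ->|kn [c hc ->]]; first exact: pdvd0.
  case: k hc kn => // k hc; rewrite ltnS => /negbT; rewrite -ltnNge => kn.
  apply: hK; first by move: kn; rewrite /n; lia.
  by move: hc; rewrite -natr1 -addrA (_ : 1 - 2 = -1) //; ring.
Qed.

Lemma phase_eval (n : nat) : exists M0, forall M (m : int), (M0 <= M)%N ->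
  pdvd n%:Z (pseval f m%:~R - (f 0%N + f 1%N * m%:~R + c0 * (psi M).[m%:~R])).
Proof.
have fcvg v : exists K, forall k, (K <= k)%N -> pdvd v%:Z (f k).
  have [K hK] := slope_log_cvg hp mu0 (v + `|(w + kappa%:Z + iota')%R|)%N.
  exists K.+2 => -[//|[//|k]] kK.
  have -> : f k.+2 = c0 * (b k.+1 / k.+2%:R).
    have c00 : c0 != 0 by exact: padic_expz_neq0.
    have k0 : k.+2%:R != 0 :> Qp by exact: padic_nat_neq0.
    by rewrite /b /psder [_ / c0]mulrC mulrA mulrA mulfV // mul1r mulrC mulKf.
  have kK' : (K <= k.+1)%N by lia.
  by apply: pdvd_le (pdvdM (pdvd_expz hp _) (hK k.+1 _ kK' (phase_slope k.+1))); lia.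
have [K hK] := fcvg n; exists K.+1 => M m KM.
rewrite -phase_partial; last by lia.
by apply: (pseval_trunc fcvg hK); [lia | exact: pdvd_int].
Qed.

Lemma dual_eval (n : nat) : exists n0, forall j (t : int), (n0 <= j)%N ->
  pdvd n%:Z (pseval dual_phase t%:~R - (f 0%N +
    c0 * (\poly_(k < j.+2) (if k is k'.+1 then - invser b k' / k%:R else 0)).[t%:~R])).
Proof.
have [K hK] := dual_cvg n; exists K => j t Kj.
rewrite -dual_partial; apply: (pseval_trunc dual_cvg hK); last exact: pdvd_int.
by lia.
Qed.

End DualPhase.

(** * Assembly of the summation formula *)

Section ValueShifts.
Variables (F : comNzRingType) (a b c d k m x : F).

Lemma sub_dual_value : a - (b + c * d) - c * (x - d) = a - (b + c * x).
Proof. by ring. Qed.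

Lemma sub_linear_term : a - (b + d * m + c * k) - (x - d) * m = a - (b + x * m + c * k).
Proof. by ring. Qed.

End ValueShifts.

Section FinalAssembly.
Variables (R : realType) (p : nat) (hp : prime p).
Local Notation Zp := (pint hp).
Local Notation Qp := (padic hp).
Local Notation tofrac := (@FracField.tofrac Zp).
Local Notation P v := (p%:R ^ v : Qp).
Local Notation e := (@expi_padic R p hp).

(** [w] may be negative, whereas the character is computed on an integer over a natural power of p;
    multiplying both sides of the fraction by p^|w| clears the sign. *)
Lemma expz_div_exp (F : fieldType) (x b m : F) (w : int) (n : nat) : x != 0 ->
  x ^ w * b * m / x ^+ n = b * m * x ^+ `|(w + `|w|)%R|%N / x ^+ (n + `|w|).
Proof.
move=> x0; rewrite -mulrA mulrC; apply/eqP; rewrite mulrAC eqr_div ?expf_neq0 //; apply/eqP.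
have -> : m * (x ^ w * b) * x ^+ (n + `|w|) = b * m * (x ^ w * x ^+ (n + `|w|)) by ring.
rewrite -[RHS]mulrA; congr (_ * _).
by rewrite !exprnP -!expfzDr //; congr (_ ^ _); lia.
Qed.

Lemma expi_padic_linear (n : nat) (w b m : int) :
  e (P w * b%:~R * m%:~R / p%:R ^+ n) =
  expi (p%:R ^ w * b%:~R * m%:~R / p%:R ^+ n : R).
Proof.
have pq : p%:R != 0 :> Qp by exact: padic_natp_neq0.
have pr : p%:R != 0 :> R by rewrite pnatr_eq0 -lt0n prime_gt0.
have intE (F : fieldType) (i : nat) :
    b%:~R * m%:~R * p%:R ^+ i = (b * m * p%:Z ^+ i)%:~R :> F.
  by rewrite !intrM rmorphXn.
by rewrite !expz_div_exp // !intE -(expi_padic_frac R hp).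
Qed.

Lemma ratr_expz_int (w b : int) : ratr (p%:R ^ w * b%:~R) = P w * b%:~R.
Proof. by rewrite padic_ratrM padic_ratrXz ratr_int. Qed.

Lemma pseval_at0 (f : nat -> Qp) (v : nat) : pdvd v%:Z (pseval f 0 - f 0%N).
Proof.
have cv (m : nat) : exists n0, forall k, (n0 <= k)%N -> pdvd m%:Z (f k * 0 ^+ k).
  by exists 1%N => -[//|k] _; rewrite exprS mul0r mulr0; exact: pdvd0.
have [n0 h] := pseval_partial cv v.
have := h n0.+1 (leqnSn _); rewrite big_ord_recl expr0 mulr1 big1 ?addr0 // => i _.
by rewrite exprS mul0r mulr0.
Qed.

Lemma pdvd_div_exp v (n : nat) x : pdvd (v + n%:Z) x -> pdvd v (x / p%:R ^+ n : Qp).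
Proof.
by move=> h; rewrite mulrC exprnN -[v](addrK n%:Z); apply/pdvd_mul_expz.
Qed.

Lemma dftZ q (phi : int -> R[i]) (c : R[i]) t :
  dft q (fun m => c * phi m) t = c * dft q phi t.
Proof.
by rewrite /dft [RHS]mulrCA [X in _ = _ * X]mulr_sumr; congr (_ * _); apply: eq_bigr => x _; rewrite -mulrA.
Qed.

Lemma sqrt_exp_powR (N : nat) (B : R) :
  B / Num.sqrt (p ^ N)%:R = B / p%:R `^ (N%:Z%:~R / 2).
Proof.
by congr (_ / _); rewrite powRrM -[N%:Z%:~R]/(N%:R) powR_mulrn ?ler0n // powR12_sqrt ?natrX //.
Qed.

End FinalAssembly.

Theorem theorem3 (R : realType) (p : nat) (hp : prime p)
    (w : int) (u kappa : nat) (lambda : R) (y : rat) (omega omega' : pint hp)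
    (f : nat -> padic hp) :
  let lambda_t : R := Num.min (kappa%:R - rho_at p R y) lambda in
  let eps_lambda : int := Num.floor lambda - Num.ceil lambda_t in
  phaseF w y kappa lambda u%:Z omega omega' f ->
  1 + iotap' p 4 <= kappa%:Z ->
  kappa%:Z + iotap' p y < u%:Z + Num.floor lambda ->
  0 < lambda_t ->
  exists2 fo : nat -> padic hp,
    phaseF (w + ordq p y) y^-1 kappa lambda_t (u%:Z + eps_lambda - ordq p y)
      omega'^-1 (- omega^-1) fo &
    forall (n : nat) (B : R) (h : R -> R[i]),
      (0 < n)%N -> 0 < B -> schwartz h ->
      kappa%:Z + iotap' p y + iotap' p 12 < n%:Z - w ->
      let N : int := n%:Z - w - iotap' p y - kappa%:Z in
      exists2 eps : R[i], `|eps| = 1 &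
        forall a : rat,
          (exists b : int, a = p%:R ^ w * b%:~R) ->
          (exists z : pint hp,
             ratr a - pseval (psder f) 0 = p%:R ^+ n * FracField.tofrac z) ->
          let hhat_fB (t : R) : R[i] :=
            fourier h (- t - ratr a / (p%:R ^+ n / B)) in
          let lhs (m : int) : R[i] :=
            expi_padic R (pseval f m%:~R / p%:R ^+ n) * h (m%:~R / B) in
          let rhs (t : int) : R[i] :=
            expi_padic R (pseval fo t%:~R / p%:R ^+ n) *
            hhat_fB (t%:~R / (p%:R ^ N / B)) in
          [/\ zsummable lhs, zsummable rhs &
              zsum lhs =
                eps * real_complex R (B / p%:R `^ (N%:~R / 2)) * zsum rhs].
Proof.
move=> mu elam fF hk4 hu mu0.
have [_ hk2 lP y0 uo uo' _ [gamma0 [g [hg hder]]]] := fF.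
exists (dual_phase w kappa y f).
  exact: (dual_phaseF y0 uo uo' lP hg hder hk4 hu mu0 hk2).
move=> n B h n0 B0 Sh hn N.
have [k1 hk1] := phase_eval y0 uo uo' hg hder hk4 hu mu0 n.
have [k2 hk2'] := dual_eval y0 uo uo' hg hder hk4 hu mu0 n.
have i12 : 0 <= iotap' p 12 by rewrite /iotap'; lia.
have [N0 NE] : exists N0 : nat, N = N0%:Z.
  by exists `|N|%N; rewrite /N; move: hn i12; lia.
have nE : w + kappa%:Z + iotap' p y + N0%:Z = n%:Z by rewrite -NE /N; ring.
(* At p = 2 the term iota'(12) equals 2, which gives the bound on N that [phase_bounds] requires. *)
have hN2 : p = 2%N -> (2 < N0)%N.
  move=> p2; suff h12 : iotap' p 12 = 2 by move: hn NE; rewrite h12 /N; lia.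
  by rewrite /iotap' (ordq_int p (n := 12)) // p2.
have [M [j [Mk1 jk2 hX]]] := critical_points y0 uo uo' hg hder hk4 hu mu0 N0 k2 (maxn k1 2).
have [X XP] := choice hX.
set psi := \poly_(k < M.+1) _ in XP hX.
have [s [r [sr rs co fi]]] := phase_bounds
  (phase_coef_hb y0 uo uo' lP hg hder hk4 hu mu0)
  (phase_coef_pdvd0 y0 uo uo' hg hder hk4 hu mu0)
  (fun p2 k => phase_coef_2 y0 uo uo' lP hg hder hk4 hu mu0 p2) M hN2.
have psi00 : psi`_0 = 0 by rewrite coef_poly.
have psi10 : psi`_1 = 0 by rewrite coef_poly /phase_coef eqxx mul0r if_same.
have [v uv vE] := phase_coef1 y0 uo uo' hg hder hk4 hu mu0.
have psi2 : psi`_2 *+ 2 = FracField.tofrac v.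
  rewrite coef_poly ltnS (leq_trans _ Mk1) ?leq_maxr // vE -[_ *+ 2]mulr_natr divfK //.
  exact: padic_nat_neq0.
have psi3 k : (2 < k)%N -> pdvd 1 (psi`_k *+ k).
  rewrite coef_poly; case: ifP => _; last by rewrite mul0rn => _; exact: pdvd0.
  case: k => [|[|k]] // k0; rewrite -[_ *+ k.+2]mulr_natr divfK ?padic_nat_neq0 //.
  exact: (phase_coef_hb y0 uo uo' lP hg hder hk4 hu mu0 (m := 0)).
have X0 t : pdvd 0 (X t) by have [] := XP t.
have Xt t : pdvd N0%:Z (psi^`().[X t] - t%:~R) by have [] := XP t.
have [eps eps1 epsE] := stationary_phase R sr rs psi00 psi10 co fi uv psi2 psi3 X0 Xt.
exists eps => // a [b aE] [z az] hhat lhs rhs.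
pose e := @expi_padic R p hp; pose c0 := phase_scale hp w kappa y.
(* The scale [c0] is p^(n-N), so it turns the modulus p^n into p^N. *)
have pn x : c0 * x / p%:R ^+ n = x / p%:R ^+ N0.
  rewrite /c0 /phase_scale.
  have -> : p%:R ^+ n = p%:R ^ (w + kappa%:Z + iotap' p y) * p%:R ^+ N0 :> padic hp.
    rewrite !exprnP -expfzDr ?padic_natp_neq0 //; congr (_ ^ _).
    by rewrite nE.
  by rewrite -mulf_div divff ?mul1r // padic_expz_neq0.
pose q := (p ^ N0)%N.
pose C := e (f 0%N / p%:R ^+ n).
pose K := eps / real_complex R (Num.sqrt q%:R).
(* f(0) enters through the constant [C] and the linear part of [f] through [al]; what remains of the
   phase has period p^N in m. *)
pose phi (m : int) := C * e (psi.[m%:~R] / p%:R ^+ N0).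
have qR : 0 < q%:R :> R by rewrite ltr0n expn_gt0 prime_gt0.
have eE x x' : pdvd n%:Z (x - x') -> e (x / p%:R ^+ n) = e (x' / p%:R ^+ n).
  move=> xx; apply: expi_padic_eq; rewrite -mulrBl; apply: pdvd_div_exp.
  by rewrite add0r.
have phiP m : phi (m + q%:Z) = phi m.
  by congr (_ * _); exact: (phase_periodic R sr psi10 co psi2 psi3).
have phi1 m : `|phi m| = 1 by rewrite normrM !norm_expi_padic mulr1.
have K0 : K != 0.
  by rewrite -normr_gt0 normf_div eps1 div1r invr_gt0 normr_gt0 fmorph_eq0 gt_eqF // sqrtr_gt0.
have GK t : dft q phi t = K * e (pseval (dual_phase w kappa y f) t%:~R / p%:R ^+ n).
  rewrite dftZ epsE mulrCA -/K; congr (_ * _).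
  (* The dual phase is f(0) plus [c0] times the critical value modulo p^n: the critical value is
     known modulo p^N, and [c0] supplies the remaining factor p^(n-N). *)
  have -> : e (pseval (dual_phase w kappa y f) t%:~R / p%:R ^+ n) =
      e ((f 0%N + c0 * (psi.[X t] - t%:~R * X t)) / p%:R ^+ n).
    apply: eE; have [_ _ hL] := XP t.
    have hc : pdvd n%:Z (c0 * (psi.[X t] - t%:~R * X t -
      (\poly_(k < j.+2) (if k is k'.+1 then - invser (phase_coef w kappa y f) k' / k%:R else 0)).[t%:~R])).
      by rewrite -nE; apply: pdvdM hL; exact: pdvd_expz.
    have := pdvdB (hk2' j t jk2) hc; congr (pdvd _ _).
    exact: sub_dual_value.
  by rewrite [X in _ = e X]mulrDl pn /e expi_padicD.
pose al : R := ratr a / p%:R ^+ n.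
have lhsE : lhs = (fun m => phi m * expi (al * m%:~R) * h (m%:~R / B)).
  apply/funext => m; rewrite /lhs; congr (_ * _).
  (* [a] and f'(0) agree modulo p^n, so exchanging them in the linear term does not change the
     character at any integer m. *)
  have haf : pdvd n%:Z (ratr a - f 1%N).
    have := pdvdD (pseval_at0 (psder f) n) (ex_intro _ z az : pdvd n%:Z _).
    by rewrite addrC subrKA /psder mul1r.
  have -> : expi_padic R (pseval f m%:~R / p%:R ^+ n) =
      e ((f 0%N + ratr a * m%:~R + c0 * psi.[m%:~R]) / p%:R ^+ n).
    apply: eE; have k1M : (k1 <= M)%N by apply: leq_trans Mk1; exact: leq_maxl.
    have := pdvdB (hk1 M m k1M) (pdvdMr haf (pdvd_int hp m)); congr (pdvd _ _).
    exact: sub_linear_term.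
  rewrite [X in e X = _]mulrDl [X in e (X + _) = _]mulrDl pn /e !expi_padicD /phi [RHS]mulrAC; congr (_ * _ * _).
  have ar : ratr a = p%:R ^ w * b%:~R :> R.
    by rewrite aE rmorphM /= ratr_int (char0_ratrXz (@pnatr_eq0 R)).
  by rewrite [in LHS]aE ratr_expz_int expi_padic_linear /al ar mulrAC.
have rhsE : rhs = (fun t => e (pseval (dual_phase w kappa y f) t%:~R / p%:R ^+ n) *
    fourier h (- (t%:~R / (q%:R / B)) - al * B)).
  apply/funext => t; rewrite /rhs /hhat NE -exprnP /q natrX; congr (_ * fourier h (_ - _)).
  by rewrite /al invf_div mulrA mulrAC.
have [S1 S2 S3] := twisted_poisson_scaled al (ltac:(by rewrite expn_gt0 prime_gt0) : (0 < q)%N)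
  phiP phi1 K0 GK B0 Sh.
split; rewrite ?lhsE ?rhsE // S3; congr (_ * _).
rewrite NE -sqrt_exp_powR rmorphM /= fmorphV /= /K -mulrA; congr (_ * _).
by rewrite mulrC.
Qed.
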